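(* For any integer $n\geq 4$ there exists a proper algebraic subset $\Sigma\subset \mathbb{CP}^{2n+1}$ such that for any rational function $$P(z)=\frac{a_nz^n+a_{n-1}z^{n-1}+\dots+a_0}{b_nz^n+b_{n-1}z^{n-1}+\dots+b_0}$$ with complex coefficients satisfying $(a_n,\dots,a_0,b_n,\dots,b_0)\notin\Sigma$, the following holds: if $P(f)=cP(g)$ for some $c\in\mathbb C$ and some non-constant functions $f,g$ meromorphic on $\mathbb C$, then $c=1$ and $f\equiv g$.
   Context: The tuple $(a_n,\dots,a_0,b_n,\dots,b_0)$ is identified with the point $[a_n:\dots:a_0:b_n:\dots:b_0]$ of $\mathbb{CP}^{2n+1}$. A proper algebraic subset is a Zariski closed subset different from the whole space. *)

(* Defs.v *)
From HB Require Import structures.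
From mathcomp Require Import all_boot all_order all_algebra.
From mathcomp Require Import all_classical all_reals all_analysis.
From mathcomp Require Import complex.
(* The notations of mpoly clash with those of analysis. *)
From mathcomp Require Import -(notations) mpoly.

Set Implicit Arguments.
Unset Strict Implicit.
Unset Printing Implicit Defensive.

Import Order.TTheory GRing.Theory Num.Theory.
Import numFieldNormedType.Exports.

Local Open Scope classical_set_scope.
Local Open Scope ring_scope.

(* R[i] is repackaged so that the topology and normed module structures that
   analysis provides for every numClosedFieldType are found by unification. *)
Definition Cplx (R : realType) : numClosedFieldType := R[i].

(* Points of CP^N are the lines through the origin of C^(N+1). *)
Definition CP (R : realType) (N : nat) : Type :=
  {L : {vspace 'rV[Cplx R]_N.+1} | \dim L == 1%N}.

(* x is the point with homogeneous coordinates [v_0 : ... : v_N]; in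
   particular v != 0, because the line x has dimension 1. *)
Definition has_hcoords (R : realType) (N : nat) (x : CP R N)
    (v : 'rV[Cplx R]_N.+1) : Prop :=
  val x = <[v]>%VS.

(* Common zero locus in CP^N of a family F of homogeneous polynomials. *)
Definition proj_zeros (R : realType) (N : nat)
    (F : set (mpoly N.+1 (Cplx R))) : set (CP R N) :=
  [set x | forall P, F P -> forall v, has_hcoords x v ->
             meval (fun i => v 0 i) P = 0].

Definition algebraic_subset (R : realType) (N : nat) (S : set (CP R N)) : Prop :=
  exists F : set (mpoly N.+1 (Cplx R)),
    (forall P, F P -> exists d : nat, P \is ishomog1 d (@mdeg N.+1))
    /\ S = proj_zeros F.

Definition proper_algebraic_subset (R : realType) (N : nat)
    (S : set (CP R N)) : Prop :=
  algebraic_subset S /\ S <> setT.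

(* The coefficient vector (a_n, ..., a_0, b_n, ..., b_0) of a pair of
   polynomials p = sum a_i X^i and q = sum b_i X^i of degree at most n. *)
Definition coef_row (R : realType) (n : nat) (p q : {poly Cplx R}) :
    'rV[Cplx R]_(2 * n + 1).+1 :=
  \row_(i < (2 * n + 1).+1)
    if (i <= n)%N then p`_(n - i) else q`_(2 * n + 1 - i).

(* A function C -> option C takes the value None at its poles. *)
Definition finite_part (R : realType) (f : Cplx R -> option (Cplx R))
    (z : Cplx R) : Cplx R :=
  odflt 0 (f z).

Definition finite_derivable (R : realType) (f : Cplx R -> option (Cplx R))
    (z : Cplx R) : Prop :=
  isSome (f z) /\ derivable (finite_part f) z 1.

Definition holomorphic_at (R : realType) (f : Cplx R -> option (Cplx R))
    (z0 : Cplx R) : Prop :=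
  \forall z \near z0, finite_derivable f z.

Definition pole_at (R : realType) (f : Cplx R -> option (Cplx R))
    (z0 : Cplx R) : Prop :=
  [/\ f z0 = None,
      \forall z \near z0^', finite_derivable f z &
      `|finite_part f z| @[z --> z0^'] --> +oo].

Definition meromorphic (R : realType) (f : Cplx R -> option (Cplx R)) : Prop :=
  forall z0, holomorphic_at f z0 \/ pole_at f z0.

Definition nonconstant (R : realType) (f : Cplx R -> option (Cplx R)) : Prop :=
  ~ exists w, forall z, f z = w.

(* P(f) for P = p / q, left undefined (None) wherever f has a pole or q(f)
   vanishes, including at the removable singularities of P(f). *)
Definition rat_comp (R : realType) (p q : {poly Cplx R})
    (f : Cplx R -> option (Cplx R)) (z : Cplx R) : option (Cplx R) :=
  if f z is Some w then if q.[w] == 0 then None else Some (p.[w] / q.[w])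
  else None.

Definition scale_fun (R : realType) (c : Cplx R)
    (u : Cplx R -> option (Cplx R)) (z : Cplx R) : option (Cplx R) :=
  omap ( *%R c) (u z).

(* Equality as meromorphic functions, i.e. off a closed discrete set, so that
   the points where rat_comp is left undefined play no role (for q != 0 and f
   meromorphic nonconstant these points form a closed discrete set). *)
Definition mero_eq (R : realType) (u v : Cplx R -> option (Cplx R)) : Prop :=
  forall z0, \forall z \near z0^', u z = v z.

(* Main.v *)
Require Import Defs.
From mathcomp Require Import all_boot all_order all_algebra.
From mathcomp Require Import all_classical all_reals all_analysis.
From mathcomp Require Import complex.
From mathcomp Require Import -(notations) mpoly.
From mathcomp Require Import separable ring lra zify.

Import Order.TTheory GRing.Theory Num.Theory.
Import numFieldNormedType.Exports.

Set Implicit Arguments.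
Unset Strict Implicit.
Unset Printing Implicit Defensive.

Local Open Scope classical_set_scope.
Local Open Scope ring_scope.

(** With P = p / q of degree n and W = p' q - p q', two functions f, g such that
    P(f) = c P(g) parametrize the curve P(x) = c P(y). For generic (p, q) this
    curve is smooth when c <> 1 up to at most one node (x0, y0), and when c = 1
    it is smooth off the diagonal, which is met transversally. With
    A = 1, x - x0 or x - y respectively, A q(y) dx / (q(x) W(y)) is a regular form,
    at infinity too because n >= 4; pulling it back by (f, g) gives h dz with
      u = |h|^2 (1 + |f|^2) (1 + |g|^2) <= K (f#^2 + g#^2),
    where f# is the spherical derivative of f. So u behaves like a metric of negative
    curvature, and the Ahlfors argument (maximize u (r^2 - |z - a|^2)^2 and let
    r go to infinity) gives u = 0. Hence f is constant, unless c = 1 and f = g.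

    A pair (p, q) that is not generic satisfies a system of linear equations
    whose coefficients depend on fewer parameters than there are independent
    equations. Its coefficient vector then lies in the image of a polynomial map
    of too few variables, on which some nonzero polynomial vanishes. *)

(** * Complex numbers as pairs of reals *)

(** The form is a Poincare residue. On the curve F(x, y) = p(x) q(y) - c p(y) q(x) = 0 the
    derivative of F in y equals - c q(x) W(y) / q(y), so the form of the overview is A dx / F_y up
    to a constant factor. On a smooth curve of bidegree (n, n), L dx / F_y is regular when L has
    bidegree at most (n - 2, n - 2). The density u is the sum of the squared moduli of the pullbacks
    for L = A, x A, y A and x y A. As A has degree at most 1 in each variable, L has bidegree at
    most (2, 2), whence 4 <= n. A singular point of the curve is a pair of critical points of p / q,
    where W(x) = W(y) = 0. It is harmless if A vanishes there, and an affine A can be made to vanish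
    at one point or along the diagonal: this dictates what generic has to mean. Neither the curve
    nor its normalization is constructed; only a pointwise estimate along the relation between f and
    g is used. Likewise no Laplacian is taken: the maximum principle for a holomorphic comparison
    function replaces the curvature computation. *)

Section ComplexPlane.
Context {R : realType}.
Local Notation C := (Cplx R).

Definition re (z : C) : R := complex.Re (z : R[i]).
Definition im (z : C) : R := complex.Im (z : R[i]).
Definition pt (x y : R) : C := Complex x y.
Definition nm (z : C) : R := ComplexField.Normc.normc (z : R[i]).
Definition cc (z : C) : C := conjc (z : R[i]).

Lemma ptE z : pt (re z) (im z) = z. Proof. by case: z. Qed.
Lemma re_pt x y : re (pt x y) = x. Proof. by []. Qed.
Lemma im_pt x y : im (pt x y) = y. Proof. by []. Qed.
Lemma eqC (z w : C) : re z = re w -> im z = im w -> z = w.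
Proof. by case: z; case: w => a b c d /= -> ->. Qed.
Lemma reD z w : re (z + w) = re z + re w. Proof. by case: z; case: w. Qed.
Lemma imD z w : im (z + w) = im z + im w. Proof. by case: z; case: w. Qed.
Lemma reN z : re (- z) = - re z. Proof. by case: z. Qed.
Lemma imN z : im (- z) = - im z. Proof. by case: z. Qed.
Lemma reB z w : re (z - w) = re z - re w. Proof. by rewrite reD reN. Qed.
Lemma imB z w : im (z - w) = im z - im w. Proof. by rewrite imD imN. Qed.
Lemma reM z w : re (z * w) = re z * re w - im z * im w.
Proof. by case: z; case: w. Qed.
Lemma imM z w : im (z * w) = re z * im w + im z * re w.
Proof. by case: z; case: w. Qed.
Lemma ptD x y x' y' : pt x y + pt x' y' = pt (x + x') (y + y').
Proof. by []. Qed.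

Lemma normE (z : C) : `|z| = pt (nm z) 0. Proof. by []. Qed.
Lemma nm_ge0 z : 0 <= nm z.
Proof. by case: z => a b; exact: sqrtr_ge0. Qed.
Lemma nmE z : nm z = Num.sqrt (re z ^+ 2 + im z ^+ 2).
Proof. by case: z. Qed.
Lemma sqr_nm z : nm z ^+ 2 = re z ^+ 2 + im z ^+ 2.
Proof. by rewrite nmE sqr_sqrtr// addr_ge0 ?sqr_ge0. Qed.
Lemma nmM z w : nm (z * w) = nm z * nm w.
Proof. exact: ComplexField.Normc.normcM. Qed.
Lemma nmD z w : nm (z + w) <= nm z + nm w.
Proof. exact: le_normcD. Qed.
Lemma nmN z : nm (- z) = nm z.
Proof. by rewrite !nmE reN imN !sqrrN. Qed.
Lemma nmBC z w : nm (z - w) = nm (w - z).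
Proof. by rewrite -nmN opprB. Qed.
Lemma nmB z w : nm (z - w) <= nm z + nm w.
Proof. by rewrite (le_trans (nmD _ _))// nmN. Qed.
Lemma nm0 : nm 0 = 0. Proof. exact: ComplexField.Normc.normc0. Qed.
Lemma nm1 : nm 1 = 1. Proof. exact: ComplexField.Normc.normc1. Qed.
Lemma nmV z : nm z^-1 = (nm z)^-1. Proof. exact: ComplexField.Normc.normcV. Qed.
Lemma nm_eq0 z : (nm z == 0) = (z == 0).
Proof.
apply/eqP/eqP => [/ComplexField.Normc.eq0_normc //|->]; exact: nm0.
Qed.
Lemma nm_gt0 z : (0 < nm z) = (z != 0).
Proof. by rewrite lt_neqAle nm_ge0 andbT eq_sym nm_eq0. Qed.
Lemma nmX z n : nm (z ^+ n) = nm z ^+ n.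
Proof. by elim: n => [|n ih]; rewrite ?expr0 ?nm1// !exprS nmM ih. Qed.
Lemma nm_re z : `|re z| <= nm z.
Proof.
rewrite nmE -sqrtr_sqr ler_wsqrtr// lerDl sqr_ge0//.
Qed.
Lemma nm_im z : `|im z| <= nm z.
Proof.
rewrite nmE -sqrtr_sqr ler_wsqrtr// lerDr sqr_ge0//.
Qed.
Lemma nm_le z : nm z <= `|re z| + `|im z|.
Proof.
rewrite -(@ler_pXn2r _ 2)// ?nnegrE ?nm_ge0 ?addr_ge0// sqr_nm sqrrD.
rewrite !real_normK ?num_real// -addrA lerD2l lerDr mulrn_wge0// mulr_ge0//.
Qed.
Lemma nm_tri z w v : nm (z - w) <= nm (z - v) + nm (v - w).
Proof. by rewrite (le_trans _ (nmD _ _))// addrA subrK. Qed.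
Lemma nmBB z w : nm z - nm w <= nm (z - w).
Proof. by rewrite lerBlDr (le_trans _ (nmD _ _))// subrK. Qed.

Lemma norm_lt (z : C) (e : R) : (`|z| < (pt e 0)) = (nm z < e).
Proof. by rewrite normE; exact: (ltcR). Qed.

(** Balls of the normed space C have complex radii for a partial order; a positive radius has zero
    imaginary part, so real radii suffice. *)
Lemma nearC (z0 : C) (P : C -> Prop) :
  (\forall z \near z0, P z) <->
  exists2 e : R, 0 < e & forall z, nm (z - z0) < e -> P z.
Proof.
split.
  move=> /nbhs_ballP[e /= e0 h].
  have eE : e = pt (re e) 0.
    by move: e0; rewrite -[e]ptE => /andP[/= /eqP <- _].
  exists (re e); first by move: e0; rewrite eE => /andP[].
  move=> z hz; apply: h; rewrite /ball/= -normrN opprB eE norm_lt//.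
move=> [e e0 h]; apply/nbhs_ballP; exists (pt e 0) => /=.
  by rewrite -[0]/(pt 0 0); rewrite ltcR.
by move=> z /=; rewrite /ball/= -normrN opprB norm_lt => /h.
Qed.

Lemma dnearC (z0 : C) (P : C -> Prop) :
  (\forall z \near z0^', P z) <->
  exists2 e : R, 0 < e & forall z, z != z0 -> nm (z - z0) < e -> P z.
Proof.
split.
  by move=> /nearC [e e0 h]; exists e => // z zz0 /h; exact.
by move=> [e e0 h]; apply/nearC; exists e => // z /[swap] zz0 /h; exact.
Qed.

Lemma cvgC (T : Type) (F : set_system T) (FF : Filter F) (f : T -> C) (l : C) :
  f @ F --> l <-> forall e : R, 0 < e -> \forall x \near F, nm (f x - l) < e.
Proof.
split => [/cvgrPdist_lt h e e0|h].
  have /h : 0 < pt e 0 :> C by rewrite -[0]/(pt 0 0); rewrite ltcR.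
  by apply: filterS => x; rewrite -normrN opprB norm_lt.
apply/cvgrPdist_lt => e e0.
have eE : e = pt (re e) 0.
  by move: e0; rewrite -[e]ptE => /andP[/= /eqP <- _].
have /h : 0 < re e by move: e0; rewrite eE => /andP[].
by apply: filterS => x; rewrite eE -normrN opprB norm_lt.
Qed.

Lemma continuousC (f : C -> C) (z0 : C) :
  {for z0, continuous f} <->
  forall e : R, 0 < e -> exists2 d : R, 0 < d &
    forall z, nm (z - z0) < d -> nm (f z - f z0) < e.
Proof.
rewrite /continuous_at; split => [h e e0|h].
  by apply/nearC; move: e e0; exact: (cvgC (nbhs_filter z0) f (f z0)).1.
by apply: (cvgC (nbhs_filter z0) f (f z0)).2 => e /h/nearC.
Qed.

(** The form f(z) - f(z0) - l (z - z0) = o(z - z0), with a large inequality so that z = z0 need not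
    be excluded. *)
Lemma is_deriveC (f : C -> C) (z0 l : C) :
  is_derive z0 1 f l <->
  forall e : R, 0 < e -> exists2 d : R, 0 < d &
    forall z, nm (z - z0) < d -> nm (f z - f z0 - l * (z - z0)) <= e * nm (z - z0).
Proof.
have key : (is_derive z0 1 f l) <->
   (fun h => h^-1 *: (f (h *: 1 + z0) - f z0)) @ (0 : C)^' --> l.
  split.
    by move=> [df <-]; exact: df.
  move=> h; split; first by apply/cvg_ex; exists l.
  by rewrite /derive; apply: cvg_lim.
rewrite key; split.
  move=> /(cvgC (dnbhs_filter (0 : C)) _ _).1 h e /h /(dnearC _ _).1 [d d0 hd].
  exists d => // z zd.
  have [->|zz0] := eqVneq z z0; first by rewrite !subrr mulr0 subr0 nm0 mulr0.
  have zn0 : z - z0 != 0 by rewrite subr_eq0.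
  have := hd (z - z0) zn0; rewrite subr0 => /(_ zd) /ltW.
  rewrite [(_ - _) *: 1]mulr1 subrK => h1.
  rewrite -ler_pdivrMr ?nm_gt0// -nmV -nmM mulrBl mulfK//.
  by rewrite [X in nm (X - _)]mulrC.
move=> h; apply: (cvgC (dnbhs_filter (0 : C)) _ _).2 => e e0; apply/dnearC.
have [d d0 hd] := h (e/2) (divr_gt0 e0 (ltr0Sn _ _)).
exists d => // k k0; rewrite subr0 => kd.
have := hd (k + z0); rewrite addrK => /(_ kd).
rewrite [k *: 1]mulr1 => h1.
suff : nm (k^-1 *: (f (k + z0) - f z0) - l) <= e / 2 by move/le_lt_trans; apply; rewrite ltr_pdivrMr// ltr_pMr// ltr1n.
rewrite -(@ler_pM2r _ (nm k)) ?nm_gt0// (le_trans _ h1)// -nmM.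
rewrite mulrBl [_ *: _]mulrC mulfVK// lexx.
Qed.

End ComplexPlane.

(** * Goursat and Cauchy on rectangles *)

Section SegmentIntegral.
Context {R : realType}.
Local Notation C := (Cplx R).
Local Notation mu := (@lebesgue_measure R).

Definition segcont (f : R -> C) (a b : R) : Prop :=
  forall x : R, a <= x <= b -> {for x, continuous f}.

Lemma cont_cst (T : topologicalType) (c : C) (z : T) :
  {for z, continuous (fun _ : T => c)}.
Proof. exact: cvg_cst. Qed.
Lemma contD (T : topologicalType) (f g : T -> C) (z : T) :
  {for z, continuous f} -> {for z, continuous g} ->
  {for z, continuous (fun x => f x + g x)}.
Proof. exact: continuousD. Qed.
Lemma contB (T : topologicalType) (f g : T -> C) (z : T) :
  {for z, continuous f} -> {for z, continuous g} ->
  {for z, continuous (fun x => f x - g x)}.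
Proof. exact: continuousB. Qed.
Lemma contM (T : topologicalType) (f g : T -> C) (z : T) :
  {for z, continuous f} -> {for z, continuous g} ->
  {for z, continuous (fun x => f x * g x)}.
Proof. exact: continuousM. Qed.
Lemma contX (T : topologicalType) (f : T -> C) (z : T) n :
  {for z, continuous f} -> {for z, continuous (fun x => f x ^+ n)}.
Proof.
move=> h; elim: n => [|n ih]; first exact: cont_cst.
rewrite (_ : (fun x => f x ^+ n.+1) = (fun x => f x * f x ^+ n)); last first.
  by apply/funext => x; rewrite exprS.
exact: contM.
Qed.
Lemma contV (T : topologicalType) (f : T -> C) (z : T) :
  f z != 0 -> {for z, continuous f} -> {for z, continuous (fun x => (f x)^-1)}.
Proof. by move=> h0 h; apply: continuousV. Qed.
Lemma contMl (T : topologicalType) c (f : T -> C) (z : T) :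
  {for z, continuous f} -> {for z, continuous (fun x => c * f x)}.
Proof. move=> h; apply: (@contM T (fun=> c) f z _ h); exact: cont_cst. Qed.

Lemma continuous_re (T : topologicalType) (f : T -> C) x :
  {for x, continuous f} -> {for x, continuous (fun t => re (f t))}.
Proof.
move=> /(cvgC (nbhs_filter x) _ _).1 h; apply/cvgrPdist_lt => e /h.
by apply: filterS => t; rewrite nmBC -reB; exact: le_lt_trans (nm_re _).
Qed.

Lemma continuous_im (T : topologicalType) (f : T -> C) x :
  {for x, continuous f} -> {for x, continuous (fun t => im (f t))}.
Proof.
move=> /(cvgC (nbhs_filter x) _ _).1 h; apply/cvgrPdist_lt => e /h.
by apply: filterS => t; rewrite nmBC -imB; exact: le_lt_trans (nm_im _).
Qed.

Lemma continuous_nm (T : topologicalType) (f : T -> C) x :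
  {for x, continuous f} -> {for x, continuous (fun t => nm (f t))}.
Proof.
move=> /(cvgC (nbhs_filter x) _ _).1 h; apply/cvgrPdist_lt => e /h.
apply: filterS => t; apply: le_lt_trans.
have h1 := nmBB (f t) (f x); have h2 := nmBB (f x) (f t).
by rewrite nmBC in h2; rewrite ler_norml; lra.
Qed.

Lemma continuousRC (f : R -> C) x :
  {for x, continuous f} <-> forall e : R, 0 < e -> exists2 d : R, 0 < d &
    forall t, `|t - x| < d -> nm (f t - f x) < e.
Proof.
split=> [/(cvgC (nbhs_filter x) _ _).1 h e /h /nbhs_ballP[d /= d0 hd]|h].
  by exists d => // t td; apply: hd; rewrite /ball/= distrC.
apply: (cvgC (nbhs_filter x) _ _).2 => e /h[d d0 hd].
by apply/nbhs_ballP; exists d => //= t; rewrite /ball/= distrC => /hd.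
Qed.

Lemma nm_hor (x t y : R) : nm (pt t y - pt x y) = `|t - x|.
Proof. by rewrite nmE reB imB /= subrr expr0n addr0 sqrtr_sqr. Qed.

Lemma nm_ver (x t y : R) : nm (pt y t - pt y x) = `|t - x|.
Proof. by rewrite nmE reB imB /= subrr expr0n add0r sqrtr_sqr. Qed.

Lemma continuous_hor (f : C -> C) x y :
  {for pt x y, continuous f} -> {for x, continuous (fun t => f (pt t y))}.
Proof.
move=> /continuousC h; apply/continuousRC => e /h[d d0 hd].
by exists d => // t td; apply: hd; rewrite nm_hor.
Qed.

Lemma continuous_ver (f : C -> C) x y :
  {for pt x y, continuous f} -> {for y, continuous (fun t => f (pt x t))}.
Proof.
move=> /continuousC h; apply/continuousRC => e /h[d d0 hd].
by exists d => // t td; apply: hd; rewrite nm_ver.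
Qed.

Lemma segment_integrable (f : R -> R) (a b : R) :
  (forall x : R, a <= x <= b -> {for x, continuous f}) ->
  mu.-integrable `[a, b] (EFin \o f).
Proof.
move=> h; apply: continuous_compact_integrable; first exact: segment_compact.
apply: continuous_in_subspaceT => x.
by rewrite inE/= in_itv/= => /h.
Qed.

Definition sint (f : R -> C) (a b : R) : C :=
  pt (\int[mu]_(x in `[a, b]) re (f x)) (\int[mu]_(x in `[a, b]) im (f x)).

Lemma segcont_re f (a b : R) : segcont f a b ->
  mu.-integrable `[a, b] (EFin \o (fun x => re (f x))).
Proof. by move=> h; apply: segment_integrable => x /h /continuous_re. Qed.
Lemma segcont_im f (a b : R) : segcont f a b ->
  mu.-integrable `[a, b] (EFin \o (fun x => im (f x))).
Proof. by move=> h; apply: segment_integrable => x /h /continuous_im. Qed.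

Lemma eq_sint f g (a b : R) : (forall x : R, a <= x <= b -> f x = g x) ->
  sint f a b = sint g a b.
Proof.
by move=> h; congr pt; apply: eq_Rintegral => x;
  rewrite inE/= in_itv/= => /h ->.
Qed.

Lemma sintD f g (a b : R) : segcont f a b -> segcont g a b ->
  sint (fun x => f x + g x) a b = sint f a b + sint g a b.
Proof.
move=> cf cg; rewrite /sint ptD -!RintegralD ?segcont_re ?segcont_im//.
by congr pt; apply: eq_Rintegral => x _; rewrite ?reD ?imD.
Qed.

Lemma sintZ f c (a b : R) : segcont f a b ->
  sint (fun x => c * f x) a b = c * sint f a b.
Proof.
move=> cf; have ir := segcont_re cf; have ii := segcont_im cf.
have iZ (k : R) (h : R -> R) : mu.-integrable `[a, b] (EFin \o h) ->
    mu.-integrable `[a, b] (EFin \o (fun x => k * h x)).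
  move=> ih; rewrite (_ : _ \o _ = (fun x => k%:E * (EFin \o h) x)%E).
    exact: integrableZl.
  by apply/funext => x /=; rewrite EFinM.
apply: eqC; rewrite ?reM ?imM /= -?RintegralZl// -?RintegralB -?RintegralD ?iZ//.
  by apply: eq_Rintegral => x _; rewrite ?reM.
by apply: eq_Rintegral => x _; rewrite ?imM.
Qed.

Lemma sint_cst c (a b : R) : a <= b -> sint (fun=> c) a b = pt (b - a) 0 * c.
Proof.
move=> ab; rewrite /sint !Rintegral_cst//.
have -> : fine (mu `[a, b]) = b - a.
  rewrite lebesgue_measure_itv/= lte_fin; by case: ltgtP ab => //= -> _; rewrite subrr.
apply: eqC; rewrite ?reM ?imM/=; ring.
Qed.

Lemma sint_split f (a m b : R) : a <= m -> m <= b -> segcont f a b ->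
  sint f a b = sint f a m + sint f m b.
Proof.
move=> am mb cf; rewrite /sint ptD.
suff key (h : R -> R) : mu.-integrable `[a, b] (EFin \o h) ->
    \int[mu]_(x in `[a, b]) h x = \int[mu]_(x in `[a, m]) h x + \int[mu]_(x in `[m, b]) h x.
  by rewrite !key ?segcont_re ?segcont_im.
move=> ih; have := @Rintegral_itvB _ h (BLeft a) (BRight b) m ih.
rewrite !bnd_simp am mb => /(_ isT isT) /eqP; rewrite subr_eq addrC => /eqP ->.
congr (_ + _); rewrite Rintegral_itv_obnd_cbnd//.
apply: integrableS ih => //; apply: subset_itvr; by rewrite bnd_simp.
Qed.

(** The factor 2 comes from bounding real and imaginary parts separately. Only the order of
    magnitude of such bounds matters later. *)
Lemma sint_bound f (a b B : R) : a <= b -> segcont f a b ->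
  (forall x : R, a <= x <= b -> nm (f x) <= B) ->
  nm (sint f a b) <= 2 * B * (b - a).
Proof.
move=> ab cf fB.
have mab : fine (mu `[a, b]) = b - a.
  rewrite lebesgue_measure_itv/= lte_fin; by case: ltgtP ab => //= -> _; rewrite subrr.
have key (h : R -> R) : (forall x : R, a <= x <= b -> {for x, continuous h}) ->
    (forall x : R, a <= x <= b -> `|h x| <= B) ->
    `|\int[mu]_(x in `[a, b]) h x| <= B * (b - a).
  move=> ch hB; have ih := segment_integrable ch.
  apply: (le_trans (le_normr_Rintegral _ ih)) => //.
  rewrite -mab -Rintegral_cst//; apply: le_Rintegral => //.
  - by apply: segment_integrable => x /ch hx; apply: cvg_norm.
  - by apply: segment_integrable => x _; exact: cvg_cst.
apply: (le_trans (nm_le _)); rewrite /=.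
have h1 : `|re (sint f a b)| <= B * (b - a).
  apply: key => x xab; first exact/continuous_re/cf.
  exact: le_trans (nm_re _) (fB _ xab).
have h2 : `|im (sint f a b)| <= B * (b - a).
  apply: key => x xab; first exact/continuous_im/cf.
  exact: le_trans (nm_im _) (fB _ xab).
lra.
Qed.

End SegmentIntegral.

(** * Contour integrals along rectangles *)

Section RectangleIntegral.
Context {R : realType}.
Local Notation C := (Cplx R).

Definition inrect (x1 x2 y1 y2 : R) (z : C) : Prop :=
  (x1 <= re z <= x2) /\ (y1 <= im z <= y2).

Definition onrect (x1 x2 y1 y2 : R) (z : C) : Prop :=
  inrect x1 x2 y1 y2 z /\
  [\/ re z = x1, re z = x2, im z = y1 | im z = y2].

(** The counterclockwise contour integral, with opposite sides merged into one integrand: bottom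
    minus top, then right minus left multiplied by i. *)
Definition oint (f : C -> C) (x1 x2 y1 y2 : R) : C :=
  sint (fun x => f (pt x y1) - f (pt x y2)) x1 x2 +
  pt 0 1 * sint (fun y => f (pt x2 y) - f (pt x1 y)) y1 y2.

Definition rectcont (f : C -> C) (x1 x2 y1 y2 : R) : Prop :=
  forall z, onrect x1 x2 y1 y2 z -> {for z, continuous f}.

Lemma rectcont_hor f x1 x2 y1 y2 : y1 <= y2 -> rectcont f x1 x2 y1 y2 ->
  segcont (fun x => f (pt x y1) - f (pt x y2)) x1 x2.
Proof.
move=> y12 h x xx; apply: contB; apply: continuous_hor; apply: h;
 split; [split=> //=|constructor 3|split=> //=|constructor 4] => //=; rewrite lexx ?y12//.
Qed.

Lemma rectcont_ver f x1 x2 y1 y2 : x1 <= x2 -> rectcont f x1 x2 y1 y2 ->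
  segcont (fun y => f (pt x2 y) - f (pt x1 y)) y1 y2.
Proof.
move=> x12 h y yy; apply: contB; apply: continuous_ver; apply: h;
 split; [split=> //=|constructor 2|split=> //=|constructor 1] => //=; rewrite lexx ?x12//.
Qed.

Lemma eq_oint f g x1 x2 y1 y2 : x1 <= x2 -> y1 <= y2 ->
  (forall z, onrect x1 x2 y1 y2 z -> f z = g z) ->
  oint f x1 x2 y1 y2 = oint g x1 x2 y1 y2.
Proof.
move=> x12 y12 h; rewrite /oint; congr (_ + _ * _); apply: eq_sint => x xx;
 congr (_ - _); apply: h; split;
 [split=> //=|constructor 3|split=> //=|constructor 4
 |split=> //=|constructor 2|split=> //=|constructor 1] => //=; rewrite lexx ?x12 ?y12//.
Qed.

Lemma ointD f g x1 x2 y1 y2 : x1 <= x2 -> y1 <= y2 ->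
  rectcont f x1 x2 y1 y2 -> rectcont g x1 x2 y1 y2 ->
  oint (fun z => f z + g z) x1 x2 y1 y2 =
  oint f x1 x2 y1 y2 + oint g x1 x2 y1 y2.
Proof.
move=> x12 y12 cf cg; rewrite /oint addrACA -mulrDr -!sintD.
- by congr (_ + _ * _); apply: eq_sint => x _; rewrite opprD addrACA.
- exact: rectcont_ver.
- exact: rectcont_ver.
- exact: rectcont_hor.
- exact: rectcont_hor.
Qed.

Lemma ointZ c f x1 x2 y1 y2 : x1 <= x2 -> y1 <= y2 ->
  rectcont f x1 x2 y1 y2 ->
  oint (fun z => c * f z) x1 x2 y1 y2 = c * oint f x1 x2 y1 y2.
Proof.
move=> x12 y12 cf; rewrite /oint mulrDr mulrCA -!(@sintZ _ _ c).
- by congr (_ + _ * _); apply: eq_sint => x _; rewrite mulrBr.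
- exact: rectcont_ver.
- exact: rectcont_hor.
Qed.

Lemma ointB f g x1 x2 y1 y2 : x1 <= x2 -> y1 <= y2 ->
  rectcont f x1 x2 y1 y2 -> rectcont g x1 x2 y1 y2 ->
  oint (fun z => f z - g z) x1 x2 y1 y2 =
  oint f x1 x2 y1 y2 - oint g x1 x2 y1 y2.
Proof.
move=> x12 y12 cf cg; have cg' : rectcont (fun z => -1 * g z) x1 x2 y1 y2.
  by move=> z /cg h; exact: contMl.
rewrite -[- oint g _ _ _ _]mulN1r -(ointZ (-1) x12 y12 cg) -(ointD x12 y12 cf cg').
by apply: eq_oint x12 y12 _ => z _; rewrite mulN1r.
Qed.

Lemma oint_affine a b x1 x2 y1 y2 : x1 <= x2 -> y1 <= y2 ->
  oint (fun z => a + b * z) x1 x2 y1 y2 = 0.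
Proof.
move=> x12 y12; rewrite /oint.
rewrite (@eq_sint _ _ (fun=> b * pt 0 (y1 - y2))); last first.
  by move=> x _; apply: eqC; rewrite !(reN,imN,reD,imD,reN,imN,reM,imM,re_pt,im_pt); ring.
rewrite (@eq_sint _ (fun y => _ - _) (fun=> b * pt (x2 - x1) 0)); last first.
  by move=> x _; apply: eqC; rewrite !(reN,imN,reD,imD,reN,imN,reM,imM,re_pt,im_pt); ring.
by rewrite !sint_cst//; apply: eqC; rewrite !(reN,imN,reD,imD,reN,imN,reM,imM,re_pt,im_pt); ring.
Qed.

Lemma nm_i : nm (pt 0 1) = 1 :> R.
Proof. by rewrite nmE/= expr0n add0r expr1n sqrtr1. Qed.

Lemma oint_bound f x1 x2 y1 y2 B : x1 <= x2 -> y1 <= y2 ->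
  rectcont f x1 x2 y1 y2 ->
  (forall z, onrect x1 x2 y1 y2 z -> nm (f z) <= B) ->
  nm (oint f x1 x2 y1 y2) <= 4 * B * ((x2 - x1) + (y2 - y1)).
Proof.
move=> x12 y12 cf fB; apply: (le_trans (nmD _ _)); rewrite nmM nm_i mul1r.
have bB z w : nm (f z) <= B -> nm (f w) <= B -> nm (f z - f w) <= 2 * B.
  by move=> hz hw; have := nmB (f z) (f w); lra.
have h1 := sint_bound x12 (rectcont_hor y12 cf) (B := 2 * B).
have h2 := sint_bound y12 (rectcont_ver x12 cf) (B := 2 * B).
apply: (@le_trans _ _ (2 * (2 * B) * (x2 - x1) + 2 * (2 * B) * (y2 - y1))); last by lra.
apply: lerD; [apply: h1|apply: h2] => x xx; apply: bB; apply: fB; split;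
  [split=> //=|constructor 3|split=> //=|constructor 4
  |split=> //=|constructor 2|split=> //=|constructor 1] => //=; rewrite lexx ?x12 ?y12//.
Qed.

Lemma sintB f g (a b : R) : segcont f a b -> segcont g a b ->
  sint (fun x => f x - g x) a b = sint f a b - sint g a b.
Proof.
move=> cf cg; have cg' : segcont (fun z => -1 * g z) a b by move=> z /cg h; exact: contMl.
rewrite -[- sint g _ _]mulN1r -(sintZ (-1) cg) -(sintD cf cg').
by apply: eq_sint => x _; rewrite mulN1r.
Qed.

Lemma oint_splitx f x1 m x2 y1 y2 : x1 <= m -> m <= x2 -> y1 <= y2 ->
  (forall z, inrect x1 x2 y1 y2 z -> {for z, continuous f}) ->
  oint f x1 x2 y1 y2 = oint f x1 m y1 y2 + oint f m x2 y1 y2.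
Proof.
move=> x1m mx2 y12 cf; have x12 := le_trans x1m mx2.
rewrite /oint (@sint_split _ _ x1 m)//; last first.
  by apply: rectcont_hor => // z [/cf].
have cy x : x1 <= x <= x2 -> segcont (fun y => f (pt x y)) y1 y2.
  by move=> xx y yy; apply: continuous_ver; exact: cf.
have key u v : x1 <= u <= x2 -> x1 <= v <= x2 ->
    sint (fun y => f (pt u y) - f (pt v y)) y1 y2 =
    sint (fun y => f (pt u y)) y1 y2 - sint (fun y => f (pt v y)) y1 y2.
  by move=> /cy cu /cy cv; exact: sintB.
by rewrite !key ?lexx ?x12 ?x1m ?mx2//; ring.
Qed.

Lemma oint_splity f x1 x2 y1 m y2 : y1 <= m -> m <= y2 -> x1 <= x2 ->
  (forall z, inrect x1 x2 y1 y2 z -> {for z, continuous f}) ->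
  oint f x1 x2 y1 y2 = oint f x1 x2 y1 m + oint f x1 x2 m y2.
Proof.
move=> y1m my2 x12 cf; have y12 := le_trans y1m my2.
rewrite /oint (@sint_split _ _ y1 m)//; last first.
  by apply: rectcont_ver => // z [/cf].
have cx y : y1 <= y <= y2 -> segcont (fun x => f (pt x y)) x1 x2.
  by move=> yy x xx; apply: continuous_hor; exact: cf.
have key u v : y1 <= u <= y2 -> y1 <= v <= y2 ->
    sint (fun x => f (pt x u) - f (pt x v)) x1 x2 =
    sint (fun x => f (pt x u)) x1 x2 - sint (fun x => f (pt x v)) x1 x2.
  by move=> /cx cu /cx cv; exact: sintB.
by rewrite !key ?lexx ?y12 ?y1m ?my2//; ring.
Qed.

End RectangleIntegral.

(** * Goursat's theorem *)

Section Goursat.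
Context {R : realType}.
Local Notation C := (Cplx R).

Lemma derivable_cont (f : C -> C) z : derivable f z 1 -> {for z, continuous f}.
Proof. by move=> /derivable1_diffP /differentiable_continuous. Qed.

Lemma derivableC (f : C -> C) z : derivable f z 1 -> exists l : C,
  forall e : R, 0 < e -> exists2 d : R, 0 < d &
    forall w, nm (w - z) < d -> nm (f w - f z - l * (w - z)) <= e * nm (w - z).
Proof. by move=> /derivableP /is_deriveC h; eexists; exact: h. Qed.

Lemma nested_intervals (u l : nat -> R) :
  (forall k, 0 <= l k) -> (forall k, u k <= u k.+1) ->
  (forall k, u k.+1 + l k.+1 <= u k + l k) ->
  exists x, forall k, u k <= x <= u k + l k.
Proof.
move=> l0 mu ml.
have mu' k j : u k <= u (k + j)%N.
  by elim: j => [|j ih]; rewrite ?addn0// addnS (le_trans ih).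
have ml' k j : u (k + j)%N + l (k + j)%N <= u k + l k.
  by elim: j => [|j ih]; rewrite ?addn0// addnS (le_trans (ml _)).
have ub k j : u j <= u k + l k.
  have [jk|kj] := leqP j k.
    rewrite -(subnKC jk) (le_trans (mu' j (k - j)%N))// lerDl//.
  rewrite -(subnKC (ltnW kj)) (le_trans _ (ml' k (j - k)%N))// lerDl//.
exists (sup (range u)) => k; apply/andP; split.
  by apply: ub_le_sup; [exists (u 0%N + l 0%N) => _ [j _ <-]; exact: ub|exists k].
by apply: ge_sup; [exists (u 0%N); exists 0%N|move=> _ [j _ <-]; exact: ub].
Qed.

Lemma half_lt (e : R) : 0 < e -> exists k : nat, (2 ^- k : R) < e.
Proof.
move=> e0; have h : (0 < e)%R by [].
have : (fun k : nat => (2^-1 : R) ^+ k) @ \oo --> (0 : R).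
  by apply: cvg_expr; rewrite ger0_norm ?invr_ge0// invf_lt1// ltr1n.
move=> /cvgrPdist_lt /(_ e e0) [N _ /(_ N (leqnn N))] /=.
rewrite sub0r normrN ger0_norm ?exprn_ge0 ?invr_ge0// exprVn => hN.
by exists N.
Qed.

(** The integrals over the four quarters add up to the whole, so one of them carries at least a
    quarter of it. Sides of the form [w + w] make bisection free of division. *)
Lemma goursat_step (f : C -> C) (x1 y1 w h I : R) : 0 <= w -> 0 <= h ->
  (forall z, inrect x1 (x1 + (w + w)) y1 (y1 + (h + h)) z -> {for z, continuous f}) ->
  I <= nm (oint f x1 (x1 + (w + w)) y1 (y1 + (h + h))) ->
  exists x y, [/\ x1 <= x, x + w <= x1 + (w + w), y1 <= y, y + h <= y1 + (h + h) &
    I / 4 <= nm (oint f x (x + w) y (y + h))].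
Proof.
move=> w0 h0 cf hI.
have e : oint f x1 (x1 + (w + w)) y1 (y1 + (h + h)) =
   (oint f x1 (x1 + w) y1 (y1 + h) + oint f x1 (x1 + w) (y1 + h) (y1 + h + h)) +
   (oint f (x1 + w) (x1 + w + w) y1 (y1 + h) +
    oint f (x1 + w) (x1 + w + w) (y1 + h) (y1 + h + h)).
  rewrite !(addrA x1) !(addrA y1) in cf *.
  rewrite (@oint_splitx _ f x1 (x1 + w) (x1 + w + w) y1 (y1 + h + h) _ _ _ cf); [|lra|lra|lra].
  by congr (_ + _); apply: oint_splity; [lra|lra|lra|move=> z [zx zy]; apply: cf; split => //; lra
   |lra|lra|lra|move=> z [zx zy]; apply: cf; split => //; lra].
rewrite {}e in hI.
have {}hI := le_trans hI (le_trans (nmD _ _) (lerD (nmD _ _) (nmD _ _))).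
have [xw xww] : x1 + w <= x1 + (w + w) /\ x1 + w + w <= x1 + (w + w).
  by clear -w0; lra.
have [yh yhh] : y1 + h <= y1 + (h + h) /\ y1 + h + h <= y1 + (h + h).
  by clear -h0; lra.
have x1w : x1 <= x1 + w by rewrite lerDl.
have y1h : y1 <= y1 + h by rewrite lerDl.
have [h1|h1] := lerP (I / 4) (nm (oint f x1 (x1 + w) y1 (y1 + h))).
  by exists x1, y1; split.
have [h2|h2] := lerP (I / 4) (nm (oint f x1 (x1 + w) (y1 + h) (y1 + h + h))).
  by exists x1, (y1 + h); split.
have [h3|h3] := lerP (I / 4) (nm (oint f (x1 + w) (x1 + w + w) y1 (y1 + h))).
  by exists (x1 + w), y1; split.
exists (x1 + w), (y1 + h); split => //.
move: (nm _) (nm _) (nm _) (nm _) hI h1 h2 h3 => a b c d.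
clear; lra.
Qed.

Lemma goursat (f : C -> C) (x1 x2 y1 y2 : R) : x1 <= x2 -> y1 <= y2 ->
  (forall z, inrect x1 x2 y1 y2 z -> derivable f z 1) ->
  oint f x1 x2 y1 y2 = 0.
Proof.
move=> x12 y12 df; apply/eqP; rewrite -nm_eq0; apply/negPn/negP => I0.
set I := nm _ in I0; have {}I0 : 0 < I by rewrite lt_neqAle eq_sym I0 nm_ge0.
pose w := x2 - x1; pose h := y2 - y1.
have w0 : 0 <= w by rewrite subr_ge0.
have h0 : 0 <= h by rewrite subr_ge0.
pose q (k : nat) : R := 2 ^- k.
have q0 k : 0 < q k by rewrite invr_gt0 exprn_gt0.
have qS k : q k = q k.+1 + q k.+1.
  by rewrite /q exprS invfM; move: (_ ^-1) => t; lra.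
have cf z : inrect x1 x2 y1 y2 z -> {for z, continuous f}.
  by move=> /df /derivable_cont.
pose Q k (s : R * R) := [/\ x1 <= s.1, s.1 + w * q k <= x2, y1 <= s.2, s.2 + h * q k <= y2 &
  I * q k ^+ 2 <= nm (oint f s.1 (s.1 + w * q k) s.2 (s.2 + h * q k))].
(* The invariant [Q] is a premise under the existential, so that choice yields a total function;
   where [Q] fails, the value [(0, 0)] is arbitrary. *)
have step (ks : nat * (R * R)) : exists s' : R * R, Q ks.1 ks.2 ->
    [/\ Q ks.1.+1 s', ks.2.1 <= s'.1, s'.1 + w * q ks.1.+1 <= ks.2.1 + w * q ks.1,
      ks.2.2 <= s'.2 & s'.2 + h * q ks.1.+1 <= ks.2.2 + h * q ks.1].
  case: (pselect (Q ks.1 ks.2)) => [|nQ]; last by exists (0, 0).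
  case: ks => k [u v] /= [/= hu1 hu2 hv1 hv2]; rewrite !(qS k) !mulrDr => hI.
  rewrite qS mulrDr in hu2; rewrite qS mulrDr in hv2.
  have wq : 0 <= w * q k.+1 by rewrite mulr_ge0// ltW.
  have hq : 0 <= h * q k.+1 by rewrite mulr_ge0// ltW.
  have [|a [b [ha1 ha2 hb1 hb2 hab]]] := goursat_step wq hq _ hI.
    by move=> z [zx zy]; apply: cf; split; lra.
  exists (a, b) => _; clear hI; split => //; split => /=; try lra.
  by apply: le_trans hab; rewrite le_eqVlt; apply/orP; left; apply/eqP; field.
have [nx hnx] := choice step.
pose s := fix s k := if k is k'.+1 then nx (k', s k') else (x1, y1).
have Qs k : Q k (s k).
  elim: k => [|k ih]; last by have [] := hnx (k, s k) ih.
  split; rewrite /= ?lexx// /q expr0 invr1 ?mulr1 ?expr1n ?mulr1 /w /h ?subrKC//.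
have [X hX] : exists x, forall k, (s k).1 <= x <= (s k).1 + w * q k.
  apply: nested_intervals => k; first by rewrite mulr_ge0// ltW.
  - by have [] := hnx (k, s k) (Qs k).
  - by have [] := hnx (k, s k) (Qs k).
have [Y hY] : exists x, forall k, (s k).2 <= x <= (s k).2 + h * q k.
  apply: nested_intervals => k; first by rewrite mulr_ge0// ltW.
  - by have [] := hnx (k, s k) (Qs k).
  - by have [] := hnx (k, s k) (Qs k).
have XYin : inrect x1 x2 y1 y2 (pt X Y).
  by have [] := Qs 0%N; move: (hX 0%N) (hY 0%N); split=> /=; lra.
have [l hl] := derivableC (df _ XYin).
(* After division by [q k ^+ 2] the final estimate reads I <= 4 e (w + h)^2, whereas this [e] makes
   4 e ((w + h)^2 + 1) equal to I / 2. The [+ 1] covers a rectangle reduced to a point. *)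
pose e := I / (8 * ((w + h) ^+ 2 + 1)).
have wh : 0 < (w + h) ^+ 2 + 1 by rewrite ltr_wpDl ?sqr_ge0.
have e0 : 0 < e by rewrite divr_gt0// mulr_gt0.
have [d d0 hd] := hl e e0.
have wh1 : 0 < w + h + 1 by clear -w0 h0; lra.
have [k hk] : exists k, q k * (w + h + 1) < d.
  have [|k hk] := @half_lt (d / (w + h + 1)).
    exact: divr_gt0.
  by exists k; rewrite -ltr_pdivlMr.
have [hu1 hu2 hv1 hv2] := Qs k.
set u := (s k).1 in hu1 hu2 *; set v := (s k).2 in hv1 hv2 *.
have := hX k; have := hY k; rewrite -/u -/v => vY uX.
have wq : 0 <= w * q k by rewrite mulr_ge0// ltW.
have hq : 0 <= h * q k by rewrite mulr_ge0// ltW.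
have u2 : u <= u + w * q k by rewrite lerDl.
have v2 : v <= v + h * q k by rewrite lerDl.
pose L z := (f (pt X Y) - l * pt X Y) + l * z.
have cL z : {for z, continuous L} by apply: contD; [exact: cont_cst|apply: contMl; exact: cvg_id].
have cfk : rectcont f u (u + w * q k) v (v + h * q k).
  by move=> z [[zx zy] _]; apply: cf; split; lra.
have e1 : oint f u (u + w * q k) v (v + h * q k) =
    oint (fun z => f z - L z) u (u + w * q k) v (v + h * q k).
  have cL' : rectcont L u (u + w * q k) v (v + h * q k) by move=> z _; exact: cL.
  by rewrite (ointB u2 v2 cfk cL') (oint_affine _ _ u2 v2) subr0.
rewrite e1 => hI.
have cfL : rectcont (fun z => f z - L z) u (u + w * q k) v (v + h * q k).
  by move=> z hz; apply: contB; [exact: cfk|exact: cL].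
have hB z : onrect u (u + w * q k) v (v + h * q k) z ->
    nm (f z - L z) <= e * (q k * (w + h)).
  move=> [[zx zy] _].
  have zd : nm (z - pt X Y) <= q k * (w + h).
    rewrite (le_trans (nm_le _))// reB imB /= mulrDr lerD//.
      by rewrite ler_norml; lra.
    by rewrite ler_norml; lra.
  apply: (@le_trans _ _ (e * nm (z - pt X Y))); last by rewrite ler_pM2l.
  have -> : f z - L z = f z - f (pt X Y) - l * (z - pt X Y) by rewrite /L; ring.
  apply: hd; apply: le_lt_trans zd _; apply: le_lt_trans hk.
  by rewrite ler_pM2l// lerDl.
have {hB}hI := le_trans hI (oint_bound u2 v2 cfL hB).
have e2 : 4 * (e * (q k * (w + h))) * (u + w * q k - u + (v + h * q k - v)) =
  (4 * e * (w + h) ^+ 2) * q k ^+ 2 by ring.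
rewrite e2 ler_pM2r ?exprn_gt0// in hI.
have : 4 * e * ((w + h) ^+ 2 + 1) = I / 2 by rewrite /e; field; rewrite gt_eqF.
have : 0 < 4 * e by rewrite mulr_gt0.
nra.
Qed.

End Goursat.

Section Derivability.
Context {R : realType}.
Local Notation C := (Cplx R).
Implicit Types (f g : C -> C) (z : C).

Lemma der_cst (c : C) z : derivable (fun=> c) z 1.
Proof. exact: derivable_cst. Qed.
Lemma der_id z : derivable (fun x : C => x) z 1.
Proof. exact: derivable_id. Qed.
Lemma derD f g z : derivable f z 1 -> derivable g z 1 ->
  derivable (fun x => f x + g x) z 1.
Proof. exact: derivableD. Qed.
Lemma derB f g z : derivable f z 1 -> derivable g z 1 ->
  derivable (fun x => f x - g x) z 1.
Proof. exact: derivableB. Qed.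
Lemma derM f g z : derivable f z 1 -> derivable g z 1 ->
  derivable (fun x => f x * g x) z 1.
Proof. exact: derivableM. Qed.
Lemma derV f z : f z != 0 -> derivable f z 1 ->
  derivable (fun x => (f x)^-1) z 1.
Proof. exact: derivableV. Qed.
Lemma derX f n z : derivable f z 1 -> derivable (fun x => f x ^+ n) z 1.
Proof.
move=> h; elim: n => [|n ih]; first exact: der_cst.
rewrite (_ : (fun x => f x ^+ n.+1) = (fun x => f x * f x ^+ n)); last first.
  by apply/funext => x; rewrite exprS.
exact: derM.
Qed.
Lemma derBc (c : C) z : derivable (fun x : C => x - c) z 1.
Proof. apply: derB; [exact: der_id|exact: der_cst]. Qed.

Lemma near_der f g z : (\forall w \near z, f w = g w) ->
  derivable f z 1 -> derivable g z 1.
Proof. by move=> fg; apply: near_eq_derivable. Qed.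

Lemma near_neq (z w : C) : z != w -> \forall x \near z, x != w.
Proof.
move=> zw; apply/nearC; exists (nm (z - w)); first by rewrite nm_gt0 subr_eq0.
by move=> x; apply: contraTneq => ->; rewrite nmBC ltxx.
Qed.

(** The difference quotient completed by the derivative at [w]. Iterating it divides out zeros one
    at a time, in place of power series. *)
Definition quot f w z : C :=
  if z == w then 'D_1 f w else (f z - f w) / (z - w).

Lemma quot_cont f w : derivable f w 1 -> {for w, continuous (quot f w)}.
Proof.
move=> /derivableP/is_deriveC h; apply/continuousC => e e0.
have e2 : 0 < e / 2 by rewrite divr_gt0.
have [d d0 hd] := h _ e2; exists d => // z /hd.
rewrite /quot eqxx; case: eqVneq => [_ _|zw]; first by rewrite subrr nm0.
have zw0 : z - w != 0 by rewrite subr_eq0.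
rewrite -ler_pdivrMr ?nm_gt0// -nmV -nmM mulrBl mulfK// => hz.
by apply: le_lt_trans hz _; clear -e0; lra.
Qed.

Lemma quot_der f w z : z != w -> derivable f z 1 -> derivable (quot f w) z 1.
Proof.
move=> zw df; apply: (@near_der (fun x => (f x - f w) / (x - w))).
  by apply: filterS (near_neq zw) => x xw; rewrite /quot (negPf xw).
apply: derM; first by apply: derB; [exact: df|exact: der_cst].
by apply: derV; [rewrite subr_eq0|exact: derBc].
Qed.

Lemma quotE f w z : f w = 0 -> f z = (z - w) * quot f w z.
Proof.
move=> fw; rewrite /quot; case: eqVneq => [->|zw].
  by rewrite subrr mul0r.
by rewrite fw subr0 mulrC mulfVK// subr_eq0.
Qed.

End Derivability.

(** * Cauchy's formula on a rectangle *)

Section CauchyFormula.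
Context {R : realType}.
Local Notation C := (Cplx R).
Variables (x1 x2 y1 y2 : R).

Definition interior_rect (w : C) : Prop :=
  (x1 < re w < x2) /\ (y1 < im w < y2).

(** Cutting along the sides of a small square around [w] leaves only the integral over that square,
    and by continuity at [w] this tends to 0 with the side. *)
Lemma goursat_except (f : C -> C) w : interior_rect w ->
  (forall z, inrect x1 x2 y1 y2 z -> {for z, continuous f}) ->
  (forall z, inrect x1 x2 y1 y2 z -> z != w -> derivable f z 1) ->
  oint f x1 x2 y1 y2 = 0.
Proof.
move=> [/andP[wx1 wx2] /andP[wy1 wy2]] cf df.
set a := re w in wx1 wx2; set b := im w in wy1 wy2.
apply/eqP; rewrite -nm_eq0; apply/negPn/negP => I0.
have {}I0 : 0 < nm (oint f x1 x2 y1 y2) by rewrite lt_neqAle eq_sym I0 nm_ge0.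
have wr : inrect x1 x2 y1 y2 w by split; rewrite !ltW.
have /continuousC/(_ 1 ltr01) [d d0 hd] := cf _ wr.
pose B := nm (f w) + 1; have B0 : 0 < B by rewrite ltr_wpDl ?nm_ge0.
(* [d / 3] keeps the square of half side [s] in the disk where |f| <= B; the second term makes the
   bound 16 B s at most half of the whole integral; the others keep the square inside the
   rectangle. *)
pose s := Num.min (Num.min (d / 3) (nm (oint f x1 x2 y1 y2) / (32 * B)))
  (Num.min (Num.min (a - x1) (x2 - a)) (Num.min (b - y1) (y2 - b))).
have s0 : 0 < s.
  by rewrite !lt_min !divr_gt0 ?mulr_gt0//= !subr_gt0 wx1 wx2 wy1.
have [sd [sI [sx1 [sx2 [sy1 sy2]]]]] : s <= d / 3 /\ (s <= nm (oint f x1 x2 y1 y2) / (32 * B) /\ (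
    s <= a - x1 /\ (s <= x2 - a /\ (s <= b - y1 /\ s <= y2 - b)))).
  by have := lexx s; rewrite {2}/s !le_min => /andP[/andP[-> ->] /andP[/andP[-> ->] /andP[-> ->]]].
have sub x1' x2' y1' y2' : x1 <= x1' -> x2' <= x2 -> y1 <= y1' -> y2' <= y2 ->
    forall z, inrect x1' x2' y1' y2' z -> inrect x1 x2 y1 y2 z.
  move=> h1 h2 h3 h4 z [/andP[k1 k2] /andP[k3 k4]].
  by split; rewrite (le_trans h1 k1, le_trans h3 k3) (le_trans k2 h2, le_trans k4 h4).
have gz x1' x2' y1' y2' : x1 <= x1' -> x2' <= x2 -> y1 <= y1' -> y2' <= y2 ->
    x1' <= x2' -> y1' <= y2' -> [|| x2' < a, a < x1', y2' < b | b < y1'] ->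
    oint f x1' x2' y1' y2' = 0.
  move=> h1 h2 h3 h4 h5 h6 h7; apply: goursat => // z zr.
  apply: df; first exact: sub zr.
  apply: contraTneq h7 => zw; move: zr => []; rewrite zw -/a -/b.
  by move=> /andP[k1 k2] /andP[k3 k4]; rewrite !ltNge k1 k2 k3 k4.
have [p1 [p2 [p3 [p4 [p5 [p6 [p7 p8]]]]]]] : x1 <= a - s /\ (a - s <= a + s /\ (a + s <= x2 /\ (y1 <= b - s /\
    (b - s <= b + s /\ (b + s <= y2 /\ (a - s < a < a + s /\ b - s < b < b + s)))))).
  by clear -s0 sx1 sx2 sy1 sy2; repeat split; lra.
have y12 : y1 <= y2 by exact: le_trans (le_trans p4 p5) p6.
have e : oint f x1 x2 y1 y2 = oint f (a - s) (a + s) (b - s) (b + s).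
  have c1 := sub _ _ _ _ (lexx x1) (lexx x2) (lexx y1) (lexx y2).
  rewrite (@oint_splitx _ f x1 (a - s) x2 y1 y2 p1 (le_trans p2 p3) y12 cf).
  rewrite gz ?lexx ?(le_trans p2 p3) ?(andP p7).1 // add0r.
  rewrite (@oint_splitx _ f (a - s) (a + s) x2 y1 y2 p2 p3 y12); last first.
    by move=> z zr; apply: cf; apply: sub zr.
  rewrite (gz (a + s)) ?lexx ?(le_trans p1 p2) ?(andP p7).2 ?orbT // addr0.
  rewrite (@oint_splity _ f (a - s) (a + s) y1 (b - s) y2 p4 (le_trans p5 p6) p2); last first.
    by move=> z zr; apply: cf; apply: sub zr.
  rewrite gz ?lexx ?(le_trans p5 p6) ?(andP p8).1 ?orbT // add0r.
  rewrite (@oint_splity _ f (a - s) (a + s) (b - s) (b + s) y2 p5 p6 p2); last first.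
    by move=> z zr; apply: cf; apply: sub zr.
  by rewrite (gz _ _ (b + s)) ?lexx ?(le_trans p4 p5) ?(andP p8).2 ?orbT // addr0.
have hB : nm (oint f (a - s) (a + s) (b - s) (b + s)) <= 4 * B * ((a + s - (a - s)) + (b + s - (b - s))).
  apply: oint_bound => //.
    by move=> z [zr _]; apply: cf; apply: sub zr.
  move=> z [[zx zy] _].
  have zw : nm (z - w) < d.
    apply: le_lt_trans (nm_le _) _; rewrite reB imB -/a -/b.
    apply: (@le_lt_trans _ _ (s + s)); last by clear -sd d0; lra.
    by apply: lerD; rewrite ler_norml; clear -zx zy; lra.
  have := hd z zw; have := nmD (f z - f w) (f w); rewrite subrK /B; clear; lra.
rewrite -e in hB.
have : s * (32 * B) <= nm (oint f x1 x2 y1 y2).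
  by rewrite -ler_pdivlMr// mulr_gt0.
move: (nm _) I0 hB => I I0 hB; clear -I0 hB B0 s0; nra.
Qed.

Hypothesis (x12 : x1 < x2) (y12 : y1 < y2).

Lemma interior_on w z : interior_rect w -> onrect x1 x2 y1 y2 z -> z - w != 0.
Proof.
move=> [/andP[a1 a2] /andP[b1 b2]] [_ h]; rewrite subr_eq0.
by apply: contraPneq h => ->; case=> h; move: a1 a2 b1 b2; rewrite h ?ltxx.
Qed.

(** The integral of 1 / (z - w) is never evaluated as 2 pi i: it stays as a factor, and later only
    its nonvanishing and its differentiability in [w] are used. *)
Lemma cauchy_formula (f : C -> C) w : interior_rect w ->
  (forall z, inrect x1 x2 y1 y2 z -> derivable f z 1) ->
  f w * oint (fun z => (z - w)^-1) x1 x2 y1 y2 =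
  oint (fun z => f z / (z - w)) x1 x2 y1 y2.
Proof.
move=> iw df.
have wr : inrect x1 x2 y1 y2 w.
  by case: iw => /andP[? ?] /andP[? ?]; split; rewrite !ltW.
have Q0 : oint (quot f w) x1 x2 y1 y2 = 0.
  apply: (goursat_except iw) => z zr.
    have [->|zw] := eqVneq z w; first exact/quot_cont/df.
    exact/derivable_cont/quot_der/df.
  by move=> zw; exact/quot_der/df.
have cV : rectcont (fun z => (z - w)^-1) x1 x2 y1 y2.
  move=> z zb; apply: derivable_cont; apply: derV; last exact: derBc.
  exact: interior_on zb.
have cf : rectcont (fun z => f z / (z - w)) x1 x2 y1 y2.
  by move=> z zb; apply: contM; [apply/derivable_cont/df; case: zb|exact: cV].
rewrite -(ointZ (f w) (ltW x12) (ltW y12) cV).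
apply/eqP; rewrite eq_sym -subr_eq0 -Q0; apply/eqP.
have cfw : rectcont (fun z => f w * (z - w)^-1) x1 x2 y1 y2.
  by move=> z /cV; exact: contMl.
rewrite -(ointB (ltW x12) (ltW y12) cf cfw).
apply: eq_oint (ltW x12) (ltW y12) _ => z zb; rewrite /quot.
have := interior_on iw zb; rewrite subr_eq0 => /negPf ->.
by rewrite mulrBl.
Qed.

Lemma rect_max (f : C -> C) : rectcont f x1 x2 y1 y2 ->
  exists2 z0, onrect x1 x2 y1 y2 z0 &
    forall z, onrect x1 x2 y1 y2 z -> nm (f z) <= nm (f z0).
Proof.
move=> cf.
have side (p : R -> C) (a b : R) : a <= b -> segcont (fun t => f (p t)) a b ->
    exists2 c, a <= c <= b & forall t, a <= t <= b -> nm (f (p t)) <= nm (f (p c)).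
  move=> ab h; have [|c] := @EVT_max R (fun t => nm (f (p t))) a b ab.
    apply: continuous_in_subspaceT => t; rewrite inE/= in_itv/= => /h.
    exact: continuous_nm.
  by rewrite in_itv/= => cab hc; exists c => // t tab; apply: hc; rewrite in_itv.
have hon y x : y = y1 \/ y = y2 -> x1 <= x <= x2 -> onrect x1 x2 y1 y2 (pt x y).
  move=> hy hx; split.
    by split => //=; case: hy => ->; rewrite lexx ltW.
  by case: hy => ->; [constructor 3|constructor 4].
have von x y : x = x1 \/ x = x2 -> y1 <= y <= y2 -> onrect x1 x2 y1 y2 (pt x y).
  move=> hx hy; split.
    by split => //=; case: hx => ->; rewrite lexx ltW.
  by case: hx => ->; [constructor 1|constructor 2].
have hside y : y = y1 \/ y = y2 -> exists2 z0, onrect x1 x2 y1 y2 z0 &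
    forall x, x1 <= x <= x2 -> nm (f (pt x y)) <= nm (f z0).
  move=> hy; have [|c hc hm] := side (fun t => pt t y) x1 x2 (ltW x12).
    by move=> x hx; apply: continuous_hor; apply: cf; exact: hon.
  by exists (pt c y) => //; exact: hon.
have vside x : x = x1 \/ x = x2 -> exists2 z0, onrect x1 x2 y1 y2 z0 &
    forall y, y1 <= y <= y2 -> nm (f (pt x y)) <= nm (f z0).
  move=> hx; have [|c hc hm] := side (fun t => pt x t) y1 y2 (ltW y12).
    by move=> y hy; apply: continuous_ver; apply: cf; exact: von.
  by exists (pt x c) => //; exact: von.
have [a ra ha] := hside y1 (or_introl erefl).
have [b rb hb] := hside y2 (or_intror erefl).
have [c rc hc] := vside x1 (or_introl erefl).
have [d rd hd] := vside x2 (or_intror erefl).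
have join u v : onrect x1 x2 y1 y2 u -> onrect x1 x2 y1 y2 v ->
    exists2 w, onrect x1 x2 y1 y2 w & nm (f u) <= nm (f w) /\ nm (f v) <= nm (f w).
  by move=> hu hv; case: (leP (nm (f u)) (nm (f v))) => h; [by exists v|exists u => //; split; rewrite ?lexx// ltW].
have [ab rab [hab1 hab2]] := join _ _ ra rb.
have [cd rcd [hcd1 hcd2]] := join _ _ rc rd.
have [m rm [hm1 hm2]] := join _ _ rab rcd.
exists m => // z [[zx zy]]; have := ptE z => /[swap] -[] -> <-.
- apply: le_trans (hc _ zy) (le_trans hcd1 hm2).
- apply: le_trans (hd _ zy) (le_trans hcd2 hm2).
- apply: le_trans (ha _ zx) (le_trans hab1 hm1).
- apply: le_trans (hb _ zx) (le_trans hab2 hm1).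
Qed.

End CauchyFormula.

Lemma le_expr (F : realFieldType) n (a b : F) : 0 <= a -> a <= b -> a ^+ n <= b ^+ n.
Proof. by move=> a0 ab; apply: lerXn2r; rewrite ?nnegrE// (le_trans a0). Qed.

(** * Differentiation of Cauchy integrals *)

Section CauchyKernel.
Context {R : realType}.
Local Notation C := (Cplx R).
Variables (x1 x2 y1 y2 : R).
Hypothesis (x12 : x1 < x2) (y12 : y1 < y2).
Local Notation oi f := (oint f x1 x2 y1 y2).
Local Notation bd := (onrect x1 x2 y1 y2).

Lemma re_inv (z : C) : re z^-1 = re z / (re z ^+ 2 + im z ^+ 2).
Proof. by case: z. Qed.
Lemma im_inv (z : C) : im z^-1 = - im z / (re z ^+ 2 + im z ^+ 2).
Proof. by case: z => a b; rewrite /im/= mulNr. Qed.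

Lemma interior_dist (w : C) : interior_rect x1 x2 y1 y2 w ->
  exists2 d : R, 0 < d & forall z, bd z -> d <= nm (z - w).
Proof.
move=> [/andP[a1 a2] /andP[b1 b2]].
exists (Num.min (Num.min (re w - x1) (x2 - re w)) (Num.min (im w - y1) (y2 - im w))).
  by rewrite !lt_min !subr_gt0 a1 a2 b1 b2.
move=> z [_ h]; rewrite !ge_min; have := nm_re (z - w); have := nm_im (z - w).
rewrite reB imB !ler_norml => /andP[h1 h2] /andP[h3 h4].
case: h => h; rewrite ?h in h1 h2 h3 h4.
- by apply/orP; left; apply/orP; left; move: h3; lra.
- by apply/orP; left; apply/orP; right.
- by apply/orP; right; apply/orP; left; move: h1; lra.
- by apply/orP; right; apply/orP; right.
Qed.

(* The integrand of [im] is positive on each of the four sides. *)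
Lemma cauchy_const_neq0 (w : C) : interior_rect x1 x2 y1 y2 w ->
  oi (fun z => (z - w)^-1) != 0.
Proof.
move=> iw; have [/andP[a1 a2] /andP[b1 b2]] := iw.
have cV : rectcont (fun z => (z - w)^-1) x1 x2 y1 y2.
  move=> z zb; apply: derivable_cont; apply: derV; last exact: derBc.
  exact: interior_on zb.
have ch := rectcont_hor (ltW y12) cV; have cv := rectcont_ver (ltW x12) cV.
suff h : 0 < im (oi (fun z => (z - w)^-1)).
  by apply: contraTneq h => ->; rewrite ltxx.
rewrite /oint imD imM re_pt im_pt mul0r mul1r add0r.
have pv x y : x1 <= x <= x2 -> y != im w ->
    0 < (x - re w) ^+ 2 + (y - im w) ^+ 2.
  by move=> _ h; rewrite ltr_wpDl ?sqr_ge0// lt_neqAle sqr_ge0 eq_sym sqrf_eq0 subr_eq0 h.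
pose D := (x2 - x1) ^+ 2 + (y2 - y1) ^+ 2.
have D0 : 0 < D by rewrite ltr_wpDl ?sqr_ge0// exprn_gt0// subr_gt0.
apply: ltr_pwDl.
  apply: (@lt_le_trans _ _ (((im w - y1) / D) * (x2 - x1))).
    by rewrite mulr_gt0 ?divr_gt0 ?subr_gt0.
  have mab : fine (@lebesgue_measure R `[x1, x2]) = x2 - x1.
    by rewrite lebesgue_measure_itv/= lte_fin x12.
  rewrite /sint im_pt -mab -Rintegral_cst//; apply: le_Rintegral => //.
  - by apply: segment_integrable => x _; exact: cvg_cst.
  - exact: segcont_im.
  move=> x; rewrite /= in_itv/= => hx.
  rewrite imB !im_inv !reB !imB !re_pt !im_pt.
  have q1 : 0 < (x - re w) ^+ 2 + (y1 - im w) ^+ 2 by rewrite pv// lt_eqF.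
  have q2 : 0 < (x - re w) ^+ 2 + (y2 - im w) ^+ 2 by rewrite pv// gt_eqF.
  rewrite !opprB -[leLHS]addr0.
  apply: lerD; last first.
    by rewrite -mulNr opprB; apply: divr_ge0; [rewrite subr_ge0 ltW|exact: ltW].
  rewrite ler_pM2l ?subr_gt0// lef_pV2 ?posrE//.
  by case/andP: hx => hx1 hx2; rewrite /D; clear -hx1 hx2 a1 a2 b1 b2; nra.
apply: Rintegral_ge0 => y; rewrite /= in_itv/= => hy.
rewrite reB !re_inv !reB !imB !re_pt !im_pt.
rewrite -mulNr opprB; apply: addr_ge0; apply: divr_ge0;
  by [rewrite subr_ge0 ltW|apply: addr_ge0; exact: sqr_ge0].
Qed.

(** Differentiation under the integral sign: a remainder of order (w - w0)^2, uniform on the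
    boundary, integrates to a remainder of the same order. *)
Lemma kernel_derive (k : C -> C -> C) (k' : C -> C) w0 (d M : R) : 0 < d ->
  (forall w, nm (w - w0) < d -> rectcont (fun z => k z w) x1 x2 y1 y2) ->
  rectcont k' x1 x2 y1 y2 ->
  (forall w z, nm (w - w0) < d -> bd z ->
    nm (k z w - k z w0 - (w - w0) * k' z) <= M * nm (w - w0) ^+ 2) ->
  is_derive w0 1 (fun w => oi (fun z => k z w)) (oi k').
Proof.
move=> d0 ck ck' hk; apply/is_deriveC => e e0.
pose L := 4 * ((x2 - x1) + (y2 - y1)).
have L0 : 0 < L by rewrite mulr_gt0// addr_gt0// subr_gt0.
have M1 : 0 < `|M| + 1 by rewrite ltr_wpDl.
exists (Num.min d (e / (L * (`|M| + 1)))).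
  by rewrite lt_min d0 divr_gt0// mulr_gt0.
move=> w; rewrite lt_min => /andP[wd we].
have c0 : rectcont (fun z => k z w0) x1 x2 y1 y2 by apply: ck; rewrite subrr nm0.
have cw := ck w wd.
have cwk : rectcont (fun z => (w - w0) * k' z) x1 x2 y1 y2.
  by move=> z /ck'; exact: contMl.
have cB : rectcont (fun z => k z w - k z w0) x1 x2 y1 y2.
  by move=> z zb; apply: contB; [exact: cw|exact: c0].
have cBB : rectcont (fun z => k z w - k z w0 - (w - w0) * k' z) x1 x2 y1 y2.
  by move=> z zb; apply: contB; [exact: cB|exact: cwk].
rewrite [oi k' * _]mulrC -(ointZ _ (ltW x12) (ltW y12) ck').
rewrite -(ointB (ltW x12) (ltW y12) cw c0) -(ointB (ltW x12) (ltW y12) cB cwk).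
have := oint_bound (ltW x12) (ltW y12) cBB (fun z zb => hk w z wd zb).
move/le_trans; apply.
have {}we : nm (w - w0) * (L * (`|M| + 1)) < e by rewrite -ltr_pdivlMr// mulr_gt0.
have -> : 4 * (M * nm (w - w0) ^+ 2) * (x2 - x1 + (y2 - y1)) =
   (nm (w - w0) * (L * M)) * nm (w - w0) by rewrite /L; ring.
apply: ler_wpM2r; first exact: nm_ge0.
apply: le_trans (ltW we); apply: ler_wpM2l; first exact: nm_ge0.
by rewrite ler_pM2l// (le_trans (ler_norm M))// lerDl.
Qed.

Variable phi : C -> C.
Hypothesis cphi : rectcont phi x1 x2 y1 y2.

Lemma kernel_cont w n : interior_rect x1 x2 y1 y2 w ->
  rectcont (fun z => phi z * ((z - w)^-1) ^+ n) x1 x2 y1 y2.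
Proof.
move=> iw z zb; apply: contM; first exact: cphi.
apply: contX; apply: derivable_cont; apply: derV; last exact: derBc.
exact: interior_on zb.
Qed.

Lemma interior_near w0 : interior_rect x1 x2 y1 y2 w0 ->
  exists2 d : R, 0 < d & forall w, nm (w - w0) < d ->
   interior_rect x1 x2 y1 y2 w /\ forall z, bd z -> nm (z - w)^-1 <= d^-1.
Proof.
move=> iw; have [d d0 hd] := interior_dist iw.
have [/andP[a1 a2] /andP[b1 b2]] := iw.
exists (Num.min (d / 2) (Num.min (Num.min (re w0 - x1) (x2 - re w0)) (Num.min (im w0 - y1) (y2 - im w0)))).
  by rewrite !lt_min !subr_gt0 a1 a2 b1 b2 divr_gt0.
set e := Num.min _ _.
have [e1 [e2 [e3 [e4 e5]]]] : e <= d / 2 /\ (e <= re w0 - x1 /\ (e <= x2 - re w0 /\ (e <= im w0 - y1 /\ e <= y2 - im w0))).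
  by have := lexx e; rewrite {2}/e !le_min => /andP[-> /andP[/andP[-> ->] /andP[-> ->]]].
have e0 : 0 < e by rewrite !lt_min !subr_gt0 a1 a2 b1 b2 divr_gt0.
move=> w we; have := nm_re (w - w0); have := nm_im (w - w0).
rewrite reB imB !ler_norml => /andP[h1 h2] /andP[h3 h4]; split.
  by clear iw; split; lra.
move=> z /hd hz; have hzw : e <= nm (z - w).
  have := nm_tri z w0 w; lra.
by rewrite nmV lef_pV2 ?posrE// (lt_le_trans e0).
Qed.

Lemma cauchy_derive1 w0 : interior_rect x1 x2 y1 y2 w0 ->
  is_derive w0 1 (fun w => oi (fun z => phi z * (z - w)^-1))
    (oi (fun z => phi z * ((z - w0)^-1) ^+ 2)).
Proof.
move=> iw; have [d d0 hd] := interior_near iw.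
have [zm _ hm] := rect_max x12 y12 cphi.
apply: (@kernel_derive _ _ _ d (nm (phi zm) * (d^-1) ^+ 3) d0).
- by move=> w /hd[iw' _]; exact: (@kernel_cont w 1).
- exact: kernel_cont.
move=> w z wd zb; have [iw' hw] := hd w wd; have d00 : nm (w0 - w0) < d by rewrite subrr nm0.
have [_ h0] := hd w0 d00.
have z0 := interior_on iw zb; have z1 := interior_on iw' zb.
have -> : phi z / (z - w) - phi z / (z - w0) - (w - w0) * (phi z * (z - w0)^-1 ^+ 2) =
  phi z * (((z - w0)^-1) ^+ 2 * (z - w)^-1) * (w - w0) ^+ 2.
  by field; rewrite z0 z1.
rewrite nmM nmX; apply: ler_wpM2r; first by rewrite exprn_ge0// nm_ge0.
rewrite nmM; apply: ler_pM; rewrite ?nm_ge0//; first exact: hm.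
rewrite nmM nmX [d^-1 ^+ 3]exprSr; apply: ler_pM; rewrite ?exprn_ge0 ?nm_ge0//; last exact: hw.
by apply: le_expr; [exact: nm_ge0|exact: h0].
Qed.

Lemma cauchy_derive2 w0 : interior_rect x1 x2 y1 y2 w0 ->
  derivable (fun w => oi (fun z => phi z * ((z - w)^-1) ^+ 2)) w0 1.
Proof.
move=> iw; have [d d0 hd] := interior_near iw.
have [zm _ hm] := rect_max x12 y12 cphi.
suff : is_derive w0 1 (fun w => oi (fun z => phi z * ((z - w)^-1) ^+ 2))
    (oi (fun z => 2 * (phi z * ((z - w0)^-1) ^+ 3))) by case.
apply: (@kernel_derive _ _ _ d (nm (phi zm) * (3 * (d^-1) ^+ 4)) d0).
- by move=> w /hd[iw' _]; exact: (@kernel_cont w 2).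
- by move=> z zb; apply: contMl; exact: kernel_cont.
move=> w z wd zb; have [iw' hw] := hd w wd; have d00 : nm (w0 - w0) < d by rewrite subrr nm0.
have [_ h0] := hd w0 d00.
have z0 := interior_on iw zb; have z1 := interior_on iw' zb.
have -> : phi z * (z - w)^-1 ^+ 2 - phi z * (z - w0)^-1 ^+ 2 - (w - w0) * (2 * (phi z * (z - w0)^-1 ^+ 3)) =
  phi z * (((z - w0)^-1) ^+ 2 * ((z - w)^-1) ^+ 2 + 
  (((z - w0)^-1) ^+ 3 * (z - w)^-1 + ((z - w0)^-1) ^+ 3 * (z - w)^-1)) * (w - w0) ^+ 2.
  by field; rewrite z0 z1.
rewrite nmM nmX; apply: ler_wpM2r; first by rewrite exprn_ge0// nm_ge0.
rewrite nmM; apply: ler_pM; rewrite ?nm_ge0//; first exact: hm.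
have di : 0 <= d^-1 by rewrite invr_ge0 ltW.
have h (a b : C) i j : (i + j = 4)%N -> nm a <= d^-1 -> nm b <= d^-1 -> nm (a ^+ i * b ^+ j) <= d^-1 ^+ 4.
  move=> <- ha hb; rewrite nmM !nmX exprD; apply: ler_pM; rewrite ?exprn_ge0 ?nm_ge0//;
  by apply: le_expr; rewrite ?nm_ge0.
have p1 := h _ _ 2 2 erefl (h0 _ zb) (hw _ zb).
have p2 := h _ _ 3 1 erefl (h0 _ zb) (hw _ zb).
apply: le_trans (nmD _ _) _; apply: (le_trans (lerD p1 (nmD _ _))).
rewrite expr1 in p2; have -> : 3 * d^-1 ^+ 4 = d^-1 ^+ 4 + (d^-1 ^+ 4 + d^-1 ^+ 4) by ring.
exact: lerD (lexx _) (lerD p2 p2).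
Qed.

End CauchyKernel.

(** * Local theory of holomorphic functions *)

Section Holomorphic.
Context {R : realType}.
Local Notation C := (Cplx R).
Implicit Types (f g : C -> C) (z : C).

Definition holo f z0 : Prop := \forall z \near z0, derivable f z 1.

Lemma holo_der f z0 : holo f z0 -> derivable f z0 1.
Proof. exact: nbhs_singleton. Qed.

Lemma holo_near f z0 : holo f z0 -> \forall z \near z0, holo f z.
Proof. by move=> /near_join. Qed.

Lemma nearS z (P Q : C -> Prop) : (forall x, P x -> Q x) ->
  (\forall x \near z, P x) -> \forall x \near z, Q x.
Proof. exact: (@filterS C (nbhs z) (nbhs_filter z) P Q). Qed.
Lemma nearS2 z (P Q S : C -> Prop) : (forall x, P x -> Q x -> S x) ->
  (\forall x \near z, P x) -> (\forall x \near z, Q x) ->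
  \forall x \near z, S x.
Proof. exact: (@filterS2 C (nbhs z) (nbhs_filter z) P Q S). Qed.

Lemma holo_cst (c : C) z : holo (fun=> c) z.
Proof. by apply/nearC; exists 1 => // w _; exact: der_cst. Qed.
Lemma holo_id z : holo (fun x : C => x) z.
Proof. by apply/nearC; exists 1 => // w _; exact: der_id. Qed.
Lemma holoD f g z : holo f z -> holo g z -> holo (fun x => f x + g x) z.
Proof. by apply: nearS2 => x hf hg; exact: (derD hf hg). Qed.
Lemma holoB f g z : holo f z -> holo g z -> holo (fun x => f x - g x) z.
Proof. by apply: nearS2 => x hf hg; exact: (derB hf hg). Qed.
Lemma holoM f g z : holo f z -> holo g z -> holo (fun x => f x * g x) z.
Proof. by apply: nearS2 => x hf hg; exact: (derM hf hg). Qed.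
Lemma holoX f n z : holo f z -> holo (fun x => f x ^+ n) z.
Proof. by apply: nearS => x hf; exact: derX. Qed.

Lemma cont_near_neq0 f z : f z != 0 -> {for z, continuous f} ->
  \forall w \near z, f w != 0.
Proof.
move=> fz /continuousC/(_ (nm (f z))); rewrite nm_gt0 => /(_ fz) [d d0 hd].
apply/nearC; exists d => // w /hd; apply: contraTneq => ->.
by rewrite sub0r nmN ltxx.
Qed.

Lemma holoV f z : f z != 0 -> holo f z -> holo (fun x => (f x)^-1) z.
Proof.
move=> fz hf; have h := cont_near_neq0 fz (derivable_cont (holo_der hf)).
by apply: nearS2 hf h => x df fx; exact: (derV fx df).
Qed.

Lemma expr_lt (q e : R) : 0 <= q -> q < 1 -> 0 < e -> exists k : nat, q ^+ k < e.
Proof.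
move=> q0 q1 e0.
have : (fun k : nat => q ^+ k) @ \oo --> (0 : R).
  by apply: cvg_expr; rewrite ger0_norm.
move=> /cvgrPdist_lt /(_ e e0) [N _ /(_ N (leqnn N))] /=.
by rewrite sub0r normrN ger0_norm ?exprn_ge0// => hN; exists N.
Qed.

Lemma cont_eq f g z0 : {for z0, continuous f} -> {for z0, continuous g} ->
  (\forall z \near z0^', f z = g z) -> f z0 = g z0.
Proof.
move=> cf cg /dnearC[d d0 hd]; apply/eqP; rewrite -subr_eq0 -nm_eq0.
apply/negPn/negP => n0.
have {}n0 : 0 < nm (f z0 - g z0) by rewrite lt_neqAle eq_sym n0 nm_ge0.
have := contB cf cg => /continuousC/(_ _ n0) [d' d'0 hd'].
pose m := Num.min d d' / 2; have m0 : 0 < m by rewrite divr_gt0// lt_min d0.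
have mm : m < Num.min d d' by rewrite ltr_pdivrMr// ltr_pMr ?ltr1n// lt_min d0.
have := mm; rewrite lt_min => /andP[md md'].
pose z := z0 + pt m 0.
have nz : nm (z - z0) = m by rewrite addrAC subrr add0r nmE/= expr0n addr0 sqrtr_sqr gtr0_norm.
have zz0 : z != z0 by rewrite -subr_eq0 -nm_gt0 nz.
have := hd' z; rewrite nz => /(_ md').
by rewrite (hd z zz0) ?nz// subrr sub0r nmN ltxx.
Qed.

Lemma square_x (z0 : C) (r : R) : 0 < r -> re z0 - r < re z0 + r.
Proof. by move=> r0; lra. Qed.
Lemma square_y (z0 : C) (r : R) : 0 < r -> im z0 - r < im z0 + r.
Proof. by move=> r0; lra. Qed.

Lemma square_near (z0 : C) (r : R) w : nm (w - z0) < r ->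
  interior_rect (re z0 - r) (re z0 + r) (im z0 - r) (im z0 + r) w.
Proof.
move=> h; have := nm_re (w - z0); have := nm_im (w - z0).
by rewrite reB imB !ler_norml /interior_rect; split; lra.
Qed.

Lemma square_bd (z0 : C) (r : R) z :
  onrect (re z0 - r) (re z0 + r) (im z0 - r) (im z0 + r) z -> r <= nm (z - z0).
Proof.
have := nm_re (z - z0); have := nm_im (z - z0).
by rewrite reB imB !ler_norml => h1 h2 [_]; case => h; lra.
Qed.

Lemma square_in (z0 : C) (r : R) z :
  inrect (re z0 - r) (re z0 + r) (im z0 - r) (im z0 + r) z -> nm (z - z0) <= r + r.
Proof.
move=> [h1 h2]; rewrite (le_trans (nm_le _))// reB imB.
by apply: lerD; rewrite ler_norml; lra.
Qed.

Lemma holo_square f z0 : holo f z0 -> exists2 r : R, 0 < r &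
  forall z, nm (z - z0) <= r + r -> derivable f z 1.
Proof.
move=> /nearC[e e0 he]; exists (e / 3); first by rewrite divr_gt0.
by move=> z hz; apply: he; apply: le_lt_trans hz _; clear -e0; lra.
Qed.

Lemma square_cauchy f z0 r w : 0 < r ->
  (forall z, nm (z - z0) <= r + r -> derivable f z 1) -> nm (w - z0) < r ->
  f w * oint (fun z => (z - w)^-1) (re z0 - r) (re z0 + r) (im z0 - r) (im z0 + r) =
  oint (fun z => f z / (z - w)) (re z0 - r) (re z0 + r) (im z0 - r) (im z0 + r).
Proof.
move=> r0 df wr; apply: cauchy_formula.
- exact: square_x.
- exact: square_y.
- exact: square_near.
- by move=> z /square_in; exact: df.
Qed.

Lemma square_const_derive z0 r w : 0 < r -> nm (w - z0) < r ->
  derivable (fun w => oint (fun z => (z - w)^-1) (re z0 - r) (re z0 + r) (im z0 - r) (im z0 + r)) w 1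
  /\ derivable ('D_1 (fun w => oint (fun z => (z - w)^-1) (re z0 - r) (re z0 + r) (im z0 - r) (im z0 + r))) w 1.
Proof.
move=> r0 wr.
have c1 : rectcont (fun=> 1 : C) (re z0 - r) (re z0 + r) (im z0 - r) (im z0 + r).
  by move=> z _; exact: cont_cst.
have e w' : (fun z : C => (z - w')^-1) = (fun z => 1 * (z - w')^-1).
  by apply/funext => z; rewrite mul1r.
have -> : (fun w => oint (fun z => (z - w)^-1) (re z0 - r) (re z0 + r) (im z0 - r) (im z0 + r)) =
  (fun w => oint (fun z => 1 * (z - w)^-1) (re z0 - r) (re z0 + r) (im z0 - r) (im z0 + r)).
  by apply/funext => w'; rewrite e.
split.
  by case: (cauchy_derive1 (square_x z0 r0) (square_y z0 r0) c1 (square_near wr)).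
apply: near_der (cauchy_derive2 (square_x z0 r0) (square_y z0 r0) c1 (square_near wr)).
apply/nearC; exists (r - nm (w - z0)); first by rewrite subr_gt0.
move=> w' w'r; have w'z : nm (w' - z0) < r by have := nm_tri w' z0 w; lra.
by case: (cauchy_derive1 (square_x z0 r0) (square_y z0 r0) c1 (square_near w'z)).
Qed.

Lemma square_bdcont f z0 r : 0 < r ->
  (forall z, nm (z - z0) <= r + r -> derivable f z 1) ->
  rectcont f (re z0 - r) (re z0 + r) (im z0 - r) (im z0 + r).
Proof.
by move=> r0 df z [/square_in zr _]; apply: derivable_cont; exact: df.
Qed.

Lemma square_int_derive (phi : C -> C) z0 r w : 0 < r ->
  rectcont phi (re z0 - r) (re z0 + r) (im z0 - r) (im z0 + r) -> nm (w - z0) < r ->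
  derivable (fun w => oint (fun z => phi z / (z - w)) (re z0 - r) (re z0 + r) (im z0 - r) (im z0 + r)) w 1
  /\ derivable ('D_1 (fun w => oint (fun z => phi z / (z - w)) (re z0 - r) (re z0 + r) (im z0 - r) (im z0 + r))) w 1.
Proof.
move=> r0 c1 wr; split.
  by case: (cauchy_derive1 (square_x z0 r0) (square_y z0 r0) c1 (square_near wr)).
apply: near_der (cauchy_derive2 (square_x z0 r0) (square_y z0 r0) c1 (square_near wr)).
apply/nearC; exists (r - nm (w - z0)); first by rewrite subr_gt0.
move=> w' w'r; have w'z : nm (w' - z0) < r by have := nm_tri w' z0 w; lra.
by case: (cauchy_derive1 (square_x z0 r0) (square_y z0 r0) c1 (square_near w'z)).
Qed.

Lemma square_const_neq0 z0 r w : 0 < r -> nm (w - z0) < r ->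
  oint (fun z => (z - w)^-1) (re z0 - r) (re z0 + r) (im z0 - r) (im z0 + r) != 0.
Proof.
move=> r0 wr; apply: cauchy_const_neq0; [exact: square_x|exact: square_y|exact: square_near].
Qed.

(** The winding factor K is not known to be constant, so f K = J is differentiated as a product. J
    and K are Cauchy integrals, hence twice differentiable, and the formula obtained for the
    derivative of f is differentiable. *)
Lemma holo_derive f z0 : holo f z0 -> holo ('D_1 f) z0.
Proof.
move=> /holo_square[r r0 df].
pose K w := oint (fun z => (z - w)^-1) (re z0 - r) (re z0 + r) (im z0 - r) (im z0 + r).
pose J w := oint (fun z => f z / (z - w)) (re z0 - r) (re z0 + r) (im z0 - r) (im z0 + r).
have hK w : nm (w - z0) < r -> [/\ K w != 0, derivable K w 1 & derivable ('D_1 K) w 1].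
  by move=> wr; have [h1 h2] := square_const_derive r0 wr;
    split; [exact: square_const_neq0|exact: h1|exact: h2].
have hJ w : nm (w - z0) < r -> derivable J w 1 /\ derivable ('D_1 J) w 1.
  by move=> wr; exact: (square_int_derive r0 (square_bdcont r0 df) wr).
have fE w : nm (w - z0) < r -> f w * K w = J w by move=> wr; exact: square_cauchy.
apply/nearC; exists r => // w wr.
have near_r x : nm (x - z0) < r -> \forall y \near x, nm (y - z0) < r.
  move=> xr; apply/nearC; exists (r - nm (x - z0)); first by rewrite subr_gt0.
  by move=> y yx; have := nm_tri y z0 x; lra.
have dfw x : nm (x - z0) < r -> derivable f x 1.
  by move=> xr; apply: df; clear -xr r0; lra.
have DE x : nm (x - z0) < r -> ('D_1 J x - f x * 'D_1 K x) / K x = 'D_1 f x.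
  move=> xr; have [Kx dK _] := hK x xr.
  have -> : 'D_1 J x = 'D_1 (fun y => f y * K y) x.
    by apply: near_eq_derive; apply: nearS (near_r x xr) => y /fE.
  rewrite (deriveM (dfw x xr) dK).
  by rewrite [X in X - _]addrC addrK [_ *: _]mulrC mulfK.
apply: (@near_der _ (fun x => ('D_1 J x - f x * 'D_1 K x) / K x)).
  by apply: nearS (near_r w wr) => x /DE.
have [Kw dK dK'] := hK w wr; have [dJ dJ'] := hJ w wr.
apply: derM; last exact: (derV Kw dK).
by apply: derB; [exact: dJ'|apply: derM; [exact: dfw|exact: dK']].
Qed.

Lemma quot_holo f z0 : holo f z0 -> holo (quot f z0) z0.
Proof.
move=> hf; have [r r0 df] := holo_square hf.
suff d0 : derivable (quot f z0) z0 1.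
  apply: nearS hf => z dz; have [->//|zz] := eqVneq z z0.
  exact: quot_der.
pose K w := oint (fun z => (z - w)^-1) (re z0 - r) (re z0 + r) (im z0 - r) (im z0 + r).
pose G z := f z - f z0.
have dG z : nm (z - z0) <= r + r -> derivable G z 1.
  by move=> /df dfz; apply: derB; [exact: dfz|exact: der_cst].
have cG := square_bdcont r0 dG.
pose phi z := G z / (z - z0).
have bd_neq w z : nm (w - z0) < r -> onrect (re z0 - r) (re z0 + r) (im z0 - r) (im z0 + r) z -> z - w != 0.
  move=> wr /square_bd zr; rewrite subr_eq0; apply: contraTneq wr => <-.
  by rewrite -leNgt.
have z0r : nm (z0 - z0) < r by rewrite subrr nm0.
have cV w : nm (w - z0) < r -> rectcont (fun z => (z - w)^-1) (re z0 - r) (re z0 + r) (im z0 - r) (im z0 + r).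
  move=> wr z zb; apply: derivable_cont; apply: derV; last exact: derBc.
  exact: bd_neq wr zb.
have cphi : rectcont phi (re z0 - r) (re z0 + r) (im z0 - r) (im z0 + r).
  by move=> z zb; apply: contM; [exact: cG|exact: cV z0r z zb].
pose J w := oint (fun z => phi z / (z - w)) (re z0 - r) (re z0 + r) (im z0 - r) (im z0 + r).
have dJ : derivable J z0 1 := (square_int_derive r0 cphi z0r).1.
have dK : derivable K z0 1 := (square_const_derive r0 z0r).1.
have K0 : K z0 != 0 := square_const_neq0 r0 z0r.
have dJK : derivable (fun w => J w / K w) z0 1 by apply: derM; [exact: dJ|exact: derV].
have qE w : w != z0 -> nm (w - z0) < r -> quot f z0 w = J w / K w.
  move=> wz wr; rewrite /quot (negPf wz).
  have Kw : K w != 0 := square_const_neq0 r0 wr.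
  have wz0 : w - z0 != 0 by rewrite subr_eq0.
  apply/eqP; rewrite eqr_div//; apply/eqP.
  (* As G vanishes at z0, the formula at z0 says that [phi] has integral 0. Subtracting it from the
     formula at w turns G(z) / (z - w) into (w - z0) phi(z) / (z - w). *)
  have e0 := square_cauchy r0 dG z0r; rewrite {1}/G subrr mul0r in e0.
  have e1 := square_cauchy r0 dG wr.
  rewrite -/(G w) -/(K w) in e1 *; rewrite e1 -[LHS]subr0 {1}e0.
  have h1 : rectcont (fun z => G z / (z - w)) (re z0 - r) (re z0 + r) (im z0 - r) (im z0 + r).
    by move=> z zb; apply: contM; [exact: cG|exact: cV wr z zb].
  have h2 : rectcont (fun z => phi z / (z - w)) (re z0 - r) (re z0 + r) (im z0 - r) (im z0 + r).
    by move=> z zb; apply: contM; [exact: cphi|exact: cV wr z zb].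
  have xx := ltW (square_x z0 r0); have yy := ltW (square_y z0 r0).
  rewrite -(ointB xx yy h1 cphi) mulrC -(ointZ (w - z0) xx yy h2).
  apply: eq_oint xx yy _ => z zb; rewrite /phi.
  have n1 := bd_neq _ _ wr zb; have n2 := bd_neq _ _ z0r zb.
  by field; rewrite n1 n2.
have near_r : \forall w \near z0, nm (w - z0) < r by apply/nearC; exists r.
have q0 : quot f z0 z0 = J z0 / K z0.
  apply: (cont_eq (f := quot f z0) (g := fun w => J w / K w)).
  - exact/quot_cont/holo_der.
  - exact: derivable_cont dJK.
  - by apply/dnearC; exists r => // w wz wr; exact: qE.
apply: near_der dJK; apply: nearS near_r => w wr.
by have [->//|wz] := eqVneq w z0; rewrite qE.
Qed.

(** Cauchy's formula for f^k gives |f(z0)|^k K <= 16 M^k, where M is the maximum of |f| on the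
    boundary of a square around z0 and K does not depend on k. If M were smaller than |f(z0)|, a
    large k would contradict this. The point found is on the boundary, hence different from z0. *)
Lemma max_modulus f z0 (e : R) : holo f z0 -> 0 < e ->
  exists z, [/\ z != z0, nm (z - z0) < e & nm (f z0) <= nm (f z)].
Proof.
move=> /nearC[e' e'0 he'] e0.
pose r := Num.min e e' / 3.
have m0 : 0 < Num.min e e' by rewrite lt_min e0.
have r0 : 0 < r by rewrite divr_gt0.
have [re' re''] : r + r < e /\ r + r < e'.
  have [m1 m2] : Num.min e e' <= e /\ Num.min e e' <= e' by rewrite !ge_min !lexx orbT.
  by rewrite /r; clear -m0 m1 m2; lra.
have df z : nm (z - z0) <= r + r -> derivable f z 1.
  by move=> zr; apply: he'; apply: le_lt_trans zr re''.
have xx := square_x z0 r0; have yy := square_y z0 r0.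
have cf := square_bdcont r0 df.
have [zm bm hm] := rect_max xx yy cf.
case: (leP (nm (f z0)) (nm (f zm))) => h.
  exists zm; split => //; last by apply: le_lt_trans re'; case: bm => /square_in.
  by rewrite -subr_eq0 -nm_gt0; apply: lt_le_trans r0 _; exact: square_bd bm.
exfalso.
have a0 : 0 < nm (f z0) by apply: le_lt_trans h; exact: nm_ge0.
have z0r : nm (z0 - z0) < r by rewrite subrr nm0.
have := square_const_neq0 r0 z0r; rewrite -nm_gt0; set K := nm _ => K0.
pose q := nm (f zm) / nm (f z0).
have q0 : 0 <= q by rewrite divr_ge0 ?nm_ge0.
have q1 : q < 1 by rewrite ltr_pdivrMr ?mul1r.
have [k hk] := expr_lt q0 q1 (divr_gt0 K0 (ltr0Sn R 15)).
have dfk z : nm (z - z0) <= r + r -> derivable (fun x => f x ^+ k) z 1.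
  by move=> /df; exact: derX.
have := square_cauchy r0 dfk z0r => /(congr1 nm); rewrite nmM -/K nmX => eK.
have cc : rectcont (fun z => f z ^+ k / (z - z0)) (re z0 - r) (re z0 + r) (im z0 - r) (im z0 + r).
  move=> z zb; apply: contM; first exact: (square_bdcont r0 dfk zb).
  apply: derivable_cont; apply: derV; last exact: derBc.
  by rewrite -nm_gt0; apply: lt_le_trans r0 (square_bd zb).
have := @oint_bound _ _ _ _ _ _ (nm (f zm) ^+ k / r) (ltW xx) (ltW yy) cc.
rewrite -eK => hB.
have {}hB : nm (f z0) ^+ k * K <= 4 * (nm (f zm) ^+ k / r) * (re z0 + r - (re z0 - r) + (im z0 + r - (im z0 - r))).
  apply: hB => z zb; rewrite nmM nmX nmV; apply: ler_pM.
  - by rewrite exprn_ge0// nm_ge0.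
  - by rewrite invr_ge0 nm_ge0.
  - by apply: le_expr; [exact: nm_ge0|exact: hm].
  - by rewrite lef_pV2 ?posrE// ?(lt_le_trans r0) ?(square_bd zb).
have e2 : 4 * (nm (f zm) ^+ k / r) * (re z0 + r - (re z0 - r) + (im z0 + r - (im z0 - r))) =
  16 * nm (f zm) ^+ k by field; rewrite gt_eqF.
rewrite e2 in hB.
move: hk; rewrite ltr_pdivlMr// /q expr_div_n mulrAC ltr_pdivrMr ?exprn_gt0// => hk.
rewrite [K * _]mulrC [_ * 16]mulrC in hk.
by have := lt_le_trans hk hB; rewrite ltxx.
Qed.

End Holomorphic.

(** * Removable singularities, zeros, connectedness *)

Section RemovableSingularities.
Context {R : realType}.
Local Notation C := (Cplx R).
Implicit Types (f g : C -> C) (z : C).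

Lemma dnearS z (P Q : C -> Prop) : (forall x, P x -> Q x) ->
  (\forall x \near z^', P x) -> \forall x \near z^', Q x.
Proof. exact: (@filterS C (dnbhs z) (dnbhs_filter z) P Q). Qed.
Lemma dnearS2 z (P Q S : C -> Prop) : (forall x, P x -> Q x -> S x) ->
  (\forall x \near z^', P x) -> (\forall x \near z^', Q x) ->
  \forall x \near z^', S x.
Proof. exact: (@filterS2 C (dnbhs z) (dnbhs_filter z) P Q S). Qed.
Lemma near_dnear z (P : C -> Prop) :
  (\forall x \near z, P x) -> \forall x \near z^', P x.
Proof. exact: (@nbhs_dnbhs C z P). Qed.
Lemma dnear_neq z : \forall x \near z^', x != z.
Proof. by apply/dnearC; exists 1. Qed.

(** Multiplication by (z - z0)^2 makes f differentiable at z0, with value and derivative 0; two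
    difference quotients at z0 then divide the square out again. *)
Lemma removable f z0 (B : R) :
  (\forall z \near z0^', derivable f z 1) ->
  (\forall z \near z0^', nm (f z) <= B) ->
  exists2 g, holo g z0 & \forall z \near z0^', f z = g z.
Proof.
move=> hf /dnearC[d d0 hB].
pose G z := (z - z0) ^+ 2 * f z.
have G0 : G z0 = 0 by rewrite /G subrr expr0n mul0r.
have dG0 : is_derive z0 1 G 0.
  apply/is_deriveC => e e0; have B1 : 0 < `|B| + 1 by rewrite ltr_wpDl.
  exists (Num.min d (e / (`|B| + 1))); first by rewrite lt_min d0 divr_gt0.
  move=> z; rewrite lt_min => /andP[zd ze].
  rewrite G0 subr0 mul0r subr0 /G nmM nmX.
  have [->|zz] := eqVneq z z0; first by rewrite subrr nm0 expr0n mul0r mulr0.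
  rewrite expr2 -mulrA [leRHS]mulrC; apply: ler_wpM2l; first exact: nm_ge0.
  apply: le_trans (_ : nm (z - z0) * (`|B| + 1) <= _).
    apply: ler_wpM2l; first exact: nm_ge0.
    by apply: le_trans (hB z zz zd) _; rewrite (le_trans (ler_norm B))// lerDl.
  by rewrite -ler_pdivlMr// ltW.
have hG : holo G z0.
  move/dnearC: hf => [d' d'0 hd']; apply/nearC; exists d' => // z zd'.
  have [->|zz] := eqVneq z z0; first by case: dG0.
  by apply: derM; [apply: derX; exact: derBc|exact: hd'].
have hQ := quot_holo hG.
have Q0 : quot G z0 z0 = 0 by rewrite /quot eqxx; case: dG0.
exists (quot (quot G z0) z0); first exact: quot_holo.
apply: dnearS (dnear_neq z0) => z zz.
have zn : z - z0 != 0 by rewrite subr_eq0.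
rewrite /quot (negPf zz) eqxx -/(quot G z0 z0).
have -> : 'D_1 G z0 = 0 by case: dG0.
rewrite G0 !subr0 /G; field; exact: zn.
Qed.

(** Zeros are divided out one by one. If this never ends, f(w) = (w - z0)^k F_k(w) for all k;
    Cauchy's formula for F_k on a square of half side r then shows |f(w)| = O(2^-k) as soon as |w -
    z0| < r / 2. *)
Lemma zero_factor f z0 : holo f z0 ->
  (\forall z \near z0, f z = 0) \/
  exists k g, [/\ holo g z0, g z0 != 0 & forall z, f z = (z - z0) ^+ k * g z].
Proof.
move=> hf; pose F k := iter k (fun h => quot h z0) f.
have hF k : holo (F k) z0 by elim: k => [|k ih]; [exact: hf|exact: (quot_holo ih)].
case: (pselect (exists k, F k z0 != 0)) => [[k0 hk0]|nz].
  right; have exk : exists k, F k z0 != 0 by exists k0.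
  have [k Fk mk] := ex_minnP exk; exists k, (F k); split; [exact: hF|exact: Fk|move=> z].
  have Fj j : (j < k)%N -> F j z0 = 0.
    by move=> jk; apply/eqP; apply/negPn/negP => /mk; rewrite leqNgt jk.
  have : forall j, (j <= k)%N -> f z = (z - z0) ^+ j * F j z.
    elim=> [|j ih] jk; first by rewrite expr0 mul1r.
    rewrite ih ?(ltnW jk)// (quotE _ (Fj j jk)) exprSr mulrA //.
  exact.
left.
have F0 k : F k z0 = 0.
  by apply/eqP; apply/negPn/negP => h; apply: nz; exists k.
have fE k z : f z = (z - z0) ^+ k * F k z.
  elim: k => [|k ih]; first by rewrite expr0 mul1r.
  by rewrite ih (quotE _ (F0 k)) exprSr mulrA.
have [r r0 df] := holo_square hf.
have dF k z : nm (z - z0) <= r + r -> derivable (F k) z 1.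
  move=> zr; elim: k => [|k ih]; first exact: df.
  have [->|zz] := eqVneq z z0; first exact: holo_der (hF k.+1).
  exact: (quot_der zz ih).
have cf := square_bdcont r0 df.
have xx := square_x z0 r0; have yy := square_y z0 r0.
have [zm bm hm] := rect_max xx yy cf.
have near_r : exists2 e : R, 0 < e & forall w, nm (w - z0) < e -> nm (w - z0) < r / 2.
  by exists (r / 2) => //; rewrite divr_gt0.
apply/nearC; exists (r / 2); first by rewrite divr_gt0.
move=> w wr2; apply/eqP; rewrite -nm_eq0; apply/negPn/negP => fw0.
have {}fw0 : 0 < nm (f w) by rewrite lt_neqAle eq_sym fw0 nm_ge0.
have wr : nm (w - z0) < r by clear -wr2 r0; lra.
have := square_const_neq0 r0 wr; rewrite -nm_gt0; set K := nm _ => K0.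
pose M := nm (f zm) / (r / 2) * 16 * r + 1.
have M0 : 0 < M.
  by rewrite ltr_wpDl// mulr_ge0 ?(ltW r0)// mulr_ge0// divr_ge0 ?nm_ge0// divr_ge0 ?(ltW r0).
have h1 : 0 <= 2^-1 :> R by rewrite invr_ge0.
have h2 : 2^-1 < 1 :> R by rewrite invf_lt1// ltr1n.
have [k hk] := expr_lt h1 h2 (divr_gt0 (mulr_gt0 fw0 K0) M0).
have := square_cauchy r0 (dF k) wr => /(congr1 nm); rewrite nmM -/K => eK.
have cc : rectcont (fun z => F k z / (z - w)) (re z0 - r) (re z0 + r) (im z0 - r) (im z0 + r).
  move=> z zb; apply: contM; first exact: (square_bdcont r0 (dF k) zb).
  apply: derivable_cont; apply: derV; last exact: derBc.
  rewrite subr_eq0; apply: contraTneq wr => <-.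
  by rewrite -leNgt; exact: square_bd zb.
have hB z : onrect (re z0 - r) (re z0 + r) (im z0 - r) (im z0 + r) z ->
    nm (F k z / (z - w)) <= (nm (f zm) / r ^+ k) / (r / 2).
  move=> zb; have zr := square_bd zb.
  have zn : z - z0 != 0 by rewrite -nm_gt0; exact: lt_le_trans zr.
  have -> : F k z = f z / (z - z0) ^+ k by rewrite (fE k) mulrAC mulfV ?mul1r// expf_neq0.
  rewrite nmM nmV; apply: ler_pM.
  - exact: nm_ge0.
  - by rewrite invr_ge0 nm_ge0.
  - rewrite nmM nmV nmX; apply: ler_pM; rewrite ?invr_ge0 ?exprn_ge0 ?nm_ge0//.
      exact: hm.
    have rk : 0 < r ^+ k by rewrite exprn_gt0.
    have rk' : r ^+ k <= nm (z - z0) ^+ k by apply: le_expr => //; exact: ltW.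
    by rewrite lef_pV2 ?posrE// (lt_le_trans rk).
  - have h : r / 2 <= nm (z - w) by have := nm_tri z z0 w; clear -zr wr2; lra.
    have r20 : 0 < r / 2 by rewrite divr_gt0.
    by rewrite lef_pV2 ?posrE// (lt_le_trans r20).
have := oint_bound (ltW xx) (ltW yy) cc hB; rewrite -eK => hI.
have rk : 0 < r ^+ k by rewrite exprn_gt0.
have e1 : 4 * (nm (f zm) / r ^+ k / (r / 2)) * (re z0 + r - (re z0 - r) + (im z0 + r - (im z0 - r))) =
  (M - 1) / r ^+ k by rewrite /M; field; rewrite !gt_eqF.
rewrite {}e1 in hI.
have hw : nm (f w) <= (2^-1) ^+ k * r ^+ k * nm (F k w).
  rewrite (fE k w) nmM nmX -exprMn; apply: ler_wpM2r; first exact: nm_ge0.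
  by apply: le_expr; [exact: nm_ge0|rewrite mulrC; exact: ltW].
have h3 : nm (f w) * K <= (2^-1) ^+ k * M.
  apply: le_trans (_ : (2^-1) ^+ k * r ^+ k * nm (F k w) * K <= _).
    by apply: ler_wpM2r => //; exact: ltW.
  rewrite -!mulrA; apply: ler_wpM2l; first by rewrite exprn_ge0.
  rewrite ler_pdivlMr// in hI; rewrite mulrC; apply: le_trans hI _.
  by rewrite lerBlDr lerDl.
by move: hk; rewrite ltr_pdivlMr// => /le_lt_trans -/(_ _ h3); rewrite ltxx.
Qed.

Lemma isolated_zero f z0 : holo f z0 ->
  (\forall z \near z0, f z = 0) \/ (\forall z \near z0^', f z != 0).
Proof.
move=> /zero_factor[|[k [g [hg g0 fE]]]]; [by left|right].
have hgn := near_dnear (cont_near_neq0 g0 (derivable_cont (holo_der hg))).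
apply: dnearS2 (dnear_neq z0) hgn => z zz gz.
by rewrite fE mulf_neq0// expf_neq0// subr_eq0.
Qed.

(** Otherwise f - f(z0) = (z - z0)^(k + 1) g with g(z0) nonzero. Cancelling (z - z0)^k in the
    derivative leaves (k + 1) g + (z - z0) g' = 0 off z0, and continuity gives g(z0) = 0. *)
Lemma derive0_const f z0 : holo f z0 -> (\forall z \near z0^', 'D_1 f z = 0) ->
  \forall z \near z0, f z = f z0.
Proof.
move=> hf df0; have hfB : holo (fun z => f z - f z0) z0 by apply: holoB; [exact: hf|exact: holo_cst].
case: (zero_factor hfB) => [h|[k [g [hg g0 fE]]]].
  by apply: nearS h => z /eqP; rewrite subr_eq0 => /eqP.
exfalso; case: k fE => [|k] fE.
  by move: (fE z0) g0; rewrite subrr expr0 mul1r => <-; rewrite eqxx.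
have hg' := holo_derive hg.
have e : \forall z \near z0^', k.+1%:R * g z + (z - z0) * 'D_1 g z = 0.
  have h1 := near_dnear hf; have h2 := near_dnear hg.
  apply: dnearS2 (dnear_neq z0) (dnearS2 (fun x a b => conj a b) df0 (dnearS2 (fun x a b => conj a b) h1 h2)) => z zz [dz [dfz dgz]].
  have zn : z - z0 != 0 by rewrite subr_eq0.
  have d1 : is_derive z 1 (fun x : C => x - z0) 1.
    by apply: is_derive_eq; rewrite subr0.
  have e1 : is_derive z 1 (fun x => (x - z0) ^+ k.+1 * g x) ((z - z0) ^+ k * (k.+1%:R * g z + (z - z0) * 'D_1 g z)).
    have d2 : is_derive z 1 ((fun x : C => x - z0) ^+ k.+1) (k.+1%:R * (z - z0) ^+ k *: 1) by apply: is_deriveX.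
    have d3 : is_derive z 1 g ('D_1 g z) by apply: derivableP; exact: dgz.
    have := is_deriveM d2 d3.
    have -> : (fun x : C => x - z0) ^+ k.+1 * g = (fun x => (x - z0) ^+ k.+1 * g x).
      by apply/funext => x; rewrite /= mulrfctE exprfctE.
    move=> h; apply: (is_derive_eq h).
    have -> : ((fun x : C => x - z0) ^+ k.+1) z = (z - z0) ^+ k.+1 by rewrite exprfctE.
    rewrite /GRing.scale /= exprS; ring.
  have e2 : 'D_1 f z = 'D_1 (fun x => f x - f z0) z.
    have [_] := is_deriveB (derivableP dfz) (is_derive_cst (f z0) z 1).
    by rewrite subr0 => <-.
  have e3 : (fun x => f x - f z0) = (fun x => (x - z0) ^+ k.+1 * g x).
    by apply/funext => x; exact: fE.
  move: dz; rewrite e2 e3; case: e1 => _ -> /eqP.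
  by rewrite mulf_eq0 (negPf (expf_neq0 _ zn)) => /eqP.
have cg := derivable_cont (holo_der hg); have cg' := derivable_cont (holo_der hg').
have c1 : {for z0, continuous (fun z => k.+1%:R * g z + (z - z0) * 'D_1 g z)}.
  apply: contD; first by apply: contMl; exact: cg.
  by apply: contM; [apply: derivable_cont; exact: derBc|exact: cg'].
have c2 : {for z0, continuous (fun=> 0 : C)} by exact: cont_cst.
have /eqP := cont_eq c1 c2 e; rewrite subrr mul0r addr0.
by rewrite mulf_eq0 pnatr_eq0 (negPf g0).
Qed.

(** Connectedness of the plane, tested on the segment from a point of [P] to an arbitrary point: the
    supremum of the initial parts contained in [P] can only be its end. *)
Lemma clopen_all (P : C -> Prop) : (exists z, P z) ->
  (forall z, P z -> \forall w \near z, P w) ->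
  (forall z, ~ P z -> \forall w \near z, ~ P w) -> forall z, P z.
Proof.
move=> [a Pa] oP oN b; apply: contrapT => nPb.
pose p t : C := a + pt t 0 * (b - a).
have cp (t : R) (Q : C -> Prop) : (\forall w \near p t, Q w) ->
    exists2 d : R, 0 < d & forall s, `|s - t| < d -> Q (p s).
  move=> /nearC[e e0 he].
  have n1 : 0 < nm (b - a) + 1 by rewrite ltr_wpDl ?nm_ge0.
  exists (e / (nm (b - a) + 1)); first exact: divr_gt0.
  move=> s; rewrite ltr_pdivlMr// => hs; apply: he.
  have -> : p s - p t = pt (s - t) 0 * (b - a).
    rewrite /p opprD addrACA subrr add0r -mulrBl; congr (_ * _).
    by apply: eqC; rewrite ?reB ?imB//= subrr.
  rewrite nmM (_ : nm (pt (s - t) 0) = `|s - t|); last first.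
    by rewrite nmE/= expr0n addr0 sqrtr_sqr.
  by apply: le_lt_trans hs; rewrite ler_wpM2l// lerDl.
pose E := [set t : R | 0 <= t <= 1 /\ forall s, 0 <= s <= t -> P (p s)].
have p0 : p 0 = a by rewrite /p (_ : pt 0 0 = 0) ?mul0r ?addr0.
have p1 : p 1 = b by rewrite /p (_ : pt 1 0 = 1) ?mul1r ?subrKC.
have E0 : E 0.
  split; first by rewrite lexx ler01.
  by move=> s /andP[s0 s1]; rewrite (_ : s = 0) ?p0//; apply: le_anti; rewrite s0 s1.
have ubE : ubound E 1 by move=> t [/andP[]].
have hsE : has_sup E by split; [exists 0|exists 1].
set T := sup E.
have T0 : 0 <= T by apply: ub_le_sup => //; exists 1.
have T1 : T <= 1 by apply: ge_sup => //; exists 0.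
have below s : 0 <= s -> s < T -> P (p s).
  move=> s0 sT; have sT' : 0 < T - s by rewrite subr_gt0.
  have [t [tE ht]] := sup_adherent sT' hsE.
  by rewrite /= -/T subKr => ts; apply: ht; rewrite s0 /= ltW.
case: (pselect (P (p T))) => PT; last first.
  have [d d0 hd] := cp T _ (oN _ PT).
  have Tn0 : T != 0 by apply: contra_notN PT => /eqP ->; rewrite p0.
  have {}Tn0 : 0 < T by rewrite lt_neqAle eq_sym Tn0.
  have [v [vT v0 hv]] : exists v, [/\ v < T, 0 <= v & T - d / 2 <= v].
    exists (Num.max 0 (T - d / 2)); rewrite gt_max Tn0 ltrBlDr ltrDl divr_gt0//.
    by rewrite !le_max !lexx orbT.
  have hn : ~ P (p v).
    by apply: hd; rewrite ltr_norml; apply/andP; split; clear -hv vT d0; lra.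
  exact: hn (below _ v0 vT).
have [d d0 hd] := cp T _ (oP _ PT).
have [T1'|T1'] := ltP T 1; last first.
  by apply: nPb; rewrite -p1 (_ : 1 = T)//; apply: le_anti; rewrite T1 T1'.
have [v [vT v1 vd]] : exists v, [/\ T < v, v <= 1 & v <= T + d / 2].
  exists (Num.min 1 (T + d / 2)); rewrite lt_min T1' ltrDl divr_gt0//.
  by rewrite !ge_min !lexx orbT.
have : E v.
  split; first by rewrite v1 (le_trans T0 (ltW vT)).
  move=> t /andP[t0 ts]; have [tT|tT] := ltP t T; first exact: below.
  by apply: hd; rewrite ltr_norml; apply/andP; split; clear -tT ts vd d0; lra.
by move=> /(@sup_upper_bound R E hsE); rewrite -/T leNgt vT.
Qed.

End RemovableSingularities.

(** * Meromorphic functions *)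

Section Meromorphic.
Context {R : realType}.
Local Notation C := (Cplx R).
Implicit Types (f g : C -> option C) (F G : C -> C) (z : C).

Lemma lt_norm (z : C) (e : R) : (pt e 0 < `|z|) = (e < nm z).
Proof. by rewrite normE; exact: (ltcR). Qed.

Lemma dnear_ex z (P : C -> Prop) : (\forall x \near z^', P x) -> exists x, P x.
Proof.
move=> /dnearC[e e0 he]; have e20 : 0 < e / 2 by rewrite divr_gt0.
have n : nm (z + pt (e / 2) 0 - z) = e / 2.
  by rewrite addrAC subrr add0r nmE/= expr0n addr0 sqrtr_sqr gtr0_norm.
exists (z + pt (e / 2) 0); apply: he; last by rewrite n; clear -e0; lra.
by rewrite -subr_eq0 -nm_gt0 n.
Qed.

Lemma dnear_near z (P : C -> Prop) : (\forall x \near z^', P x) ->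
  \forall w \near z, \forall x \near w^', P x.
Proof.
move=> /dnearC[e e0 he]; apply/nearC; exists e => // w we; apply/dnearC.
have [->|wz] := eqVneq w z; first by exists e.
have nwz : 0 < nm (w - z) by rewrite nm_gt0 subr_eq0.
exists (Num.min (nm (w - z)) (e - nm (w - z))); first by rewrite lt_min nwz subr_gt0.
move=> x _; rewrite lt_min => /andP[x1 x2]; apply: he.
  by apply: contraTneq x1 => ->; rewrite nmBC ltxx.
by have := nm_tri x z w; clear -x2; lra.
Qed.

(** A meromorphic function seen as a holomorphic map to the sphere: [inv] selects the coordinate 1 /
    w, used at a pole, near which 1 / f is bounded and so has a removable singularity. *)
Lemma mero_chart f z0 : meromorphic f -> exists F (inv : bool),
  [/\ holo F z0,
      \forall z \near z0^', f z = Some (if inv then (F z)^-1 else F z),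
      inv -> F z0 = 0 /\ \forall z \near z0^', F z != 0 &
      f z0 = if inv then None else Some (F z0)].
Proof.
move=> /(_ z0)[hf|[f0 hf foo]].
  have fE : \forall z \near z0, f z = Some (finite_part f z).
    by apply: nearS hf => z [+ _]; rewrite /finite_part; case: (f z).
  exists (finite_part f), false; split => //.
  - by rewrite /holo; apply: nearS hf => z [].
  - exact: near_dnear fE.
  - exact: nbhs_singleton fE.
have big (M : R) : \forall z \near z0^', M < nm (finite_part f z).
  have : (\forall x \near +oo, pt M 0 < x :> C).
    exists (pt M 0); split => //.
    by have := complex_real M 0; rewrite eqxx.
  by move=> /foo; apply: dnearS => z /=; rewrite lt_norm.
have b1 := big 1.
have nz : \forall z \near z0^', finite_part f z != 0.
  by apply: dnearS b1 => z h; rewrite -nm_gt0; exact: lt_trans ltr01 h.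
have [||F hF FE] := @removable R (fun z => (finite_part f z)^-1) z0 1.
- by apply: dnearS2 nz hf => z fz [_ df]; exact: (derV fz df).
- apply: dnearS b1 => z h; rewrite nmV invf_le1 ?(lt_trans ltr01 h)//; exact: ltW.
have Fn : \forall z \near z0^', F z != 0.
  by apply: dnearS2 nz FE => z fz <-; rewrite invr_eq0.
exists F, true; split => //.
- apply: dnearS2 hf FE => z [+ _] <-; rewrite invrK /finite_part; by case: (f z).
- move=> _; split => //; apply/eqP; rewrite -nm_eq0; apply/negPn/negP => F0.
  have {}F0 : 0 < nm (F z0) by rewrite lt_neqAle eq_sym F0 nm_ge0.
  have F20 : 0 < nm (F z0) / 2 by rewrite divr_gt0.
  have := derivable_cont (holo_der hF); move=> /continuousC/(_ _ F20)/nearC/near_dnear h1.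
  have h2 := big (2 / nm (F z0)).
  have [z [[h3 h4] h5]] := dnear_ex (dnearS2 (fun x a b => conj a b) (dnearS2 (fun x a b => conj a b) h1 h2) FE).
  have h6 : nm (F z) < nm (F z0) / 2.
    rewrite -h5 nmV -[ltRHS]invrK invf_div ltf_pV2 ?posrE ?divr_gt0//.
    by apply: lt_trans h4; rewrite divr_gt0.
  have := nm_tri (F z0) 0 (F z); rewrite nmBC in h3; rewrite !subr0; clear -h3 h6; lra.
Qed.

Lemma mero_some f z0 : meromorphic f -> \forall z \near z0^', isSome (f z).
Proof. by move=> /(mero_chart z0)[F [i [_ h _ _]]]; apply: dnearS h => z ->. Qed.

(** In equal charts this is the isolation of the zeros of F - G. In different charts, 1 / F and G,
    say, cannot agree near z0, because F G is close to 0 there. *)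
Lemma mero_dich_local f g z0 : meromorphic f -> meromorphic g ->
  (\forall z \near z0^', f z = g z) \/ (\forall z \near z0^', f z <> g z).
Proof.
move=> /(mero_chart z0)[F [i [hF fE iF _]]] /(mero_chart z0)[G [j [hG gE jG _]]].
have fgE := dnearS2 (fun x a b => conj a b) fE gE.
have mixed (H K : C -> C) : holo H z0 -> holo K z0 -> H z0 = 0 ->
    (\forall z \near z0^', H z != 0) -> \forall z \near z0^', (H z)^-1 <> K z.
  move=> hH hK H0 Hn.
  have c : {for z0, continuous (fun z => H z * K z - 1)}.
    apply: derivable_cont; apply: derB; last exact: der_cst.
    by apply: derM; [exact: (holo_der hH)|exact: (holo_der hK)].
  have HK : H z0 * K z0 - 1 != 0 by rewrite H0 mul0r sub0r oppr_eq0 oner_eq0.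
  have h := near_dnear (@cont_near_neq0 _ (fun z => H z * K z - 1) z0 HK c).
  apply: dnearS2 Hn h => z Hz /negP h e; apply: h.
  by rewrite -e mulfV// subrr.
have [ij|ij] := eqVneq i j.
  have hB : holo (fun z => F z - G z) z0 by apply: holoB; [exact: hF|exact: hG].
  case: (isolated_zero hB) => [/near_dnear h|h]; [left|right].
    apply: dnearS2 fgE h => z [-> ->] /eqP; rewrite subr_eq0 => /eqP ->.
    by rewrite ij.
  apply: dnearS2 fgE h => z [-> ->] /negP h [] e; apply: h; rewrite subr_eq0.
  by move: e; rewrite ij; case: {+}j => [/invr_inj|] ->.
right; case: i j iF jG fgE ij {fE gE} => [] [] // iF jG fgE _.
  have [F0 Fn] := iF isT; apply: dnearS2 fgE (mixed F G hF hG F0 Fn) => z [-> ->] h [].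
  exact: h.
have [G0 Gn] := jG isT; apply: dnearS2 fgE (mixed G F hG hF G0 Gn) => z [-> ->] h [] e.
by apply: h; rewrite e.
Qed.

(** The identity theorem on the sphere. The points around which f and g agree form an open and
    closed set, and agreement around a point forces equal values at it, [None] included. The theorem
    needs this pointwise equality. *)
Lemma mero_dich f g : meromorphic f -> meromorphic g ->
  (forall z, f z = g z) \/ (forall z0, \forall z \near z0^', f z <> g z).
Proof.
move=> mf mg.
pose P z0 := \forall z \near z0^', f z = g z.
have NP z0 : ~ P z0 -> \forall z \near z0^', f z <> g z.
  by case: (mero_dich_local z0 mf mg).
case: (pselect (exists z, P z)) => [exP|nP]; last first.
  by right => z0; apply: NP => h; apply: nP; exists z0.
left.
have allP : forall z, P z.
  apply: clopen_all exP _ _ => z; first exact: dnear_near.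
  move=> /NP /dnear_near; apply: nearS => w h1 h2.
  by have [x []] := dnear_ex (dnearS2 (fun x a b => conj a b) h1 h2).
move=> z0; have h := allP z0.
have [F [i [hF fE iF ->]]] := mero_chart z0 mf.
have [G [j [hG gE jG ->]]] := mero_chart z0 mg.
have fgE : \forall z \near z0^', (if i then (F z)^-1 else F z) = (if j then (G z)^-1 else G z).
  apply: dnearS2 (dnearS2 (fun x a b => conj a b) fE gE) h => z [-> ->] [] //.
have cF := derivable_cont (holo_der hF); have cG := derivable_cont (holo_der hG).
have mixed (H K : C -> C) : {for z0, continuous H} -> {for z0, continuous K} ->
    H z0 = 0 -> (\forall z \near z0^', H z != 0) ->
    ~ (\forall z \near z0^', (H z)^-1 = K z).
  move=> cH cK H0 Hn e.
  have c1 : {for z0, continuous (fun=> 1 : C)} by exact: cont_cst.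
  have c2 := contM cH cK.
  have e2 : \forall z \near z0^', H z * K z = 1.
    by apply: dnearS2 Hn e => z Hz <-; rewrite mulfV.
  have := @cont_eq _ (fun z => H z * K z) (fun=> 1) z0 c2 c1 e2.
  by rewrite H0 mul0r => /esym/eqP; rewrite oner_eq0.
case: i j iF jG fgE {fE gE} => [] [] // iF jG fgE.
- by have [F0 Fn] := iF isT; case: (mixed F G cF cG F0 Fn).
- have [G0 Gn] := jG isT; case: (mixed G F cG cF G0 Gn).
  by apply: dnearS fgE => z ->.
- by rewrite (cont_eq cF cG fgE).
Qed.

Lemma mero_cst (a : C) : meromorphic (fun=> Some a).
Proof.
move=> z; left; apply/nearC; exists 1 => // w _; split; [by []|exact: der_cst].
Qed.

Lemma mero_neq f (a : C) z0 : meromorphic f -> nonconstant f ->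
  \forall z \near z0^', f z <> Some a.
Proof.
move=> mf nf; case: (mero_dich mf (mero_cst a)) => // h.
by case: nf; exists (Some a).
Qed.

Lemma mero_poly_neq0 f (s : {poly C}) z0 : meromorphic f -> nonconstant f ->
  s != 0 -> \forall z \near z0^', exists2 w, f z = Some w & s.[w] != 0.
Proof.
move=> mf nf s0; have [r sE] := closed_field_poly_normal s.
have h : \forall z \near z0^', forall a, a \in r -> f z <> Some a.
  elim: r {sE} => [|a r ih]; first by apply/dnearC; exists 1.
  apply: dnearS2 (mero_neq a z0 mf nf) ih => z ha hr b.
  by rewrite inE => /predU1P[->//|/hr].
apply: dnearS2 (mero_some z0 mf) h => z; case: (f z) => // w _ hw.
exists w => //; rewrite sE hornerZ mulf_neq0 ?lead_coef_eq0//.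
rewrite horner_prod prodf_seq_neq0; apply/allP => a ar /=.
by rewrite !hornerE subr_eq0; apply/eqP => wa; apply: (hw a) => //; rewrite wa.
Qed.

End Meromorphic.

(** * The Ahlfors argument *)

Section MaximumPrinciple.
Context {R : realType}.
Local Notation C := (Cplx R).

Lemma rcontD (f g : C -> R) z : {for z, continuous f} -> {for z, continuous g} ->
  {for z, continuous (fun x => f x + g x)}.
Proof. exact: continuousD. Qed.
Lemma rcontB (f g : C -> R) z : {for z, continuous f} -> {for z, continuous g} ->
  {for z, continuous (fun x => f x - g x)}.
Proof. exact: continuousB. Qed.
Lemma rcontM (f g : C -> R) z : {for z, continuous f} -> {for z, continuous g} ->
  {for z, continuous (fun x => f x * g x)}.
Proof. exact: continuousM. Qed.
Lemma rcontV (f : C -> R) z : f z != 0 -> {for z, continuous f} ->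
  {for z, continuous (fun x => (f x)^-1)}.
Proof. by move=> h0 h; apply: continuousV. Qed.
Lemma rcont_cst (T : topologicalType) (c : R) (z : T) :
  {for z, continuous (fun _ : T => c)}.
Proof. exact: cvg_cst. Qed.
Lemma rcont_nm2 (f : C -> C) z : {for z, continuous f} ->
  {for z, continuous (fun x => nm (f x) ^+ 2)}.
Proof.
have -> : (fun x => nm (f x) ^+ 2) = (fun x => nm (f x) * nm (f x)).
  by apply/funext => x; rewrite expr2.
move=> h.
by apply: rcontM; exact: continuous_nm.
Qed.
Lemma rcont_1nm2 (f : C -> C) z : {for z, continuous f} ->
  {for z, continuous (fun x => 1 + nm (f x) ^+ 2)}.
Proof. by move=> h; apply: rcontD; [exact: rcont_cst|exact: rcont_nm2]. Qed.

Lemma rcont_gt0 (f : C -> R) z : {for z, continuous f} -> 0 < f z ->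
  \forall w \near z, 0 < f w.
Proof.
move=> /cvgrPdist_lt h f0; have := h _ f0; apply: nearS => w.
by rewrite ltr_norml => /andP[_]; rewrite ltrBlDr ltrDl.
Qed.

Lemma rcont_le (f g : C -> R) z : {for z, continuous f} -> {for z, continuous g} ->
  (\forall w \near z^', f w <= g w) -> f z <= g z.
Proof.
move=> cf cg h; rewrite leNgt; apply/negP => gf.
have := rcontB cf cg => /rcont_gt0; rewrite subr_gt0 => /(_ gf)/near_dnear h'.
have [w []] := dnear_ex (dnearS2 (fun x a b => conj a b) h h').
by rewrite subr_gt0 => /le_lt_trans hh /hh; rewrite ltxx.
Qed.

Lemma rcont_eq (f g : C -> R) z : {for z, continuous f} -> {for z, continuous g} ->
  (\forall w \near z^', f w = g w) -> f z = g z.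
Proof.
move=> cf cg h; apply: le_anti; apply/andP; split; apply: rcont_le => //;
 by apply: dnearS h => w ->.
Qed.

Lemma cont_der_nm2 (f : C -> C) z : derivable f z 1 ->
  {for z, continuous (fun x => nm (f x) ^+ 2)}.
Proof. by move=> h; apply: rcont_nm2; exact: derivable_cont. Qed.

(** Unchanged when F is replaced by 1 / F ([sph_inv]), hence computable in either chart of the
    sphere. *)
Definition sph (F : C -> C) (z : C) : R := nm ('D_1 F z) / (1 + nm (F z) ^+ 2).

Lemma nm2_gt0 (z : C) : 0 < 1 + nm z ^+ 2.
Proof. by rewrite ltr_pwDl// sqr_ge0. Qed.

Lemma rcont_sph2 F z : holo F z -> {for z, continuous (fun x => sph F x ^+ 2)}.
Proof.
have -> : (fun x => sph F x ^+ 2) = (fun x => sph F x * sph F x).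
  by apply/funext => x; rewrite expr2.
move=> hF.
have h : {for z, continuous (sph F)}.
  apply: rcontM.
    by apply: continuous_nm; apply: derivable_cont; exact: (holo_der (holo_derive hF)).
  apply: rcontV; first by rewrite gt_eqF// nm2_gt0.
  by apply: rcont_1nm2; apply: derivable_cont; exact: holo_der hF.
exact: rcontM.
Qed.

Lemma cc_nm (z : C) : cc z * z = pt (nm z ^+ 2) 0.
Proof.
by apply: eqC; rewrite ?reM ?imM ?re_pt ?im_pt ?sqr_nm; case: z => a b; rewrite /re /im/=; ring.
Qed.

(** Recentring the sphere at [b]: up to a constant, 1 + |a|^2 is the squared modulus of a function
    holomorphic in [a] times 1 + t^2, where t = |a - b| / |1 + cc b a| vanishes at [b]. *)
Lemma sphere_identity (a b : C) :
  (1 + nm a ^+ 2) * (1 + nm b ^+ 2) = nm (1 + cc b * a) ^+ 2 + nm (a - b) ^+ 2.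
Proof.
rewrite !sqr_nm !reD !imD !reM !imM !reN !imN.
by case: a => a a'; case: b => b b'; rewrite /re /im /=; ring.
Qed.

(** The Schwarz-Pick identity, recentring at [c] the disk of radius [r] about [a]; the holomorphic
    factor is normalized to be 1 at [c]. *)
Lemma disk_identity (r : R) (a c z : C) (D := r ^+ 2 - nm (c - a) ^+ 2) : D != 0 ->
  r ^+ 2 - nm (z - a) ^+ 2 =
  D * (nm (1 - cc (c - a) * pt D^-1 0 * (z - c)) ^+ 2 - r ^+ 2 / D ^+ 2 * nm (z - c) ^+ 2).
Proof.
move=> D0.
have -> : z - a = (z - c) + (c - a) by rewrite addrA subrK.
have DE : r ^+ 2 = D + nm (c - a) ^+ 2 by rewrite /D subrK.
move: (z - c) => w; rewrite {}DE; move: D D0 => D D0; move: (c - a) => d.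
rewrite !sqr_nm !(reD,imD,reN,imN,reM,imM,re_pt,im_pt).
by case: w => w w'; case: d => d d'; rewrite /re /im /=; field.
Qed.

(** In terms of Laplacians of logarithms, 1 + |F|^2 contributes four times the square of [sph F],
    likewise for G, and (r^2 - |z - a|^2)^2 contributes -8 r^2 / D^2; the sum is at most 0 at a
    maximum. Here the recentring identities write the maximized function, up to a constant, as
    |phi|^2 with phi holomorphic, times a factor that is 1 at c and exceeds 1 around c if the claim
    fails. A nearby point where |phi| is at least |phi(c)| gives the contradiction. *)
Lemma local_max (F G H : C -> C) (c a : C) (r : R) (D := r ^+ 2 - nm (c - a) ^+ 2) :
  holo F c -> holo G c -> holo H c -> H c != 0 -> 0 < D ->
  (\forall z \near c,
    nm (H z) ^+ 2 * (1 + nm (F z) ^+ 2) * (1 + nm (G z) ^+ 2) *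
      (r ^+ 2 - nm (z - a) ^+ 2) ^+ 2 <=
    nm (H c) ^+ 2 * (1 + nm (F c) ^+ 2) * (1 + nm (G c) ^+ 2) * D ^+ 2) ->
  sph F c ^+ 2 + sph G c ^+ 2 <= 2 * (r ^+ 2 / D ^+ 2).
Proof.
move=> hF hG hH Hc D0 hmax; rewrite leNgt; apply/negP => hS.
pose mF z := 1 + cc (F c) * F z; pose mG z := 1 + cc (G c) * G z.
pose bb := cc (c - a) * pt D^-1 0.
pose q z := 1 - bb * (z - c).
have hmF : holo mF c by apply: holoD; [exact: holo_cst|apply: holoM; [exact: holo_cst|exact: hF]].
have hmG : holo mG c by apply: holoD; [exact: holo_cst|apply: holoM; [exact: holo_cst|exact: hG]].
have hq : holo q c.
  apply: holoB; first exact: holo_cst.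
  by apply: holoM; [exact: holo_cst|apply: holoB; [exact: holo_id|exact: holo_cst]].
have mc (K : C -> C) : 1 + cc (K c) * K c = pt (1 + nm (K c) ^+ 2) 0.
  by rewrite cc_nm; apply: eqC; rewrite ?reD ?imD /= ?addr0.
have mc0 (K : C -> C) : 1 + cc (K c) * K c != 0.
  rewrite mc; apply/eqP => /(congr1 re); rewrite re_pt /= => /eqP.
  by rewrite gt_eqF// nm2_gt0.
have nmc (K : C -> C) : nm (1 + cc (K c) * K c) = 1 + nm (K c) ^+ 2.
  by rewrite mc nmE re_pt im_pt expr0n addr0 sqrtr_sqr ger0_norm// ltW// nm2_gt0.
pose phi z := H z * mF z * mG z * q z ^+ 2.
have hphi : holo phi c.
  apply: holoM; last exact: holoX.
  by apply: holoM; [apply: holoM; [exact: hH|exact: hmF]|exact: hmG].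
pose pF z := quot F c z / mF z; pose pG z := quot G c z / mG z.
have cp (K m : C -> C) : holo K c -> holo m c -> m c != 0 ->
    {for c, continuous (fun z => nm (quot K c z / m z) ^+ 2)}.
  move=> hK hm m0; apply: rcont_nm2; apply: contM; first exact: quot_cont (holo_der hK).
  by apply: contV; [exact: m0|exact: derivable_cont (holo_der hm)].
have cpF := cp F mF hF hmF (mc0 F); have cpG := cp G mG hG hmG (mc0 G).
pose k := r ^+ 2 / D ^+ 2.
have k0 : 0 <= k by rewrite divr_ge0// sqr_ge0.
(* With E = |z - c|^2, Q = |q|^2, A = |pF|^2, B = |pG|^2, the factor is (1 + E A) (1 + E B) (1 - k E
   / Q)^2. It is at least (1 + E (A + B)) (1 - 2 k E / Q), which exceeds 1 when X, Y and E are
   positive. Positivity of [Y] at [c] is the negated claim. *)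
pose X z := nm (q z) ^+ 2 - 2 * k * nm (z - c) ^+ 2.
have cX : {for c, continuous X}.
  apply: rcontB; first exact: cont_der_nm2 (holo_der hq).
  apply: rcontM; first exact: rcont_cst.
  by apply: cont_der_nm2; exact: derBc.
have qc : q c = 1 by rewrite /q subrr mulr0 subr0.
have Xc : X c = 1 by rewrite /X qc subrr nm0 nm1 expr0n mulr0 subr0 expr1n.
pose Y z := (nm (pF z) ^+ 2 + nm (pG z) ^+ 2) * X z - 2 * k.
have cY : {for c, continuous Y}.
  apply: rcontB; last exact: rcont_cst.
  by apply: rcontM; [apply: rcontD; [exact: cpF|exact: cpG]|exact: cX].
have sphE (K m : C -> C) : nm (m c) = 1 + nm (K c) ^+ 2 ->
    nm (quot K c c / m c) = sph K c.
  by move=> e; rewrite /quot eqxx nmM nmV e.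
have Yc : 0 < Y c by rewrite /Y Xc mulr1 /pF /pG !sphE ?nmc// subr_gt0.
have Xc0 : 0 < X c by rewrite Xc.
have nX := rcont_gt0 cX Xc0; have nY := rcont_gt0 cY Yc.
have cmF := derivable_cont (holo_der hmF).
have cmG := derivable_cont (holo_der hmG).
have mF0 : mF c != 0 := mc0 F.
have mG0 : mG c != 0 := mc0 G.
have nmF := @cont_near_neq0 R mF c mF0 cmF.
have nmG := @cont_near_neq0 R mG c mG0 cmG.
have /nearC[e e0 he] := nearS2 (fun x a b => conj a b) (nearS2 (fun x a b => conj a b) nX nY)
  (nearS2 (fun x a b => conj a b) (nearS2 (fun x a b => conj a b) nmF nmG) hmax).
have [z [zc ze hphiz]] := max_modulus hphi e0.
have [[Xz Yz] [[mFz mGz] hz]] := he z ze.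
have E0 : 0 < nm (z - c) ^+ 2 by rewrite exprn_gt0// nm_gt0 subr_eq0.
have key (K m : C -> C) : m z != 0 -> m z = 1 + cc (K c) * K z ->
    (1 + nm (K z) ^+ 2) * (1 + nm (K c) ^+ 2) =
    nm (m z) ^+ 2 * (1 + nm (z - c) ^+ 2 * nm (quot K c z / m z) ^+ 2).
  move=> mz mE; rewrite sphere_identity -mE mulrDr mulr1; congr (_ + _).
  rewrite -!exprMn -!nmM; congr (nm _ ^+ 2).
  rewrite /quot (negPf zc); field; rewrite mz /= subr_eq0; exact: zc.
have kF := key F mF mFz erefl; have kG := key G mG mGz erefl.
have Dn0 : r ^+ 2 - nm (c - a) ^+ 2 != 0 by rewrite gt_eqF.
have kD := disk_identity z Dn0.
rewrite -/D -/bb -/(q z) -/k in kD.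
have hphi2 : nm (phi c) ^+ 2 <= nm (phi z) ^+ 2 by apply: le_expr => //; exact: nm_ge0.
have phic : nm (phi c) ^+ 2 = nm (H c) ^+ 2 * (1 + nm (F c) ^+ 2) ^+ 2 * (1 + nm (G c) ^+ 2) ^+ 2.
  by rewrite /phi qc expr1n mulr1 !nmM !nmc !exprMn.
have phiz : nm (phi z) ^+ 2 = nm (H z) ^+ 2 * nm (mF z) ^+ 2 * nm (mG z) ^+ 2 * (nm (q z) ^+ 2) ^+ 2.
  by rewrite /phi nmM nmX nmM nmM !exprMn.
rewrite phic phiz in hphi2; rewrite kD in hz.
have hc0 : 0 < nm (H c) ^+ 2 by rewrite exprn_gt0// nm_gt0.
have f0 := nm2_gt0 (F c); have g0 := nm2_gt0 (G c).
have mFp : 0 < nm (mF z) ^+ 2 by rewrite exprn_gt0// nm_gt0.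
have mGp : 0 < nm (mG z) ^+ 2 by rewrite exprn_gt0// nm_gt0.
move: Xz Yz; rewrite /Y /X -/(pF z) -/(pG z) in kF kG *.
have A0 : 0 <= nm (pF z) ^+ 2 by rewrite sqr_ge0.
have B0 : 0 <= nm (pG z) ^+ 2 by rewrite sqr_ge0.
have h0 : 0 <= nm (H z) ^+ 2 by rewrite sqr_ge0.
have Q0 : 0 <= nm (q z) ^+ 2 by rewrite sqr_ge0.
move: hz hphi2 kF kG hc0 f0 g0 mFp mGp A0 B0 h0 Q0 E0 k0 D0.
move: (nm (H z) ^+ 2) (nm (H c) ^+ 2) (nm (mF z) ^+ 2) (nm (mG z) ^+ 2)
  (nm (pF z) ^+ 2) (nm (pG z) ^+ 2) (nm (q z) ^+ 2) (nm (z - c) ^+ 2)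
  (1 + nm (F z) ^+ 2) (1 + nm (G z) ^+ 2) (1 + nm (F c) ^+ 2) (1 + nm (G c) ^+ 2).
clearbody k D; clear; move: k D => k D h hc m1 m2 A B Q E fz gz fc gc hz hphi kF kG hc0 f0 g0 m10 m20 A0 B0 h0 Q0 E0 k0 D0 X0 Y0.
have Qp : 0 < Q by nra.
have s1 : h * m1 * m2 * ((1 + E * A) * (1 + E * B)) * (Q - k * E) ^+ 2 <= hc * fc ^+ 2 * gc ^+ 2.
  have e1 : h * m1 * m2 * ((1 + E * A) * (1 + E * B)) = h * (fz * fc) * (gz * gc).
    by rewrite kF kG; ring.
  rewrite e1; have D2 : 0 < D ^+ 2 by rewrite exprn_gt0.
  rewrite -(ler_pM2r D2).
  have := ler_wpM2r (ltW (mulr_gt0 f0 g0)) hz.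
  have -> : h * fz * gz * (D * (Q - k * E)) ^+ 2 * (fc * gc) =
    h * (fz * fc) * (gz * gc) * (Q - k * E) ^+ 2 * D ^+ 2 by ring.
  by have -> : hc * fc * gc * D ^+ 2 * (fc * gc) = hc * fc ^+ 2 * gc ^+ 2 * D ^+ 2 by ring.
have s2 := le_trans s1 hphi.
have hp : 0 < h.
  rewrite lt_neqAle h0 andbT; apply/eqP => h00; move: hphi; rewrite -h00 !mul0r leNgt.
  by rewrite !mulr_gt0// exprn_gt0.
have hmm : 0 < h * m1 * m2 by rewrite !mulr_gt0.
have s3 : ((1 + E * A) * (1 + E * B)) * (Q - k * E) ^+ 2 <= Q ^+ 2.
  by rewrite -(ler_pM2l hmm) mulrA.
have s4 : (1 + E * (A + B)) * (Q * (Q - 2 * k * E)) <= Q ^+ 2.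
  apply: le_trans s3; apply: ler_pM.
  - by rewrite addr_ge0// mulr_ge0 ?addr_ge0// ltW.
  - by rewrite mulr_ge0// ltW.
  - have : 0 <= E * A * (E * B) by rewrite !mulr_ge0// ltW.
    nra.
  - have : 0 <= (k * E) ^+ 2 by rewrite sqr_ge0.
    nra.
have s5 : Q * E * ((A + B) * (Q - 2 * k * E) - 2 * k) <= 0.
  rewrite -subr_ge0 in s4; rewrite -oppr_ge0.
  by have <- : Q ^+ 2 - (1 + E * (A + B)) * (Q * (Q - 2 * k * E)) =
   - (Q * E * ((A + B) * (Q - 2 * k * E) - 2 * k)) by ring.
by move: s5; rewrite leNgt !mulr_gt0.
Qed.

End MaximumPrinciple.

(** * Growing disks and the vanishing of the density *)

Section Ahlfors.
Context {R : realType}.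
Local Notation C := (Cplx R).

Lemma compact_rect (x1 x2 y1 y2 : R) : compact (inrect x1 x2 y1 y2 : set C).
Proof.
have -> : (inrect x1 x2 y1 y2 : set C) =
    (fun p : R * R => pt p.1 p.2) @` (`[x1, x2]%classic `*` `[y1, y2]%classic).
  apply/seteqP; split=> [z [zx zy]|_ [[x y] [/= xx yy] <-]].
    by exists (re z, im z); rewrite ?ptE//=; split; rewrite /= in_itv.
  by move: xx yy; rewrite !in_itv.
apply: continuous_compact; last first.
  by apply: compact_setX; exact: segment_compact.
apply: continuous_subspaceT => p.
apply: (cvgC (nbhs_filter p) _ _).2 => e e0.
have e2 : 0 < e / 2 by rewrite divr_gt0.
apply/nbhs_ballP; exists (e / 2) => //= x [h1 h2].
have {}h1 : `|x.1 - p.1| < e / 2 by rewrite distrC.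
have {}h2 : `|x.2 - p.2| < e / 2 by rewrite distrC.
have : nm (pt x.1 x.2 - pt p.1 p.2) < e.
  apply: le_lt_trans (nm_le _) _; rewrite reB imB !re_pt !im_pt.
  by rewrite [e]splitr ltrD.
by [].
Qed.

(** The sum of the squared moduli of H, H F, H G and H F G. *)
Definition pullback (F G H : C -> C) (z : C) : R :=
  nm (H z) ^+ 2 * (1 + nm (F z) ^+ 2) * (1 + nm (G z) ^+ 2).

Lemma pullback_cont F G H z : holo F z -> holo G z -> holo H z ->
  {for z, continuous (pullback F G H)}.
Proof.
move=> hF hG hH; apply: rcontM; first apply: rcontM.
- exact: cont_der_nm2 (holo_der hH).
- by apply: rcont_1nm2; exact: derivable_cont (holo_der hF).
- by apply: rcont_1nm2; exact: derivable_cont (holo_der hG).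
Qed.

Lemma rcont_near (T : topologicalType) (f g : T -> R) z : (\forall w \near z, f w = g w) ->
  {for z, continuous g} -> {for z, continuous f}.
Proof.
move=> e /cvgrPdist_lt h; apply/cvgrPdist_lt => d d0.
rewrite (nbhs_singleton e); have hd := h d d0.
by apply: filterS2 e hd => w ->.
Qed.

Lemma pullback_ge0 F G H z : 0 <= pullback F G H z.
Proof.
apply: mulr_ge0; last exact: ltW (nm2_gt0 _).
by apply: mulr_ge0; [exact: sqr_ge0|exact: ltW (nm2_gt0 _)].
Qed.

(* If [u] attains the maximum of [u (r^2 - |z - a|^2)^2] at [c], [local_max]
   bounds [u c], hence [u a = O(1 / r^2)]. *)
Lemma ahlfors (u0 : C -> R) (K : R) :
  (forall z0, exists F G H, [/\ holo F z0, holo G z0, holo H z0,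
    \forall z \near z0^', u0 z = pullback F G H z &
    \forall z \near z0^', u0 z <= K * (sph F z ^+ 2 + sph G z ^+ 2)]) ->
  forall z0, \forall z \near z0^', u0 z = 0.
Proof.
move=> loc.
have [T hT] := choice (fun z0 => let: ex_intro F (ex_intro G (ex_intro H h)) := loc z0 in
  ex_intro (fun t : (C -> C) * (C -> C) * (C -> C) => [/\ holo t.1.1 z0, holo t.1.2 z0, holo t.2 z0,
    \forall z \near z0^', u0 z = pullback t.1.1 t.1.2 t.2 z &
    \forall z \near z0^', u0 z <= K * (sph t.1.1 z ^+ 2 + sph t.1.2 z ^+ 2)]) ((F, G), H) h).
(* [u0] is controlled only off isolated points; [u] takes at each point the value of the local
   expression centred there, which makes it continuous. *)
pose u z := pullback (T z).1.1 (T z).1.2 (T z).2 z.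
have uE z0 : \forall z \near z0, u z = pullback (T z0).1.1 (T z0).1.2 (T z0).2 z.
  have [hF hG hH e _] := hT z0.
  have hFGH := nearS2 (fun x a b => conj a b) (nearS2 (fun x a b => conj a b) (holo_near hF) (holo_near hG)) (holo_near hH).
  apply: nearS2 hFGH (dnear_near e) => z [[hFz hGz] hHz] ez.
  have [hF' hG' hH' e' _] := hT z.
  apply: (rcont_eq (pullback_cont hF' hG' hH') (pullback_cont hFz hGz hHz)).
  by apply: dnearS2 e' ez => w -> ->.
have u0E z0 : \forall z \near z0^', u0 z = u z.
  have [_ _ _ e _] := hT z0.
  by apply: dnearS2 e (near_dnear (uE z0)) => z -> ->.
have uge z : 0 <= u z by exact: pullback_ge0.
have ucont z0 : {for z0, continuous u}.
  have [hF hG hH _ _] := hT z0.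
  exact: rcont_near (uE z0) (pullback_cont hF hG hH).
have uK z0 : u z0 <= K * (sph (T z0).1.1 z0 ^+ 2 + sph (T z0).1.2 z0 ^+ 2).
  have [hF hG hH e h] := hT z0.
  have c : {for z0, continuous (fun z => K * (sph (T z0).1.1 z ^+ 2 + sph (T z0).1.2 z ^+ 2))}.
    apply: rcontM; first exact: rcont_cst.
    by apply: rcontD; exact: rcont_sph2.
  apply: (rcont_le (ucont z0) c).
  by apply: dnearS2 h (u0E z0) => z + <-.
suff uz a : u a = 0 by move=> z0; apply: dnearS (u0E z0) => z ->.
apply/eqP; apply/negPn/negP => ua0.
have {}ua0 : 0 < u a by rewrite lt_neqAle eq_sym ua0 uge.
suff bound (r : R) : 0 < r -> u a * r ^+ 2 <= 2 * K.
  (* The radius r = 2 |K| / u a + 1 is at least 1, so u a r^2 >= u a r = 2 |K| + u a > 2 K. *)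
  have q0 : 0 <= 2 * `|K| / u a by apply: divr_ge0; [exact: mulr_ge0|exact: ltW].
  have r0 : 0 < 2 * `|K| / u a + 1.
    exact: ltr_wpDl.
  have := bound _ r0; rewrite leNgt => /negP; apply.
  apply: (@lt_le_trans _ _ (u a * (2 * `|K| / u a + 1))).
    rewrite mulrDr mulr1 mulrCA mulfV ?gt_eqF// mulr1.
    have := ler_norm K; clear -ua0; lra.
  by rewrite ler_pM2l// expr2 ler_peMr ?(ltW r0)// lerDr.
move=> r0.
(* Truncation at 0 keeps [v] continuous and makes it vanish off the disk, so its positive maximum
   over the compact square is attained in the open disk. *)
pose D z := Num.max 0 (r ^+ 2 - nm (z - a) ^+ 2).
pose v z := u z * (D z * D z).
have cD z : {for z, continuous D}.
  apply: continuous_max; first exact: rcont_cst.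
  apply: rcontB; first exact: rcont_cst.
  by apply: cont_der_nm2; exact: derBc.
have cv : {within (inrect (re a - r) (re a + r) (im a - r) (im a + r) : set C), continuous v}.
  apply: continuous_subspaceT => z; apply: rcontM; first exact: ucont.
  by apply: rcontM; exact: cD.
have [|c _ hc] := compact_EVT_max _ (@compact_rect _ _ _ _) cv.
  by exists a; split; rewrite !lerBlDr !lerDl ltW.
have insq z : nm (z - a) < r -> z \in (inrect (re a - r) (re a + r) (im a - r) (im a + r) : set C).
  move=> zr; rewrite inE; have := nm_re (z - a); have := nm_im (z - a).
  by rewrite reB imB !ler_norml; split; lra.
have DE z : nm (z - a) < r -> D z = r ^+ 2 - nm (z - a) ^+ 2.
  by move=> zr; rewrite /D max_r// subr_ge0 le_expr ?nm_ge0// ltW.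
have ar : nm (a - a) < r by rewrite subrr nm0.
have Da : D a = r ^+ 2 by rewrite DE// subrr nm0 expr0n subr0.
have va : v a <= v c by apply: hc; apply: insq.
have va0 : 0 < v a by rewrite /v Da; apply: mulr_gt0 => //; apply: mulr_gt0; exact: exprn_gt0.
have vc0 := lt_le_trans va0 va.
have Dge z : 0 <= D z by rewrite le_max lexx.
have Dc0 : 0 < D c.
  rewrite lt_neqAle Dge andbT; apply: contraTneq vc0 => d0.
  by rewrite /v -d0 !mulr0 ltxx.
have cr : nm (c - a) < r.
  rewrite ltNge; apply/negP => rc; move: Dc0; rewrite /D max_l ?ltxx//.
  by rewrite subr_le0 le_expr// ltW.
rewrite DE// in Dc0.
have uc0 : u c != 0 by apply: contraTneq vc0 => h; rewrite /v h mul0r ltxx.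
have [hF hG hH _ _] := hT c.
have Hc : (T c).2 c != 0.
  by apply: contraNneq uc0 => h; rewrite /u /pullback h nm0 expr0n !mul0r.
have nr : \forall z \near c, nm (z - a) < r.
  apply/nearC; exists (r - nm (c - a)); first by rewrite subr_gt0.
  by move=> z zc; have := nm_tri z a c; clear -zc; lra.
have hmax : \forall z \near c,
    nm ((T c).2 z) ^+ 2 * (1 + nm ((T c).1.1 z) ^+ 2) * (1 + nm ((T c).1.2 z) ^+ 2) *
      (r ^+ 2 - nm (z - a) ^+ 2) ^+ 2 <=
    nm ((T c).2 c) ^+ 2 * (1 + nm ((T c).1.1 c) ^+ 2) * (1 + nm ((T c).1.2 c) ^+ 2) *
      (r ^+ 2 - nm (c - a) ^+ 2) ^+ 2.
  apply: nearS2 nr (uE c) => z zr uz.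
  have := hc z (insq z zr); rewrite /v DE// DE// uz.
  by rewrite -!expr2.
have hS := local_max hF hG hH Hc Dc0 hmax.
have D20 : 0 < (r ^+ 2 - nm (c - a) ^+ 2) ^+ 2 by rewrite exprn_gt0.
have h1 : u c * (r ^+ 2 - nm (c - a) ^+ 2) ^+ 2 <= 2 * K * r ^+ 2.
  have K0 : 0 <= K.
    rewrite leNgt; apply/negP => K0; have := uK c.
    rewrite leNgt => /negP; apply; apply: le_lt_trans (_ : 0 < u c); last first.
      by rewrite lt_neqAle eq_sym uc0 uge.
    by rewrite nmulr_rle0// addr_ge0// sqr_ge0.
  apply: le_trans (_ : K * (2 * (r ^+ 2 / (r ^+ 2 - nm (c - a) ^+ 2) ^+ 2)) * (r ^+ 2 - nm (c - a) ^+ 2) ^+ 2 <= _).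
    rewrite ler_pM2r//; apply: le_trans (uK c) _.
    exact: ler_wpM2l.
  by rewrite le_eqVlt; apply/orP; left; apply/eqP; field; rewrite gt_eqF.
have r20 : 0 < r ^+ 2 by rewrite exprn_gt0.
rewrite -(ler_pM2r r20); apply: le_trans h1.
by move: va; rewrite /v Da DE// -expr2 mulrA.
Qed.

End Ahlfors.

(** * The pulled-back form *)

Section DeriveRules.
Context {R : realType}.
Local Notation C := (Cplx R).
Implicit Types (f g : C -> C) (z l m : C).

Lemma isd_cst (c z : C) : is_derive z 1 (fun _ : C => c) 0.
Proof. exact: is_derive_cst. Qed.
Lemma isdD f g z l m : is_derive z 1 f l -> is_derive z 1 g m ->
  is_derive z 1 (fun w => f w + g w) (l + m).
Proof. exact: is_deriveD. Qed.
Lemma isdM f g z l m : is_derive z 1 f l -> is_derive z 1 g m ->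
  is_derive z 1 (fun w => f w * g w) (f z * m + l * g z).
Proof.
by move=> hf hg; have := is_deriveM hf hg; rewrite [_ *: l]mulrC.
Qed.

Lemma isd_horner (P : {poly C}) f z l : is_derive z 1 f l ->
  is_derive z 1 (fun w => P.[f w]) (P^`().[f z] * l).
Proof.
move=> hf; elim/poly_ind: P => [|P c ih].
  have -> : (fun w => (0 : {poly C}).[f w]) = (fun=> 0).
    by apply/funext => w; rewrite horner0.
  by rewrite deriv0 horner0 mul0r; exact: isd_cst.
have -> : (fun w => (P * 'X + c%:P).[f w]) = (fun w => P.[f w] * f w + c).
  by apply/funext => w; rewrite !hornerE.
have -> : (P * 'X + c%:P)^`().[f z] * l = P.[f z] * l + P^`().[f z] * l * f z + 0.
  by rewrite derivD derivM derivX derivC !hornerE; ring.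
exact: isdD (isdM ih hf) (isd_cst c z).
Qed.

Lemma isd_inv f z l : f z != 0 -> is_derive z 1 f l ->
  is_derive z 1 (fun w => (f w)^-1) (- l / f z ^+ 2).
Proof.
move=> fz [df <-]; split; first exact: derV.
rewrite deriveV//; rewrite /GRing.scale /=; field; exact: fz.
Qed.

Lemma isd_unique f z l m : is_derive z 1 f l -> is_derive z 1 f m -> l = m.
Proof. by move=> [_ <-] [_ <-]. Qed.

Lemma near_isd f g z l : (\forall w \near z, f w = g w) ->
  is_derive z 1 f l -> is_derive z 1 g l.
Proof. exact: near_eq_is_derive. Qed.

Lemma holo_isd f z : holo f z -> is_derive z 1 f ('D_1 f z).
Proof. by move=> /holo_der /derivableP. Qed.

Lemma holo_horner (P : {poly C}) f z : holo f z -> holo (fun w => P.[f w]) z.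
Proof.
move=> hf; rewrite /holo; apply: nearS hf => w /derivableP h.
by case: (isd_horner P h).
Qed.

Lemma sph_inv f g z : f z != 0 -> holo f z -> (\forall w \near z, g w = (f w)^-1) ->
  sph g z = sph f z.
Proof.
move=> fz hf e; have gz := nbhs_singleton e.
have e' : \forall w \near z, (f w)^-1 = g w by apply: nearS e => w ->.
have [_ dg] := near_isd e' (isd_inv fz (holo_isd hf)).
rewrite /sph dg gz nmM nmN !nmV nmX.
have nf : nm (f z) != 0 by rewrite nm_eq0.
have f2 := nm2_gt0 (f z); field.
by rewrite nf gt_eqF//= gt_eqF//= ltr_wpDl// ?sqr_ge0.
Qed.

End DeriveRules.

Section PulledBackMetric.
Context {R : realType}.
Local Notation C := (Cplx R).

Definition wronsk (p q : {poly C}) : {poly C} := p^`() * q - p * q^`().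

Definition msq (x : C) : R := 1 + nm x ^+ 2.

Lemma tangent_algebra (F : comPzRingType) (c px py qx qy px' py' qx' qy' x' y' : F) :
  px * qy = c * py * qx ->
  px * (qy' * y') + px' * x' * qy =
    c * py * (qx' * x') + (c * (py' * y') + 0 * py) * qx ->
  qy ^+ 2 * (px' * qx - px * qx') * x' = c * qx ^+ 2 * (py' * qy - py * qy') * y'.
Proof.
move=> ez h.
have h3 : (px' * qy - c * py * qx') * x' = (c * py' * qx - px * qy') * y'.
  apply/eqP; rewrite -subr_eq0; apply/eqP.
  transitivity ((px * (qy' * y') + px' * x' * qy) -
     (c * py * (qx' * x') + (c * (py' * y') + 0 * py) * qx)); first by ring.
  by rewrite h subrr.
have k1 : qx * (px' * qy - c * py * qx') = qy * (px' * qx - px * qx').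
  transitivity (qx * px' * qy - qx' * (c * py * qx)); first by ring.
  by rewrite -ez; ring.
have k2 : qy * (c * py' * qx - px * qy') = c * qx * (py' * qy - py * qy').
  transitivity (qy * c * py' * qx - qy' * (px * qy)); first by ring.
  by rewrite ez; ring.
transitivity (qx * qy * ((px' * qy - c * py * qx') * x')).
  transitivity (qy * (qy * (px' * qx - px * qx')) * x'); first by ring.
  by rewrite -k1; ring.
rewrite h3; transitivity (qx * (qy * (c * py' * qx - px * qy')) * y'); first by ring.
by rewrite k2; ring.
Qed.

(** The equation (p / q)'(f) f' = c (p / q)'(g) g' freed of denominators: the relation is
    differentiated, then used once more to eliminate. *)
Lemma curve_tangent (p q : {poly C}) (c : C) (f g : C -> C) z :
  holo f z -> holo g z ->
  (\forall w \near z, p.[f w] * q.[g w] = c * p.[g w] * q.[f w]) ->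
  q.[g z] ^+ 2 * (wronsk p q).[f z] * 'D_1 f z =
  c * q.[f z] ^+ 2 * (wronsk p q).[g z] * 'D_1 g z.
Proof.
move=> hf0 hg0 e; have ez := nbhs_singleton e.
have hf := holo_isd hf0; have hg := holo_isd hg0.
have h1 := isdM (isd_horner p hf) (isd_horner q hg).
have h2 := isdM (isdM (isd_cst c z) (isd_horner p hg)) (isd_horner q hf).
have h3 := isd_unique (near_isd e h1) h2.
have W x : (wronsk p q).[x] = p^`().[x] * q.[x] - p.[x] * q^`().[x].
  by rewrite hornerD hornerN !hornerM.
by rewrite !W; exact: tangent_algebra ez h3.
Qed.

(** The hypothesis 4 <= n enters twice, as x^4 <= x^n and as y^n <= y^(2 n - 4). *)
Lemma power_absorb (n : nat) (T rho x y : R) : (4 <= n)%N -> 0 <= T -> 0 < rho ->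
  1 <= x -> 1 <= y -> rho * x ^+ n <= T * y ^+ n ->
  x ^+ 4 * rho <= T * y ^+ (2 * n - 4).
Proof.
move=> n4 T0 r0 x1 y1 h; apply: (@le_trans _ _ (T * y ^+ n)).
  apply: le_trans h; rewrite mulrC ler_pM2l//; exact: ler_weXn2l.
by apply: ler_wpM2l => //; apply: ler_weXn2l => //; lia.
Qed.

(* The pulled-back form is bounded by the spherical derivatives: the weights
   [a], [b] of [q] are comparable along the curve, and [4 <= n] absorbs the
   remaining powers of [Mx] and [My]. *)
Lemma metric_bound (n : nat) (px qx wx py qy wy x' y' A k K K' cc Mx My : R) :
  (4 <= n)%N -> 0 < k -> 0 <= K -> 0 < cc ->
  0 <= px -> 0 < qx -> 0 < wx -> 0 <= py -> 0 < qy -> 0 < wy -> 0 <= x' -> 0 <= y' -> 0 <= A ->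
  1 <= Mx -> 1 <= My -> 0 <= K' ->
  px * qy = cc * py * qx ->
  qy ^+ 2 * wx * x' = cc * qx ^+ 2 * wy * y' ->
  k * Mx ^+ n <= px + qx -> px + qx <= K * Mx ^+ n ->
  k * My ^+ n <= py + qy -> py + qy <= K * My ^+ n ->
  A <= K' * (Mx * My) * (wx / Mx ^+ (2 * n - 2) + wy / My ^+ (2 * n - 2)) ->
  A * (qy * x' / (qx * wy)) * Mx * My <=
    K' * ((1 + cc) * (1 + cc^-1) * K / k) * (1 + cc) * (x' / Mx ^+ 2 + y' / My ^+ 2).
Proof.
move=> n4 k0 K0 c0 px0 qx0 wx0 py0 qy0 wy0 x0 y0 A0 Mx1 My1 K'0 e1 e2 bx1 bx2 by1 by2 hA.
have Mx0 : 0 < Mx := lt_le_trans ltr01 Mx1.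
have My0 : 0 < My := lt_le_trans ltr01 My1.
have Mxn j : 0 < Mx ^+ j by rewrite exprn_gt0.
have Myn j : 0 < My ^+ j by rewrite exprn_gt0.
pose T := (1 + cc) * (1 + cc^-1) * K / k.
have ci0 : 0 < cc^-1 by rewrite invr_gt0.
have T0 : 0 <= T.
  by rewrite /T divr_ge0// ?(ltW k0)// !mulr_ge0// ?addr_ge0// ltW.
have cci : cc * cc^-1 = 1 by rewrite mulfV// gt_eqF.
(* All variables stand for squared moduli. Along the curve the ratios p : q at x and at y differ
   only by c, so |q(y) / q(x)|^2 is comparable to (My / Mx)^n; [r1] and [r2] are the two halves of
   this. *)
have r1 : qy * Mx ^+ n <= T * My ^+ n * qx.
  have h : (px + qx) * qy <= (1 + cc) * qx * (py + qy).
    rewrite mulrDl e1 -subr_ge0.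
    have -> : (1 + cc) * qx * (py + qy) - (cc * py * qx + qx * qy) = qx * py + cc * (qx * qy) by ring.
    by rewrite addr_ge0// !mulr_ge0// ltW.
  have h1 : k * (qy * Mx ^+ n) <= (1 + cc) * K * My ^+ n * qx.
    apply: (@le_trans _ _ ((px + qx) * qy)).
      by rewrite mulrCA mulrC ler_pM2r.
    apply: (le_trans h).
    have -> : (1 + cc) * K * My ^+ n * qx = ((1 + cc) * qx) * (K * My ^+ n) by ring.
    by rewrite ler_pM2l// mulr_gt0// addr_gt0.
  rewrite -(ler_pM2l k0); apply: (le_trans h1).
  have -> : k * (T * My ^+ n * qx) = ((1 + cc) * K * My ^+ n * qx) * (1 + cc^-1).
    by rewrite /T; field; rewrite !gt_eqF.
  by rewrite ler_peMr// ?lerDl ?(ltW ci0)// !mulr_ge0// ?addr_ge0// ltW.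
have r2 : qx * My ^+ n <= T * Mx ^+ n * qy.
  have h : (py + qy) * qx <= (1 + cc^-1) * qy * (px + qx).
    have e3 : py * qx = cc^-1 * (px * qy) by rewrite e1 mulrA mulrA (mulrC _ cc) cci mul1r.
    rewrite mulrDl e3 -subr_ge0.
    have -> : (1 + cc^-1) * qy * (px + qx) - (cc^-1 * (px * qy) + qy * qx) = qy * px + cc^-1 * (qy * qx) by ring.
    by rewrite addr_ge0// !mulr_ge0// ltW.
  have h1 : k * (qx * My ^+ n) <= (1 + cc^-1) * K * Mx ^+ n * qy.
    apply: (@le_trans _ _ ((py + qy) * qx)).
      by rewrite mulrCA mulrC ler_pM2r.
    apply: (le_trans h).
    have -> : (1 + cc^-1) * K * Mx ^+ n * qy = ((1 + cc^-1) * qy) * (K * Mx ^+ n) by ring.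
    by rewrite ler_pM2l// mulr_gt0// addr_gt0.
  rewrite -(ler_pM2l k0); apply: (le_trans h1).
  have -> : k * (T * Mx ^+ n * qy) = ((1 + cc^-1) * K * Mx ^+ n * qy) * (1 + cc).
    by rewrite /T; field; rewrite !gt_eqF.
  by rewrite ler_peMr// ?lerDl ?(ltW c0)// !mulr_ge0// ?addr_ge0// ltW.
pose rho := qy / qx.
have rho0 : 0 < rho by rewrite divr_gt0.
have s1 : Mx ^+ 4 * rho <= T * My ^+ (2 * n - 4).
  apply: power_absorb => //; rewrite /rho mulrAC ler_pdivrMr//.
have rhoi0 : 0 < rho^-1 by rewrite invr_gt0.
have s2 : My ^+ 4 * rho^-1 <= T * Mx ^+ (2 * n - 4).
  apply: power_absorb => //; rewrite /rho invf_div mulrAC ler_pdivrMr//.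
have n2 : (2 * n - 2 = (2 * n - 4) + 2)%N by clear -n4; lia.
have t2 : rho * x' * (Mx * My) ^+ 2 / My ^+ (2 * n - 2) <= T * (x' / Mx ^+ 2).
  have -> : rho * x' * (Mx * My) ^+ 2 / My ^+ (2 * n - 2) =
     (Mx ^+ 4 * rho) * (x' / (Mx ^+ 2 * My ^+ (2 * n - 4))).
    by rewrite n2 exprD; field; rewrite !gt_eqF.
  apply: (@le_trans _ _ (T * My ^+ (2 * n - 4) * (x' / (Mx ^+ 2 * My ^+ (2 * n - 4))))).
    by apply: ler_wpM2r => //; rewrite divr_ge0// mulr_ge0// ltW.
  by rewrite le_eqVlt; apply/orP; left; apply/eqP; field; rewrite !gt_eqF.
(* The summand with [wx] still has [wy] in its denominator; the tangent relation exchanges x' / wy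
   for y' / wx, and both weights disappear. *)
have e4 : rho * x' * wx / wy = cc * y' * rho^-1.
  have -> : rho * x' * wx / wy = (qy ^+ 2 * wx * x') / (qx * qy * wy).
    by rewrite /rho; field; rewrite !gt_eqF.
  by rewrite e2 /rho; field; rewrite !gt_eqF.
have t1 : rho * x' * wx / wy * (Mx * My) ^+ 2 / Mx ^+ (2 * n - 2) <= T * (cc * (y' / My ^+ 2)).
  rewrite e4.
  have -> : cc * y' * rho^-1 * (Mx * My) ^+ 2 / Mx ^+ (2 * n - 2) =
     (My ^+ 4 * rho^-1) * (cc * y' / (My ^+ 2 * Mx ^+ (2 * n - 4))).
    by rewrite n2 exprD; field; rewrite !gt_eqF.
  apply: (@le_trans _ _ (T * Mx ^+ (2 * n - 4) * (cc * y' / (My ^+ 2 * Mx ^+ (2 * n - 4))))).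
    by apply: ler_wpM2r => //; rewrite divr_ge0 ?mulr_ge0// ltW.
  by rewrite le_eqVlt; apply/orP; left; apply/eqP; field; rewrite !gt_eqF.
apply: (@le_trans _ _ (K' * (Mx * My) * (wx / Mx ^+ (2 * n - 2) + wy / My ^+ (2 * n - 2)) * (rho * x' / wy * Mx * My))).
  have -> : A * (qy * x' / (qx * wy)) * Mx * My = A * (rho * x' / wy * Mx * My).
    by rewrite /rho; field; rewrite !gt_eqF.
  by apply: ler_wpM2r => //; rewrite !mulr_ge0 ?invr_ge0// ltW.
have -> : K' * (Mx * My) * (wx / Mx ^+ (2 * n - 2) + wy / My ^+ (2 * n - 2)) * (rho * x' / wy * Mx * My) =
  K' * (rho * x' * wx / wy * (Mx * My) ^+ 2 / Mx ^+ (2 * n - 2) +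
        rho * x' * (Mx * My) ^+ 2 / My ^+ (2 * n - 2)).
  by field; rewrite !gt_eqF.
apply: (le_trans (ler_wpM2l K'0 (lerD t1 t2))).
rewrite -/T -!(mulrA K') -(mulrA T) -mulrDr.
apply: ler_wpM2l => //; apply: ler_wpM2l => //.
have u1 : 0 <= x' / Mx ^+ 2 by rewrite divr_ge0// ltW.
have u2 : 0 <= y' / My ^+ 2 by rewrite divr_ge0// ltW.
by clear -u1 u2 c0; nra.
Qed.

End PulledBackMetric.

(** * Vanishing of the pulled-back form *)

Section Rigidity.
Context {R : realType}.
Local Notation C := (Cplx R).

Lemma dnear_near_open (z : C) (P : C -> Prop) : (\forall x \near z^', P x) ->
  \forall w \near z^', \forall x \near w, P x.
Proof.
move=> h; have h' := near_dnear (dnear_near h).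
by apply: dnearS2 h h' => w Pw /dnearC[e e0 he]; apply/nearC; exists e => // x xe;
  have [->//|xw] := eqVneq x w; exact: he.
Qed.

Lemma mero_holo (f : C -> option C) z0 : meromorphic f ->
  \forall z \near z0^', holo (finite_part f) z.
Proof.
move=> mf; have h : \forall z \near z0^', derivable (finite_part f) z 1.
  case: (mf z0) => [hf|[_ hf _]].
    by apply: near_dnear; apply: nearS hf => z [].
  by apply: dnearS hf => z [].
exact: dnear_near_open h.
Qed.

Lemma sph_eq (F G : C -> C) z : (\forall w \near z, F w = G w) -> sph F z = sph G z.
Proof. by move=> e; rewrite /sph (near_eq_derive _ e) (nbhs_singleton e). Qed.

Lemma nm_sqr_mul (a b d : C) :
  nm (a ^+ 2 * b * d) ^+ 2 = (nm a ^+ 2) ^+ 2 * nm b ^+ 2 * nm d ^+ 2.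
Proof. by rewrite nmM nmM nmX exprMn exprMn. Qed.

(** The affine coefficients cover all choices of A at once. The bound of A by W(x) and W(y) encodes
    that A vanishes at the singular points of the curve; the last premise is what lets a vanishing
    form imply f' = 0. *)
Lemma curve_rigid (p q : {poly C}) (n : nat) (c A0 A1 A2 : C) (k K K' : R)
    (f g : C -> option C) :
  (4 <= n)%N -> 0 < k -> 0 <= K -> 0 <= K' -> c != 0 -> q != 0 -> wronsk p q != 0 ->
  (forall x, k * msq x ^+ n <= nm p.[x] ^+ 2 + nm q.[x] ^+ 2) ->
  (forall x, nm p.[x] ^+ 2 + nm q.[x] ^+ 2 <= K * msq x ^+ n) ->
  (forall x y, p.[x] * q.[y] = c * p.[y] * q.[x] ->
    nm (A0 + A1 * x + A2 * y) ^+ 2 <= K' * (msq x * msq y) *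
      (nm (wronsk p q).[x] ^+ 2 / msq x ^+ (2 * n - 2) +
       nm (wronsk p q).[y] ^+ 2 / msq y ^+ (2 * n - 2))) ->
  meromorphic f -> meromorphic g -> nonconstant f -> nonconstant g ->
  (forall z0, \forall z \near z0^', forall x y, f z = Some x -> g z = Some y ->
    p.[x] * q.[y] = c * p.[y] * q.[x]) ->
  (forall z0, \forall z \near z0^', forall x y, f z = Some x -> g z = Some y ->
    A0 + A1 * x + A2 * y != 0) -> False.
Proof.
move=> n4 k0 K0 K'0 c0 q0 W0 lo up star mf mg nf ng rel An0.
pose W := wronsk p q; pose ff := finite_part f; pose gg := finite_part g.
pose A z := A0 + A1 * ff z + A2 * gg z.
pose good z := [/\ f z = Some (ff z), g z = Some (gg z),
  q.[ff z] != 0 /\ W.[ff z] != 0, q.[gg z] != 0 /\ W.[gg z] != 0 &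
  p.[ff z] * q.[gg z] = c * p.[gg z] * q.[ff z] /\ A z != 0].
have nice z0 : \forall z \near z0^', good z.
  have qW0 : q * W != 0 by rewrite mulf_neq0.
  have hf := mero_poly_neq0 z0 mf nf qW0; have hg := mero_poly_neq0 z0 mg ng qW0.
  have h1 := dnearS2 (fun x a b => conj a b) hf hg.
  have h2 := dnearS2 (fun x a b => conj a b) (rel z0) (An0 z0).
  apply: dnearS2 h1 h2 => z [[x fx +] [y gy +]] [rz az].
  rewrite !hornerM !mulf_eq0 !negb_or => /andP[qx wx] /andP[qy wy].
  have ffx : ff z = x by rewrite /ff /finite_part fx.
  have ggy : gg z = y by rewrite /gg /finite_part gy.
  by rewrite /good /A ffx ggy; split => //; split; [exact: rz|exact: az].
have hff z0 : \forall z \near z0^', holo ff z by exact: mero_holo.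
have hgg z0 : \forall z \near z0^', holo gg z by exact: mero_holo.
(* The coefficient of the pulled-back form; at the isolated points where [good] fails its value is
   meaningless. *)
pose h z := A z * q.[gg z] * 'D_1 ff z / (q.[ff z] * W.[gg z]).
pose u0 z := nm (h z) ^+ 2 * msq (ff z) * msq (gg z).
pose cc := nm c ^+ 2.
have cc0 : 0 < cc by apply: exprn_gt0; rewrite nm_gt0.
pose K3 := K' * ((1 + cc) * (1 + cc^-1) * K / k) * (1 + cc).
have msq1 (x : C) : 1 <= msq x by rewrite lerDl sqr_ge0.
have bound z : holo ff z -> holo gg z -> (\forall w \near z, good w) ->
    u0 z <= K3 * (sph ff z ^+ 2 + sph gg z ^+ 2).
  move=> hf hg hgood; have [_ _ [qx wx] [qy wy] [rz _]] := nbhs_singleton hgood.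
  have relz : \forall w \near z, p.[ff w] * q.[gg w] = c * p.[gg w] * q.[ff w].
    by apply: nearS hgood => w [_ _ _ _ []].
  have tan := curve_tangent hf hg relz.
  have e1 : nm p.[ff z] ^+ 2 * nm q.[gg z] ^+ 2 = cc * nm p.[gg z] ^+ 2 * nm q.[ff z] ^+ 2.
    by rewrite /cc -[LHS]exprMn -nmM rz nmM nmM exprMn exprMn.
  have e2 : (nm q.[gg z] ^+ 2) ^+ 2 * nm W.[ff z] ^+ 2 * nm ('D_1 ff z) ^+ 2 =
      cc * (nm q.[ff z] ^+ 2) ^+ 2 * nm W.[gg z] ^+ 2 * nm ('D_1 gg z) ^+ 2.
    rewrite -nm_sqr_mul tan -!(mulrA c) nmM exprMn nm_sqr_mul /cc.
    by rewrite !mulrA.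
  have pos (x : C) : x != 0 -> 0 < nm x ^+ 2 by move=> x0; apply: exprn_gt0; rewrite nm_gt0.
  have sq (x : C) : 0 <= nm x ^+ 2 by exact: sqr_ge0.
  have := @metric_bound R n _ _ _ _ _ _ _ _ _ k K K' cc _ _ n4 k0 K0 cc0
    (sq p.[ff z]) (pos _ qx) (pos _ wx) (sq p.[gg z]) (pos _ qy) (pos _ wy)
    (sq ('D_1 ff z)) (sq ('D_1 gg z)) (sq (A z)) (msq1 (ff z)) (msq1 (gg z)) K'0
    e1 e2 (lo _) (up _) (lo _) (up _) (star _ _ rz).
  rewrite -/K3 => hb; rewrite /u0 /sph !expr_div_n -!/(msq _).
  apply: le_trans hb; rewrite le_eqVlt; apply/orP; left; apply/eqP; congr (_ * _ * _).
  by rewrite /h !nmM nmV nmM exprMn !exprVn !exprMn invfM; ring.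
have key : forall z0, \forall z \near z0^', u0 z = 0.
  apply: (@ahlfors R u0 K3) => z0.
  have [F [i [hF fE iF _]]] := mero_chart z0 mf.
  have [G [j [hG gE jG _]]] := mero_chart z0 mg.
  (* Near a pole f = 1 / F and 1 + |f|^2 = (1 + |F|^2) / |F|^2; these denominators are moved into
     [H0]. *)
  pose cF z := if i then F z else 1; pose cG z := if j then G z else 1.
  pose H0 z := h z / (cF z * cG z).
  have hcF : holo cF z0 by rewrite /cF; case: (i); [exact: hF|exact: holo_cst].
  have hcG : holo cG z0 by rewrite /cG; case: (j); [exact: hG|exact: holo_cst].
  have cF0 : \forall z \near z0^', cF z != 0.
    rewrite /cF; case: (i) iF => [/(_ isT)[]//|_].
    by apply: dnearS (dnear_neq z0) => z _; exact: oner_neq0.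
  have cG0 : \forall z \near z0^', cG z != 0.
    rewrite /cG; case: (j) jG => [/(_ isT)[]//|_].
    by apply: dnearS (dnear_neq z0) => z _; exact: oner_neq0.
  have n1 := dnearS2 (fun x a b => conj a b) (dnear_near_open (nice z0))
    (dnearS2 (fun x a b => conj a b) (hff z0) (hgg z0)).
  have n2 := dnearS2 (fun x a b => conj a b) cF0 cG0.
  have n3 := dnearS2 (fun x a b => conj a b) (near_dnear (holo_near hF)) (near_dnear (holo_near hG)).
  have n4' := dnearS2 (fun x a b => conj a b) (near_dnear (holo_near hcF)) (near_dnear (holo_near hcG)).
  have ffE : \forall z \near z0^', ff z = if i then (F z)^-1 else F z.
    by apply: dnearS fE => z; rewrite /ff /finite_part => ->.
  have ggE : \forall z \near z0^', gg z = if j then (G z)^-1 else G z.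
    by apply: dnearS gE => z; rewrite /gg /finite_part => ->.
  have n5 := dnearS2 (fun x a b => conj a b) (dnear_near_open ffE) (dnear_near_open ggE).
  have msqE (b : bool) (x : C) : (b -> x != 0) ->
      msq (if b then x^-1 else x) = (1 + nm x ^+ 2) / nm (if b then x else 1) ^+ 2.
    case: b => [/(_ isT) x0|_]; last by rewrite nm1 expr1n divr1.
    rewrite /msq nmV; field; by rewrite nm_eq0.
  have e0 : \forall z \near z0^', u0 z = pullback F G H0 z.
    have m1 := dnearS2 (fun x a b => conj a b) ffE ggE.
    apply: dnearS2 m1 n2 => z [fz gz] [cFz cGz].
    rewrite /u0 /pullback fz gz !msqE; last 2 first.
    - by move: cGz; rewrite /cG; case: (j).
    - by move: cFz; rewrite /cF; case: (i).
    rewrite /H0 -/(cF z) -/(cG z) nmM nmV nmM.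
    by field; rewrite !nm_eq0 cFz cGz.
  have b0 : \forall z \near z0^', u0 z <= K3 * (sph F z ^+ 2 + sph G z ^+ 2).
    have m1 := dnearS2 (fun x a b => conj a b) n1 n2.
    have m2 := dnearS2 (fun x a b => conj a b) n3 n5.
    apply: dnearS2 m1 m2 => z [[gz [hfz hgz]] [cFz cGz]] [[hFz hGz] [fz ez]].
    have s1 : sph ff z = sph F z.
      move: fz cFz; rewrite /cF; case: (i) => fz cFz; first exact: sph_inv.
      exact: sph_eq.
    have s2 : sph gg z = sph G z.
      move: ez cGz; rewrite /cG; case: (j) => ez cGz; first exact: sph_inv.
      exact: sph_eq.
    by rewrite -s1 -s2; exact: bound.
  have dH0 : \forall z \near z0^', derivable H0 z 1.
    have m1 := dnearS2 (fun x a b => conj a b) n1 n2.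
    apply: dnearS2 m1 n4' => z [[gz [hfz hgz]] [cFz cGz]] [hcFz hcGz].
    have [_ _ [qx wx] [qy wy] _] := nbhs_singleton gz.
    have hqf := holo_horner q hfz; have hqg := holo_horner q hgz; have hWg := holo_horner W hgz.
    have hA : holo A z.
      apply: holoD; first apply: holoD.
      - exact: holo_cst.
      - by apply: holoM; [exact: holo_cst|exact: hfz].
      - by apply: holoM; [exact: holo_cst|exact: hgz].
    apply: holo_der; apply: holoM; last first.
      by apply: holoV; [rewrite mulf_neq0|apply: holoM; [exact: hcFz|exact: hcGz]].
    apply: holoM; last first.
      by apply: holoV; [rewrite mulf_neq0|apply: holoM; [exact: hqf|exact: hWg]].
    apply: holoM; last exact: holo_derive.
    by apply: holoM; [exact: hA|exact: hqg].
  pose S z := K3 * (sph F z ^+ 2 + sph G z ^+ 2).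
  have cS : {for z0, continuous S}.
    apply: rcontM; first exact: rcont_cst.
    by apply: rcontD; exact: rcont_sph2.
  have cS' : {for z0, continuous (fun z => S z0 + 1 - S z)}.
    by apply: rcontB; [exact: rcont_cst|exact: cS].
  have S1 : 0 < S z0 + 1 - S z0 by rewrite addrAC subrr add0r.
  have nS := near_dnear (rcont_gt0 cS' S1).
  (* Since [pullback] is at least |H0|^2, the metric estimate itself bounds [H0] and makes its
     singularity removable: no local study of the curve is needed, not even at infinity. *)
  have bH0 : \forall z \near z0^', nm (H0 z) <= S z0 + 2.
    apply: dnearS2 (dnearS2 (fun x a b => conj a b) e0 b0) nS => z [ez bz] Sz.
    have h1 : nm (H0 z) ^+ 2 <= u0 z.
      rewrite ez /pullback -mulrA; apply: ler_peMr; first exact: sqr_ge0.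
      exact: mulr_ege1 (msq1 (F z)) (msq1 (G z)).
    have h2 : 0 <= (nm (H0 z) - 1) ^+ 2 by exact: sqr_ge0.
    have h0 := nm_ge0 (H0 z).
    move: bz h1 h2 Sz; rewrite -/(S z); move: (u0 z) (S z) (S z0) (nm (H0 z)) h0 => a b d e.
    by clear => *; nra.
  have [H hH HE] := removable dH0 bH0.
  exists F, G, H; split; [exact: hF|exact: hG|exact: hH| |exact: b0].
  by apply: dnearS2 e0 HE => z -> e; rewrite /pullback e.
have D0 : \forall z \near (0 : C)^', 'D_1 ff z = 0.
  apply: dnearS2 (key 0) (nice 0) => z uz [_ _ [qx wx] [qy wy] [_ Az]].
  have m0 (x : C) : (msq x == 0) = false by rewrite gt_eqF// nm2_gt0.
  move/eqP: uz; rewrite /u0 !mulf_eq0 !m0 !orbF orbb nm_eq0 /h !mulf_eq0 (negPf Az) (negPf qy) /=.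
  by rewrite invr_eq0 mulf_eq0 (negPf qx) (negPf wy) !orbF => /eqP.
have [z [Dz [hz gz]]] := dnear_ex (dnearS2 (fun x a b => conj a b) (dnear_near_open D0)
   (dnearS2 (fun x a b => conj a b) (hff 0) (dnear_near_open (nice 0)))).
have cst := derive0_const hz (near_dnear Dz).
have [w [[cw gw] fw]] := dnear_ex (dnearS2 (fun x a b => conj a b) (near_dnear (nearS2 (fun x a b => conj a b) cst gz)) (mero_neq (ff z) z mf nf)).
by apply: fw; case: gw => -> _ _ _ _; rewrite cw.
Qed.

End Rigidity.

(** * Estimates on the curve of a generic pair *)

Section RootEstimates.
Context {R : realType}.
Local Notation C := (Cplx R).
Implicit Types (p q W : {poly C}) (a b x y : C) (rs : seq C).

Definition sqd x a : R := nm (x - a) ^+ 2.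

Lemma sqd_ge0 x a : 0 <= sqd x a. Proof. exact: sqr_ge0. Qed.

Lemma msq_ge1 x : 1 <= msq x. Proof. by rewrite lerDl sqr_ge0. Qed.
Lemma msq_gt0 x : 0 < msq x. Proof. exact: nm2_gt0. Qed.

Lemma nm_add_sqr x y : nm (x + y) ^+ 2 <= 2 * nm x ^+ 2 + 2 * nm y ^+ 2.
Proof.
have h := nmD x y; have h0 := nm_ge0 (x + y).
have h1 := sqr_ge0 (nm x - nm y).
apply: (@le_trans _ _ ((nm x + nm y) ^+ 2)); first exact: le_expr.
by move: h1; clear => h1; nra.
Qed.

Lemma sqd_tri x a b : sqd a b <= 2 * sqd x a + 2 * sqd x b.
Proof.
have := nm_add_sqr (a - x) (x - b); rewrite addrA subrK.
by rewrite (nmBC a x).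
Qed.

(** The truncated distance makes the estimate uniform in [x]: away from [a], including near
    infinity, [sqd x a] is comparable to [msq x]. *)
Lemma sqd_lower a x :
  (3 + 2 * nm a ^+ 2)^-1 * Num.min 1 (sqd x a) * msq x <= sqd x a.
Proof.
have B0 : 0 < 3 + 2 * nm a ^+ 2 by rewrite ltr_pwDl// mulr_ge0// sqr_ge0.
rewrite -mulrA mulrC ler_pdivrMr//.
have := nm_add_sqr (x - a) a; rewrite subrK /msq -/(sqd x a).
have := sqd_ge0 x a; have : 0 <= nm a ^+ 2 by exact: sqr_ge0.
move: (sqd x a) (nm a ^+ 2) (nm x ^+ 2) => d e z e0 d0 h.
by case: (leP 1 d) => hd; [nra|nra].
Qed.

Lemma sqd_upper a x : sqd x a <= 2 * msq a * msq x.
Proof.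
have := nm_add_sqr x (- a); rewrite nmN -/(sqd x a) /msq.
have : 0 <= nm a ^+ 2 * nm x ^+ 2 by rewrite mulr_ge0// sqr_ge0.
by clear; nra.
Qed.

Lemma nm_prod_roots rs x :
  nm (\prod_(a <- rs) ('X - a%:P)).[x] ^+ 2 = \prod_(a <- rs) sqd x a.
Proof.
elim: rs => [|a rs ih]; first by rewrite !big_nil hornerE nm1 expr1n.
by rewrite !big_cons hornerM nmM exprMn ih !hornerE.
Qed.

Lemma poly_roots p : p != 0 -> {rs : seq C |
  p = lead_coef p *: \prod_(a <- rs) ('X - a%:P) & size p = (size rs).+1}.
Proof.
move=> p0; have [rs e] := closed_field_poly_normal p; exists rs => //.
by rewrite {1}e size_scale ?lead_coef_eq0// size_prod_XsubC.
Qed.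

Lemma root_in p rs x : p != 0 -> p = lead_coef p *: \prod_(a <- rs) ('X - a%:P) ->
  (x \in rs) = root p x.
Proof.
by move=> p0 e; rewrite e rootZ ?lead_coef_eq0// root_prod_XsubC.
Qed.

Lemma poly_lower p rs : p != 0 -> p = lead_coef p *: \prod_(a <- rs) ('X - a%:P) ->
  exists2 k : R, 0 < k & forall x,
    k * \prod_(a <- rs) Num.min 1 (sqd x a) * msq x ^+ size rs <= nm p.[x] ^+ 2.
Proof.
move=> p0 pE; set l := lead_coef p in pE.
have l0 : 0 < nm l ^+ 2 by apply: exprn_gt0; rewrite nm_gt0 lead_coef_eq0.
exists (nm l ^+ 2 * \prod_(a <- rs) (3 + 2 * nm a ^+ 2)^-1).
  apply: mulr_gt0 => //; elim: (rs) => [|a s ih]; rewrite ?big_nil// big_cons mulr_gt0//.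
  by rewrite invr_gt0 ltr_pwDl// mulr_ge0// sqr_ge0.
move=> x; rewrite pE hornerZ nmM exprMn nm_prod_roots.
rewrite -(mulrA (nm l ^+ 2)) -(mulrA (nm l ^+ 2)) ler_pM2l//.
elim: (rs) => [|a s ih]; first by rewrite !big_nil !mulr1.
rewrite !big_cons /= [msq x ^+ _]exprS.
set A := \prod_(_ <- s) _ in ih *; set B := \prod_(_ <- s) _ in ih *; set D := \prod_(_ <- s) _ in ih *.
apply: (@le_trans _ _ (((3 + 2 * nm a ^+ 2)^-1 * Num.min 1 (sqd x a) * msq x) * (A * B * msq x ^+ size s))).
  by rewrite le_eqVlt; apply/orP; left; apply/eqP; ring.
have ge0 : 0 <= A * B * msq x ^+ size s.
  rewrite -mulrA; apply: mulr_ge0; last apply: mulr_ge0.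
  - apply: prodr_ge0 => b _; rewrite invr_ge0 addr_ge0// mulr_ge0// sqr_ge0//.
  - by apply: prodr_ge0 => b _; rewrite le_min ler01 sqd_ge0.
  - by rewrite exprn_ge0// ltW// msq_gt0.
apply: ler_pM => //; last exact: sqd_lower.
apply: mulr_ge0; last exact: ltW (msq_gt0 x).
apply: mulr_ge0; last by rewrite le_min ler01 sqd_ge0.
by rewrite invr_ge0 addr_ge0// mulr_ge0// sqr_ge0.
Qed.

Lemma poly_upper p n : (size p <= n.+1)%N ->
  exists2 K : R, 0 <= K & forall x, nm p.[x] ^+ 2 <= K * msq x ^+ n.
Proof.
have [->|p0 sp] := eqVneq p 0.
  by exists 0 => // x; rewrite horner0 nm0 expr0n mul0r.
have [rs pE sE] := poly_roots p0.
exists (nm (lead_coef p) ^+ 2 * \prod_(a <- rs) (2 * msq a)).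
  apply: mulr_ge0; first exact: sqr_ge0.
  by apply: prodr_ge0 => a _; rewrite mulr_ge0// ltW// msq_gt0.
move=> x; rewrite [in nm _]pE hornerZ nmM exprMn nm_prod_roots -(mulrA (nm _ ^+ 2)).
apply: ler_wpM2l; first exact: sqr_ge0.
apply: (@le_trans _ _ (\prod_(a <- rs) (2 * msq a) * msq x ^+ size rs)).
  elim: (rs) => [|a s ih]; first by rewrite !big_nil mulr1.
  rewrite !big_cons /= [msq x ^+ _]exprS mulrACA; apply: ler_pM => //.
  - exact: sqd_ge0.
  - by apply: prodr_ge0 => b _; exact: sqd_ge0.
  - exact: sqd_upper.
apply: ler_wpM2l.
  by apply: prodr_ge0 => a _; rewrite mulr_ge0// ltW// msq_gt0.
by apply: ler_weXn2l; [exact: msq_ge1|rewrite -ltnS -sE].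
Qed.

Lemma uniform_pos (T : eqType) (s : seq T) (P : T -> R -> Prop) :
  (forall t e e', P t e -> 0 < e' -> e' <= e -> P t e') ->
  (forall t, t \in s -> exists2 e : R, 0 < e & P t e) ->
  exists2 e : R, 0 < e & forall t, t \in s -> P t e.
Proof.
move=> mono; elim: s => [|t s ih] h; first by exists 1.
have [e1 e10 h1] := h t (mem_head _ _).
have [|e2 e20 h2] := ih; first by move=> u us; apply: h; rewrite inE us orbT.
exists (Num.min e1 e2); first by rewrite lt_min e10.
move=> u; rewrite inE => /predU1P[->|us].
  by apply: mono h1 _ _; rewrite ?lt_min ?e10// ge_min lexx.
by apply: mono (h2 u us) _ _; rewrite ?lt_min ?e10// ge_min lexx orbT.
Qed.

Lemma prod_min_ge (e : R) rs x : 0 < e -> e <= 1 -> (forall a, a \in rs -> e <= sqd x a) ->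
  e ^+ size rs <= \prod_(a <- rs) Num.min 1 (sqd x a).
Proof.
move=> e0 e1; elim: rs => [|a s ih] h; first by rewrite big_nil.
rewrite big_cons /= exprS; apply: ler_pM.
- exact: ltW.
- by rewrite exprn_ge0// ltW.
- by rewrite le_min e1 h// mem_head.
- by apply: ih => b bs; apply: h; rewrite inE bs orbT.
Qed.

(* Distinct points of [rs] cannot both be close to [x]. *)
Lemma separation rs1 rs2 : exists2 e : R, 0 < e <= 1 &
  forall x a b, a \in rs1 -> b \in rs2 -> a != b -> sqd x a < e -> e <= sqd x b.
Proof.
have [|t|e e0 he] := @uniform_pos _ [seq (a, b) | a <- rs1, b <- rs2]
  (fun t e => t.1 != t.2 -> 4 * e <= sqd t.1 t.2).
- by move=> t e e' h e'0 ee' /h; lra.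
- move=> _; have [tt|tt] := eqVneq t.1 t.2; first by exists 1.
  exists (sqd t.1 t.2 / 4); last by rewrite mulrC divfK.
  by rewrite divr_gt0//; apply: exprn_gt0; rewrite nm_gt0 subr_eq0.
exists (Num.min e 1); first by rewrite lt_min e0 ltr01 ge_min lexx orbT.
move=> x a b ars brs ab; rewrite lt_min => /andP[ha _].
have := he (a, b) (allpairs_f _ ars brs) ab => /=.
have := sqd_tri x a b; rewrite ge_min => h1 h2; apply/orP; left.
by move: h1 h2 ha; clear; lra.
Qed.

(** No x is close both to a root of p and to a root of q, so one of the two polynomials satisfies
    the bound alone. Both have exact degree n, which settles large x. *)
Lemma coprime_lower p q n : size p = n.+1 -> size q = n.+1 -> coprimep p q ->
  exists2 k : R, 0 < k & forall x, k * msq x ^+ n <= nm p.[x] ^+ 2 + nm q.[x] ^+ 2.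
Proof.
move=> sp sq cpq.
have p0 : p != 0 by rewrite -size_poly_eq0 sp.
have q0 : q != 0 by rewrite -size_poly_eq0 sq.
have [rp pE spE] := poly_roots p0; have [rq qE sqE] := poly_roots q0.
have np : size rp = n by move: spE; rewrite sp => -[].
have nq : size rq = n by move: sqE; rewrite sq => -[].
have [kp kp0 hp] := poly_lower p0 pE; have [kq kq0 hq] := poly_lower q0 qE.
have [e /andP[e0 e1] he] := separation rp rq.
have en : 0 < e ^+ n by rewrite exprn_gt0.
have mn x : 0 <= msq x ^+ n by rewrite exprn_ge0// ltW// msq_gt0.
exists (Num.min kp kq * e ^+ n); first by rewrite mulr_gt0// lt_min kp0.
move=> x; have [h|] := boolP (all (fun a => e <= sqd x a) rp).
  apply: (@le_trans _ _ (nm p.[x] ^+ 2)); last by rewrite lerDl sqr_ge0.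
  apply: le_trans (hp x); rewrite np; apply: ler_wpM2r => //.
  apply: ler_pM; rewrite ?ge_min ?lexx//.
  - by rewrite le_min !ltW.
  - exact: ltW.
  - by rewrite -np; apply: prod_min_ge => // a ar; exact: (allP h).
rewrite -has_predC => /hasP[a ar /=]; rewrite -ltNge => ha.
apply: (@le_trans _ _ (nm q.[x] ^+ 2)); last by rewrite lerDr sqr_ge0.
apply: le_trans (hq x); rewrite nq; apply: ler_wpM2r => //.
apply: ler_pM; rewrite ?ge_min ?lexx ?orbT//.
- by rewrite le_min !ltW.
- exact: ltW.
rewrite -nq; apply: prod_min_ge => // b br; apply: he ha => //.
apply: contraTneq br => <-; rewrite (root_in _ q0 qE).
rewrite (root_in _ p0 pE) in ar; exact: coprimep_root ar.
Qed.

(** Where W is small, x is close to a single root, whose factor is simple, while the factors of the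
    other roots are bounded below. The radius [e] is imposed by the caller. *)
Lemma near_simple_root W m (e : R) : size W = m.+1 -> separable_poly W -> 0 < e ->
  exists2 k : R, 0 < k & forall x, k <= nm W.[x] ^+ 2 / msq x ^+ m \/
    exists a, [/\ root W a, sqd x a < e & k * sqd x a <= nm W.[x] ^+ 2 / msq x ^+ m].
Proof.
move=> sW sep e0.
have W0 : W != 0 by rewrite -size_poly_eq0 sW.
have [rs WE sE] := poly_roots W0.
have ms : size rs = m by move: sE; rewrite sW => -[].
have urs : uniq rs.
  rewrite -separable_prod_XsubC; move: sep; rewrite WE.
  by rewrite (eqp_separable (eqp_scale _ _))// lead_coef_eq0.
have [k k0 hk] := poly_lower W0 WE.
have [e1 /andP[e10 e11] he1] := separation rs rs.
pose d := Num.min e e1.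
have d0 : 0 < d by rewrite lt_min e0.
have d1 : d <= 1 by rewrite ge_min e11 orbT.
have de : d <= e by rewrite ge_min lexx.
have de1 : d <= e1 by rewrite ge_min lexx orbT.
exists (k * d ^+ m); first by rewrite mulr_gt0// exprn_gt0.
move=> x; have mx : 0 < msq x ^+ m by rewrite exprn_gt0// msq_gt0.
have [h|] := boolP (all (fun a => d <= sqd x a) rs).
  left; rewrite ler_pdivlMr//; apply: le_trans (hk x); rewrite ms ler_pM2r// ler_pM2l//.
  by rewrite -ms; apply: prod_min_ge => // a ar; exact: (allP h).
rewrite -has_predC => /hasP[a ar /=]; rewrite -ltNge => ha; right; exists a; split.
- by rewrite -(root_in _ W0 WE).
- exact: lt_le_trans de.
rewrite ler_pdivlMr//; apply: le_trans (hk x); rewrite ms ler_pM2r// -mulrA ler_pM2l//.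
have ps := perm_to_rem ar; rewrite (perm_big _ ps) /= big_cons mulrC.
have -> : Num.min 1 (sqd x a) = sqd x a by rewrite min_r// ltW// (lt_le_trans ha).
apply: ler_wpM2l; first exact: sqd_ge0.
apply: (@le_trans _ _ (d ^+ size (rem a rs))).
  by apply: ler_wiXn2l => //; [exact: ltW|rewrite -ms size_rem// leq_pred].
apply: prod_min_ge => // b; rewrite mem_rem_uniq// inE => /andP[ba br].
apply: (le_trans de1); apply: he1 ar br _ _; first by rewrite eq_sym.
exact: lt_le_trans de1.
Qed.

End RootEstimates.

(** * Uniqueness for generic pairs *)

Section Core.
Context {R : realType}.
Local Notation C := (Cplx R).
Implicit Types (p q : {poly C}) (a b x y c : C).

Lemma cont_horner (T : topologicalType) (P : {poly C}) (f : T -> C) (t : T) :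
  {for t, continuous f} -> {for t, continuous (fun u => P.[f u])}.
Proof.
move=> h; elim/poly_ind: P => [|P c ih].
  have -> : (fun u => (0 : {poly C}).[f u]) = (fun=> 0).
    by apply/funext => u; rewrite horner0.
  exact: cont_cst.
have -> : (fun u => (P * 'X + c%:P).[f u]) = (fun u => P.[f u] * f u + c).
  by apply/funext => u; rewrite !hornerE.
by apply: contD; [apply: contM; [exact: ih|exact: h]|exact: cont_cst].
Qed.

Lemma curve_far p q c a b : p.[a] * q.[b] != c * p.[b] * q.[a] ->
  exists2 e : R, 0 < e & forall x y, sqd x a < e -> sqd y b < e ->
    p.[x] * q.[y] <> c * p.[y] * q.[x].
Proof.
move=> nab; pose F (z : C * C) := p.[z.1] * q.[z.2] - c * p.[z.2] * q.[z.1].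
have c1 : {for ((a, b) : C * C), continuous (fun z : C * C => z.1)} by exact: cvg_fst.
have c2 : {for ((a, b) : C * C), continuous (fun z : C * C => z.2)} by exact: cvg_snd.
have cF : {for ((a, b) : C * C), continuous F}.
  apply: contB.
    apply: (@contM _ _ (fun z => p.[z.1]) (fun z => q.[z.2])).
      by apply: (@cont_horner _ p (fun z : C * C => z.1)); exact: c1.
    by apply: (@cont_horner _ q (fun z : C * C => z.2)); exact: c2.
  apply: (@contM _ _ (fun z => c * p.[z.2]) (fun z => q.[z.1])).
    apply: contMl; apply: (@cont_horner _ p (fun z : C * C => z.2)); exact: c2.
  by apply: (@cont_horner _ q (fun z : C * C => z.1)); exact: c1.
have F0 : 0 < nm (F (a, b)) by rewrite nm_gt0 subr_eq0.
have /(cvgC (nbhs_filter ((a, b) : C * C)) _ _).1/(_ _ F0) := cF.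
case=> -[A B] [/= /nearC[d d0 hd] /nearC[e e0 he]] h.
exists (Num.min (d ^+ 2) (e ^+ 2)); first by rewrite lt_min !exprn_gt0.
move=> x y; rewrite !lt_min => /andP[xd _] /andP[_ ye] exy.
have xa : nm (x - a) < d by rewrite -(@ltr_pXn2r _ 2)// ?nnegrE ?nm_ge0// ltW.
have yb : nm (y - b) < e by rewrite -(@ltr_pXn2r _ 2)// ?nnegrE ?nm_ge0// ltW.
have := h (x, y) (conj (hd x xa) (he y yb)); rewrite /= {1}/F /= exy subrr sub0r nmN.
by rewrite ltxx.
Qed.

Lemma nm_affine_le (A0 A1 A2 x y : C) :
  nm (A0 + A1 * x + A2 * y) ^+ 2 <=
  4 * (nm A0 ^+ 2 + nm A1 ^+ 2 + nm A2 ^+ 2) * (msq x * msq y).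
Proof.
have h1 := nm_add_sqr (A0 + A1 * x) (A2 * y); have h2 := nm_add_sqr A0 (A1 * x).
rewrite nmM exprMn in h1; rewrite nmM exprMn in h2.
have p0 : 0 <= nm A0 ^+ 2 by exact: sqr_ge0.
have p1 : 0 <= nm A1 ^+ 2 by exact: sqr_ge0.
have p2 : 0 <= nm A2 ^+ 2 by exact: sqr_ge0.
have q1 : 0 <= nm x ^+ 2 by exact: sqr_ge0.
have q2 : 0 <= nm y ^+ 2 by exact: sqr_ge0.
rewrite /msq; move: p0 p1 p2 q1 q2 h1 h2.
move: (nm A0 ^+ 2) (nm A1 ^+ 2) (nm A2 ^+ 2) (nm x ^+ 2) (nm y ^+ 2) (nm (A0 + A1 * x + A2 * y) ^+ 2) (nm (A0 + A1 * x) ^+ 2).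
move=> u v w X Y s t u0 v0 w0 X0 Y0 h1 h2.
have k1 : 0 <= u * X by exact: mulr_ge0.
have k2 : 0 <= u * Y by exact: mulr_ge0.
have k3 : 0 <= u * (X * Y) by rewrite !mulr_ge0.
have k4 : 0 <= v * Y by exact: mulr_ge0.
have k5 : 0 <= v * (X * Y) by rewrite !mulr_ge0.
have k6 : 0 <= w * X by exact: mulr_ge0.
have k7 : 0 <= w * (X * Y) by rewrite !mulr_ge0.
have k8 : 0 <= v * X by exact: mulr_ge0.
have k9 : 0 <= w * Y by exact: mulr_ge0.
lra.
Qed.

(** If W(x) or W(y) is not small, a crude bound of A suffices. Otherwise x and y are near roots a
    and b of W, and (a, b) is on the curve, since points off the curve have neighbourhoods off it.
    So A(a, b) = 0, and A(x, y) = A1 (x - a) + A2 (y - b) is controlled by the simple zeros of W. *)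
Lemma node_estimate p q c (m : nat) (A0 A1 A2 : C) (W := wronsk p q) :
  size W = m.+1 -> separable_poly W ->
  (forall a b, root W a -> root W b -> p.[a] * q.[b] = c * p.[b] * q.[a] ->
     A0 + A1 * a + A2 * b = 0) ->
  exists2 K' : R, 0 <= K' & forall x y, p.[x] * q.[y] = c * p.[y] * q.[x] ->
    nm (A0 + A1 * x + A2 * y) ^+ 2 <= K' * (msq x * msq y) *
      (nm W.[x] ^+ 2 / msq x ^+ m + nm W.[y] ^+ 2 / msq y ^+ m).
Proof.
move=> sW sep node.
have W0 : W != 0 by rewrite -size_poly_eq0 sW.
have [rs WE _] := poly_roots W0.
have [|t|e e0 he] := @uniform_pos R _ [seq (a, b) | a <- rs, b <- rs]
  (fun t e => p.[t.1] * q.[t.2] != c * p.[t.2] * q.[t.1] ->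
     forall x y, sqd x t.1 < e -> sqd y t.2 < e -> p.[x] * q.[y] <> c * p.[y] * q.[x]).
- move=> t e e' h e'0 ee' /h hh x y hx hy; apply: hh; exact: lt_le_trans ee'.
- move=> _; have [tt|tt] := eqVneq (p.[t.1] * q.[t.2]) (c * p.[t.2] * q.[t.1]).
    by exists 1.
  by have [e e0 he] := curve_far tt; exists e.
have [k k0 hk] := near_simple_root sW sep e0.
pose B := 4 * (nm A0 ^+ 2 + nm A1 ^+ 2 + nm A2 ^+ 2).
have B0 : 0 <= B by rewrite mulr_ge0// !addr_ge0// sqr_ge0.
exists (B / k); first by rewrite divr_ge0// ltW.
move=> x y exy.
have om z : 0 <= nm W.[z] ^+ 2 / msq z ^+ m.
  by rewrite divr_ge0 ?sqr_ge0// exprn_ge0// ltW// msq_gt0.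
have mm : 0 < msq x * msq y by rewrite mulr_gt0// msq_gt0.
have -> : B / k * (msq x * msq y) * (nm W.[x] ^+ 2 / msq x ^+ m + nm W.[y] ^+ 2 / msq y ^+ m) =
  (B * (msq x * msq y)) * ((nm W.[x] ^+ 2 / msq x ^+ m + nm W.[y] ^+ 2 / msq y ^+ m) / k) by ring.
have far : k <= nm W.[x] ^+ 2 / msq x ^+ m + nm W.[y] ^+ 2 / msq y ^+ m ->
    nm (A0 + A1 * x + A2 * y) ^+ 2 <= B * (msq x * msq y) *
      ((nm W.[x] ^+ 2 / msq x ^+ m + nm W.[y] ^+ 2 / msq y ^+ m) / k).
  move=> h; apply: le_trans (nm_affine_le _ _ _ _ _) _.
  by apply: ler_peMr; [rewrite mulr_ge0// ltW|rewrite ler_pdivlMr// mul1r].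
have [hx|[a [ra xa hx]]] := hk x; first by apply: far; rewrite (le_trans hx)// lerDl.
have [hy|[b [rb yb hy]]] := hk y; first by apply: far; rewrite (le_trans hy)// lerDr.
have nab : A0 + A1 * a + A2 * b = 0.
  apply: node => //; apply/eqP; apply: contraT => nab.
  case: (he (a, b) _ nab x y xa yb exy).
  by apply: allpairs_f; rewrite (root_in _ W0 WE).
have -> : A0 + A1 * x + A2 * y = A1 * (x - a) + A2 * (y - b).
  by rewrite -[LHS]subr0 -nab; ring.
have h1 := nm_add_sqr (A1 * (x - a)) (A2 * (y - b)).
rewrite !nmM !exprMn -!/(sqd _ _) in h1.
have h2 : sqd x a <= (nm W.[x] ^+ 2 / msq x ^+ m) / k by rewrite ler_pdivlMr// mulrC.
have h3 : sqd y b <= (nm W.[y] ^+ 2 / msq y ^+ m) / k by rewrite ler_pdivlMr// mulrC.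
rewrite (mulrDl _ _ k^-1); set X := _ / k in h2 *; set Y := _ / k in h3 *.
have X0 : 0 <= X by apply: le_trans h2; exact: sqd_ge0.
have Y0 : 0 <= Y by apply: le_trans h3; exact: sqd_ge0.
apply: (le_trans h1); apply: (@le_trans _ _ (B * (X + Y))); last first.
  apply: ler_wpM2r; first exact: addr_ge0.
  by apply: ler_peMr => //; apply: mulr_ege1; exact: msq_ge1.
have a1 : 0 <= nm A1 ^+ 2 by exact: sqr_ge0.
have a2 : 0 <= nm A2 ^+ 2 by exact: sqr_ge0.
have a0 : 0 <= nm A0 ^+ 2 by exact: sqr_ge0.
have j1 := ler_wpM2l a1 h2; have j2 := ler_wpM2l a2 h3.
rewrite /B; move: (nm A0 ^+ 2) (nm A1 ^+ 2) (nm A2 ^+ 2) a0 a1 a2 j1 j2 => u v w u0 v0 w0 j1 j2.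
have i1 := mulr_ge0 u0 (addr_ge0 X0 Y0); have i2 := mulr_ge0 v0 X0.
have i3 := mulr_ge0 v0 Y0; have i4 := mulr_ge0 w0 X0; have i5 := mulr_ge0 w0 Y0.
lra.
Qed.

(* The critical values of [p / q] are distinct and, for [c] not in [{0, 1}], the
   curve P(x) = c P(y) has at most one singular point. *)
Definition generic_pair (n : nat) p q : Prop :=
  [/\ size p = n.+1 /\ size q = n.+1, coprimep p q,
      size (wronsk p q) = (2 * n - 2).+1 /\ separable_poly (wronsk p q),
      (forall a b, root (wronsk p q) a -> root (wronsk p q) b ->
         p.[a] * q.[b] = p.[b] * q.[a] -> a = b) &
      forall c, c != 0 -> c != 1 -> forall a b a' b',
        root (wronsk p q) a -> root (wronsk p q) b ->
        root (wronsk p q) a' -> root (wronsk p q) b' ->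
        p.[a] * q.[b] = c * p.[b] * q.[a] -> p.[a'] * q.[b'] = c * p.[b'] * q.[a'] ->
        a = a' /\ b = b'].

Lemma generic_unique (n : nat) p q c (f g : C -> option C) : (4 <= n)%N ->
  generic_pair n p q ->
  meromorphic f -> meromorphic g -> nonconstant f -> nonconstant g ->
  mero_eq (rat_comp p q f) (scale_fun c (rat_comp p q g)) ->
  c = 1 /\ (forall z, f z = g z).
Proof.
move=> n4 [[sp sq] cpq [sW sep] dist node] mf mg nf ng e.
have p0 : p != 0 by rewrite -size_poly_eq0 sp.
have q0 : q != 0 by rewrite -size_poly_eq0 sq.
have W0 : wronsk p q != 0 by rewrite -size_poly_eq0 sW.
have rel z0 : \forall z \near z0^', forall x y, f z = Some x -> g z = Some y ->
    p.[x] / q.[x] = c * (p.[y] / q.[y]) /\ (q.[x] != 0 /\ q.[y] != 0).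
  have h := dnearS2 (fun _ u v => conj u v) (mero_poly_neq0 z0 mf nf q0) (mero_poly_neq0 z0 mg ng q0).
  apply: dnearS2 h (e z0) => z [[x fx qx] [y gy qy]] ez x' y'.
  rewrite fx gy => -[<-] [<-]; move: ez.
  by rewrite /scale_fun /rat_comp fx gy (negPf qx) (negPf qy) => -[].
have [c0|c0] := eqVneq c 0.
  exfalso; have h := dnearS2 (fun _ u v => conj u v) (mero_poly_neq0 0 mf nf p0) (mero_some 0 mg).
  have [z [[[x fx px] gs] r]] := dnear_ex (dnearS2 (fun _ u v => conj u v) h (rel 0)).
  case gz : (g z) gs => [y|]// _; have [+ [qx _]] := r x y fx gz.
  by rewrite c0 mul0r => /eqP; rewrite mulf_eq0 invr_eq0 (negPf px) (negPf qx).
have rel' z0 : \forall z \near z0^', forall x y, f z = Some x -> g z = Some y ->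
    p.[x] * q.[y] = c * p.[y] * q.[x].
  apply: dnearS (rel z0) => z h x y fx gy; have [exy [qx qy]] := h x y fx gy.
  have -> : p.[x] = p.[x] / q.[x] * q.[x] by rewrite divfK.
  by rewrite exy; field.
have [k k0 lo] := coprime_lower sp sq cpq.
have [Kp Kp0 hp] : exists2 K : R, 0 <= K & forall x, nm p.[x] ^+ 2 <= K * msq x ^+ n.
  by apply: poly_upper; rewrite sp.
have [Kq Kq0 hq] : exists2 K : R, 0 <= K & forall x, nm q.[x] ^+ 2 <= K * msq x ^+ n.
  by apply: poly_upper; rewrite sq.
have up x : nm p.[x] ^+ 2 + nm q.[x] ^+ 2 <= (Kp + Kq) * msq x ^+ n.
  by rewrite mulrDl; apply: lerD; [exact: hp|exact: hq].
have K0 : 0 <= Kp + Kq by exact: addr_ge0.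
have fin (A0 A1 A2 : C) :
    (forall a b, root (wronsk p q) a -> root (wronsk p q) b ->
      p.[a] * q.[b] = c * p.[b] * q.[a] -> A0 + A1 * a + A2 * b = 0) ->
    (forall z0, \forall z \near z0^', forall x y, f z = Some x -> g z = Some y ->
      A0 + A1 * x + A2 * y != 0) -> False.
  move=> hn ha; have [K' K'0 star] := node_estimate sW sep hn.
  exact: (curve_rigid n4 k0 K0 K'0 c0 q0 W0 lo up star mf mg nf ng rel' ha).
have [c1|c1] := eqVneq c 1.
  split => //; case: (mero_dich mf mg) => // fg; exfalso.
  apply: (fin 0 1 (-1)).
    move=> a b ra rb; rewrite c1 mul1r => /dist -> //.
    by rewrite add0r mul1r mulN1r subrr.
  move=> z0; apply: dnearS (fg z0) => z h x y fx gy.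
  rewrite add0r mul1r mulN1r subr_eq0; apply/eqP => xy; apply: h.
  by rewrite fx gy xy.
exfalso.
case: (pselect (exists a b, [/\ root (wronsk p q) a, root (wronsk p q) b &
    p.[a] * q.[b] = c * p.[b] * q.[a]])) => [[a [b [ra rb eab]]]|nn].
  apply: (fin (- a) 1 0).
    move=> a' b' ra' rb' eab'; have [-> _] := node c c0 c1 a b a' b' ra rb ra' rb' eab eab'.
    by rewrite mul1r mul0r addr0 addNr.
  move=> z0; apply: dnearS (mero_neq a z0 mf nf) => z h x y fx _.
  rewrite mul1r mul0r addr0 addrC subr_eq0; apply/eqP => xa; apply: h.
  by rewrite fx xa.
apply: (fin 1 0 0).
  by move=> a b ra rb eab; case: nn; exists a, b.
by move=> z0; apply/dnearC; exists 1 => // z _ _ x y _ _; rewrite !mul0r !addr0 oner_eq0.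
Qed.

End Core.

(** * Elimination *)

Section Thin.
Context {F : fieldType}.

Lemma left_kernel_vector (m k : nat) (A : 'M[F]_(m, k)) : (k < m)%N ->
  exists2 u : 'rV_m, u != 0 & u *m A = 0.
Proof.
move=> km; have : kermx A != 0.
  rewrite -mxrank_eq0 mxrank_ker subn_eq0 -ltnNge.
  exact: leq_ltn_trans (rank_leq_col A) km.
by case/rowV0Pn => u /sub_kermxP uA u0; exists u.
Qed.

Definition mdeg_le (K d : nat) (P : mpoly K F) :=
  forall m, m \in msupp P -> (mdeg m <= d)%N.

Lemma mdeg_leM (K a b : nat) (P Q : mpoly K F) :
  mdeg_le a P -> mdeg_le b Q -> mdeg_le (a + b) (P * Q).
Proof.
move=> hP hQ m /msuppM_le/allpairsP[[m1 m2] /= [h1 h2 ->]].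
by rewrite mdegD leq_add ?hP ?hQ.
Qed.

Lemma mdeg_le_prod_exp (K N D e : nat) (phi : 'I_N -> mpoly K F)
    (s : 'I_N -> nat) : (forall i, mdeg_le D (phi i)) ->
  (forall i, (s i <= e)%N) -> mdeg_le (N * (e * D)) (\prod_i phi i ^+ s i).
Proof.
move=> hD he.
have h1 : mdeg_le 0 (1 : mpoly K F).
  by move=> m; rewrite msupp1 inE => /eqP ->; rewrite mdeg0.
have -> : (N * (e * D) = \sum_(i < N) (e * D))%N.
  by rewrite sum_nat_const card_ord.
apply: (big_ind2 (fun P a => mdeg_le a P)); first exact: h1.
  by move=> P a Q b; exact: mdeg_leM.
move=> i _; have hX k : mdeg_le (k * D) (phi i ^+ k).
  elim: k => [|k ih]; first exact: h1.
  by rewrite exprS mulSn; exact: mdeg_leM (hD i) ih.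
by move=> m /hX h; apply: leq_trans h _; rewrite leq_mul2r he orbT.
Qed.

(* Counting: the e ^ N products of powers < e of the phi_i lie in the span of
   ((N D + 1) e) ^ K monomials, which for e = (N D + 1) ^ K + 1 is too small. *)
Lemma algebraic_dependence (K N : nat) (phi : 'I_N -> mpoly K F) :
  (K < N)%N -> exists2 Phi : mpoly N F, Phi != 0 &
    forall v : 'I_K -> F, meval (fun i => meval v (phi i)) Phi = 0.
Proof.
move=> KN; pose D := (\max_i mmeasure (@mdeg K) (phi i))%N.
have hD i : mdeg_le D (phi i).
  move=> m /msize_mdeg_lt h; apply: leq_trans (ltnW h) _.
  exact: (leq_bigmax i).
pose c := (N * D).+1; pose e := (c ^ K).+1; pose E := (c * e)%N.
pose S := {ffun 'I_N -> 'I_e}; pose T := {ffun 'I_K -> 'I_E}.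
pose mS (s : S) : multinom N := Multinom [tuple (s i : nat) | i < N].
pose mT (t : T) : multinom K := Multinom [tuple (t i : nat) | i < K].
pose P (s : S) := \prod_i phi i ^+ s i.
pose A := \matrix_(i < #|S|, j < #|T|) mcoeff (mT (enum_val j)) (P (enum_val i)).
have card : (#|T| < #|S|)%N.
  rewrite !card_ffun !card_ord expnMn.
  apply: (@leq_trans (e ^ K.+1)); last exact: leq_pexp2l.
  by rewrite expnS ltn_pmul2r ?expn_gt0.
have [u u0 uA] := left_kernel_vector A card.
pose w (s : S) := u 0 (enum_rank s).
have sum0 : \sum_s w s *: P s = 0.
  apply/mpolyP => m; rewrite mcoeff0 raddf_sum /=.
  have [mE|] := boolP [forall i, (m i < E)%N].
    pose t : T := [ffun i => Ordinal (forallP mE i)].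
    have mt : mT t = m by apply/mnmP => i; rewrite mnmE ffunE.
    have /rowP/(_ (enum_rank t)) := uA; rewrite !mxE => uAt; apply: etrans uAt.
    rewrite [RHS](reindex enum_rank) /=; last exact: onW_bij (enum_rank_bij _).
    by apply: eq_bigr => s _; rewrite mcoeffZ !mxE !enum_rankK mt.
  move=> h; case: (elimT forallPn h) => i; rewrite -leqNgt => Ei.
  rewrite big1// => s _; rewrite mcoeffZ; apply/eqP; rewrite mulf_eq0; apply/orP; right.
  rewrite mcoeff_eq0; apply/negP => ms.
  have he j : (s j <= c ^ K)%N by rewrite -ltnS; exact: ltn_ord.
  have := mdeg_le_prod_exp hD he ms; rewrite leqNgt => /negP; apply.
  apply: (@leq_trans (m i)); last by rewrite mdegE (bigD1 i)//= leq_addr.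
  apply: leq_trans Ei; rewrite /E /c /e mulSn mulnS -mulnA (mulnC _ D).
  by rewrite mulnC; clear; lia.
exists (\sum_s w s *: mpolyX _ (mS s)).
  have [i ui] := rV0Pn _ u0.
  apply/eqP => /(congr1 (mcoeff (mS (enum_val i)))); rewrite mcoeff0 raddf_sum /=.
  rewrite (bigD1 (enum_val i))//= mcoeffZ mcoeffX eqxx mulr1 big1 ?addr0.
    by rewrite /w enum_valK; apply/eqP.
  move=> s si; rewrite mcoeffZ mcoeffX; case: eqP => [es|_]; last by rewrite mulr0.
  case/eqP: si; apply/ffunP => j; apply/val_inj.
  by have /mnmP/(_ j) := es; rewrite !mnmE.
move=> v; have /(congr1 (meval v)) := sum0; rewrite meval0 !raddf_sum /= => h.
apply: etrans h; apply: eq_bigr => s _; rewrite !mevalZ mevalX rmorph_prod /=.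
by congr (_ * _); apply: eq_bigr => i _; rewrite mnmE rmorphXn.
Qed.
End Thin.

(** * Polynomial functions and thin sets *)

Section PolyFun.
Context {F : fieldType}.

(** Functions rather than polynomials, so that determinants and adjugates are handled by closure
    properties. *)
Definition polyfun (m : nat) (f : ('I_m -> F) -> F) : Prop :=
  exists P : mpoly m F, forall t, f t = meval t P.

Lemma polyfun_cst (m : nat) (c : F) : polyfun (fun _ : 'I_m -> F => c).
Proof. by exists (mpolyC m c) => t; rewrite mevalC. Qed.

Lemma polyfun_var (m : nat) (i : 'I_m) : polyfun (fun t : 'I_m -> F => t i).
Proof. by exists (mpolyX F (mnm1 i)) => t; rewrite mevalXU. Qed.

Lemma polyfunD (m : nat) (f g : ('I_m -> F) -> F) :
  polyfun f -> polyfun g -> polyfun (fun t => f t + g t).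
Proof. by move=> [P hP] [Q hQ]; exists (P + Q) => t; rewrite mevalD hP hQ. Qed.

Lemma polyfunM (m : nat) (f g : ('I_m -> F) -> F) :
  polyfun f -> polyfun g -> polyfun (fun t => f t * g t).
Proof. by move=> [P hP] [Q hQ]; exists (P * Q) => t; rewrite mevalM hP hQ. Qed.

Lemma polyfunN (m : nat) (f : ('I_m -> F) -> F) :
  polyfun f -> polyfun (fun t => - f t).
Proof. by move=> [P hP]; exists (- P) => t; rewrite mevalN hP. Qed.

Lemma polyfunX (m k : nat) (f : ('I_m -> F) -> F) :
  polyfun f -> polyfun (fun t => f t ^+ k).
Proof. by move=> [P hP]; exists (P ^+ k) => t; rewrite rmorphXn hP. Qed.

Lemma polyfun_sum (m : nat) (I : finType) (f : I -> ('I_m -> F) -> F) :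
  (forall i, polyfun (f i)) -> polyfun (fun t => \sum_i f i t).
Proof.
move=> /boolp.choice[P hP]; exists (\sum_i P i) => t.
by rewrite raddf_sum; apply: eq_bigr => i _.
Qed.

Lemma polyfun_prod (m : nat) (I : finType) (f : I -> ('I_m -> F) -> F) :
  (forall i, polyfun (f i)) -> polyfun (fun t => \prod_i f i t).
Proof.
move=> /boolp.choice[P hP]; exists (\prod_i P i) => t.
by rewrite rmorph_prod; apply: eq_bigr => i _.
Qed.

Lemma polyfun_reindex (m k : nat) (h : 'I_m -> 'I_k) (f : ('I_m -> F) -> F) :
  polyfun f -> polyfun (fun t : 'I_k -> F => f (fun i => t (h i))).
Proof.
move=> [P hP]; exists (comp_mpoly [tuple mpolyX F (mnm1 (h i)) | i < m] P) => t.
rewrite hP comp_mpoly_meval; apply: meval_eq => i.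
by rewrite tnth_mktuple mevalXU.
Qed.

Lemma polyfun_det (m k : nat) (M : ('I_m -> F) -> 'M[F]_k) :
  (forall i j, polyfun (fun t => M t i j)) -> polyfun (fun t => \det (M t)).
Proof.
move=> hM; apply: polyfun_sum => s; apply: polyfunM; first exact: polyfun_cst.
by apply: polyfun_prod => i.
Qed.

Lemma polyfun_adj (m k : nat) (M : ('I_m -> F) -> 'M[F]_k) i j :
  (forall i j, polyfun (fun t => M t i j)) -> polyfun (fun t => (\adj (M t)) i j).
Proof.
move=> hM.
have -> : (fun t => (\adj (M t)) i j) = (fun t => cofactor (M t) j i).
  by apply/funext => t; rewrite mxE.
apply: polyfunM; first exact: polyfun_cst.
apply: polyfun_det => a b.
have -> : (fun t => row' j (col' i (M t)) a b) = (fun t => M t (lift j a) (lift i b)).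
  by apply/funext => t; rewrite !mxE.
exact: hM.
Qed.

(** Contained in a hypersurface of affine space; homogeneity is recovered only in [thin_cone]. *)
Definition thin (N : nat) (B : ('I_N -> F) -> Prop) : Prop :=
  exists2 Phi : mpoly N F, Phi != 0 & forall v, B v -> meval v Phi = 0.

Lemma thin_sub (N : nat) (A B : ('I_N -> F) -> Prop) :
  thin B -> (forall v, A v -> B v) -> thin A.
Proof. by move=> [P P0 hP] AB; exists P => // v /AB/hP. Qed.

Lemma thin_finunion (N : nat) (I : finType) (B : I -> ('I_N -> F) -> Prop) :
  (forall i, thin (B i)) -> thin (fun v => exists i, B i v).
Proof.
move=> hB; have /boolp.choice[P hP] : forall i, exists Phi : mpoly N F,
    Phi != 0 /\ forall v, B i v -> meval v Phi = 0.
  by move=> i; have [P P0 h] := hB i; exists P.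
exists (\prod_i P i).
  by apply/prodf_neq0 => i _; have [] := hP i.
move=> v [i /(hP i).2 h]; rewrite rmorph_prod (bigD1 i)//=.
by rewrite h mul0r.
Qed.

Lemma thin_image (K N : nat) (phi : 'I_N -> ('I_K -> F) -> F) :
  (K < N)%N -> (forall i, polyfun (phi i)) ->
  thin (fun v => exists t, forall i, v i = phi i t).
Proof.
move=> KN /boolp.choice[P hP]; have [Phi Phi0 h] := algebraic_dependence P KN.
exists Phi => // v [t vt]; apply: etrans (h t).
by apply: meval_eq => i; rewrite vt hP.
Qed.

Lemma row_free_ker (k l : nat) (A : 'M[F]_(k, l)) :
  (forall u : 'rV_k, u *m A = 0 -> u = 0) -> row_free A.
Proof. by move=> h; rewrite -kermx_eq0; apply/rowV0P => u /sub_kermxP/h. Qed.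

(** The selected coordinate vectors map to a basis of the quotient by the row space of [A]. As there
    are finitely many selections, finitely many Cramer formulas cover all kernels. *)
Lemma row_free_complete (k r : nat) (A : 'M[F]_(k, k + r)) : row_free A ->
  exists f : {ffun 'I_r -> 'I_(k + r)}, \det (col_mx A (rowsub f 1%:M)) != 0.
Proof.
move=> fA; pose Q := cokermx A.
have rQ : \rank Q = r.
  by rewrite mxrank_coker; move/eqP: fA => ->; rewrite addKn.
have : exists f : 'I_(\rank Q) -> 'I_(k + r), row_free (rowsub f Q).
  by exists (maxrankfun Q); exact: maxrowsub_free.
move: (\rank Q) rQ => r' -> [f ff].
exists [ffun i => f i]; rewrite -unitfE -unitmxE -row_free_unit.
apply: row_free_ker => u; rewrite -[u]hsubmxK mul_row_col => h.
have b0 : rsubmx u = 0.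
  apply: (row_free_inj ff); rewrite mul0mx.
  have := congr1 (mulmx^~ Q) h; rewrite mulmxDl mul0mx -!mulmxA mulmx_coker mulmx0 add0r.
  rewrite -rowsubE => h'; apply: etrans h'; congr (_ *m _).
  by apply/matrixP => i j; rewrite !mxE ffunE.
move: h; rewrite b0 mul0mx addr0 -(mul0mx _ A) => /(row_free_inj fA) ->.
by rewrite row_mx0 mul0mx.
Qed.

(* By Cramer's rule every kernel vector of [M t] is a polynomial expression in
   [t] and [r] further parameters, that is in fewer than [k + r] variables. *)
Lemma thin_kernel (m k r : nat) (M : ('I_m -> F) -> 'M[F]_(k, k + r)) :
  (m < k)%N -> (forall i j, polyfun (fun t => M t i j)) ->
  thin (fun v => exists t, row_free (M t) /\ M t *m (\col_i v i) = 0).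
Proof.
move=> mk hM.
pose Om (f : {ffun 'I_r -> 'I_(k + r)}) t := col_mx (M t) (rowsub f 1%:M).
(* The last [r] parameters are free coordinates of the kernel vector already divided by the
   determinant, which keeps Cramer's formula polynomial. *)
pose phi f i (x : 'I_(m + r) -> F) :=
  \sum_j (\adj (Om f (fun i => x (lshift r i)))) i (rshift k j) * x (rshift m j).
have hphi f i : polyfun (phi f i).
  apply: polyfun_sum => j; apply: polyfunM; last exact: polyfun_var.
  apply: (@polyfun_reindex _ _ (lshift r) (fun t => (\adj (Om f t)) i (rshift k j))).
  apply: polyfun_adj => a b; rewrite /Om.
  case: (fintype.splitP a) => a' ea.
    have -> : (fun t => col_mx (M t) (rowsub f 1%:M) a b) = (fun t => M t a' b).
      apply/funext => t; have -> : a = lshift r a' by apply/val_inj.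
      by rewrite col_mxEu.
    exact: hM.
  have -> : (fun t => col_mx (M t) (rowsub f 1%:M) a b) =
            (fun=> (rowsub f 1%:M : 'M[F]_(r, k + r)) a' b).
    apply/funext => t; have -> : a = rshift k a' by apply/val_inj.
    by rewrite col_mxEd.
  exact: polyfun_cst.
apply: (thin_sub (thin_finunion (fun f => thin_image _ (hphi f)))).
  by rewrite ltn_add2r.
move=> v [t [/row_free_complete[f df] Mv]]; exists f.
set d := \det _ in df.
pose x (i : 'I_(m + r)) := match fintype.split i with inl a => t a | inr b => v (f b) / d end.
exists x => i.
have Ov : Om f t *m (\col_i v i) = col_mx 0 (\col_j v (f j)).
  rewrite mul_col_mx Mv -rowsubE; congr col_mx.
  by apply/matrixP => a b; rewrite !mxE.
have := congr1 (mulmx (\adj (Om f t))) Ov.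
rewrite mulmxA mul_adj_mx mul_scalar_mx => /colP/(_ i).
rewrite [LHS]mxE [X in _ * X]mxE [RHS]mxE big_split_ord /= [X in X + _]big1 ?add0r; last first.
  by move=> j _; rewrite col_mxEu [X in _ * X]mxE mulr0.
rewrite -/d => e; apply: (mulfI df); rewrite e /phi mulr_sumr.
apply: eq_bigr => j _; rewrite col_mxEd [X in _ * X = _]mxE.
have -> : (fun i => x (lshift r i)) = t.
  by apply/funext => a; rewrite /x (unsplitK (inl a)).
rewrite /x (unsplitK (inr j)) mulrCA; congr (_ * _).
by rewrite mulrCA divff ?mulr1.
Qed.
End PolyFun.

(** * Homogeneous equations for cones *)

Section Cone.
Context {F : numFieldType}.

Lemma poly_fun0 (P : {poly F}) : (forall x, P.[x] = 0) -> P = 0.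
Proof.
move=> h; apply: (@roots_geq_poly_eq0 _ _ [seq i%:R : F | i <- iota 0 (size P)]).
- by apply/allP => x _; rewrite /root h.
- by rewrite map_inj_uniq ?iota_uniq// => i j /eqP; rewrite eqr_nat => /eqP.
- by rewrite size_map size_iota.
Qed.

Lemma digits_inj (E N : nat) (a b : nat -> nat) :
  (forall i, (a i < E)%N) -> (forall i, (b i < E)%N) ->
  (\sum_(i < N) a i * E ^ i = \sum_(i < N) b i * E ^ i)%N ->
  forall i, (i < N)%N -> a i = b i.
Proof.
elim: N a b => [//|N ih] a b aE bE.
rewrite !big_ord_recl /= !expn0 !muln1 => e.
have shift (c : nat -> nat) : (\sum_(i < N) c (bump 0 i) * E ^ bump 0 i =
    (\sum_(i < N) c i.+1 * E ^ i) * E)%N.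
  by rewrite big_distrl; apply: eq_bigr => i _; rewrite /= -mulnA -expnSr.
rewrite !shift in e.
have E0 : (0 < E)%N by exact: leq_ltn_trans (aE 0).
have e0 : a 0 = b 0.
  have := congr1 (modn^~ E) e.
  by rewrite /= ![(_ + _ * E)%N]addnC !modnMDl !modn_small.
have e1 : (\sum_(i < N) a i.+1 * E ^ i = \sum_(i < N) b i.+1 * E ^ i)%N.
  by move: e; rewrite e0 => /addnI/eqP; rewrite eqn_pmul2r// => /eqP.
case=> // i; rewrite ltnS.
exact: (ih (fun i => a i.+1) (fun i => b i.+1)).
Qed.

(* Kronecker substitution x_i := X^(E^i), E larger than all exponents. *)
Lemma mpoly_nonroot (N : nat) (Phi : mpoly N F) :
  Phi != 0 -> exists v, meval v Phi != 0.
Proof.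
move=> Phi0; pose E := (mmeasure (@mdeg N) Phi).
have hE m : m \in msupp Phi -> forall i, (m i < E)%N.
  move=> /msize_mdeg_lt h i; apply: leq_ltn_trans h.
  by rewrite mdegE (bigD1 i)//= leq_addr.
pose wt (m : multinom N) := (\sum_(i < N) m i * E ^ i)%N.
have [m0 Pm0] : exists m, m \in msupp Phi.
  by exists (mlead Phi); exact: mlead_supp.
have wt_inj m m' : m \in msupp Phi -> m' \in msupp Phi -> wt m = wt m' -> m = m'.
  move=> hm hm' e; apply/mnmP => i.
  pose ex (m : multinom N) j := if insub j is Some j' then m j' else 0%N.
  have exE (m1 : multinom N) (j : 'I_N) : ex m1 j = m1 j by rewrite /ex valK.
  rewrite -!exE; apply: (@digits_inj E N) => //.
  - move=> j; rewrite /ex; case: insubP => [j' _ _|_]; first exact: hE.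
    exact: leq_ltn_trans (hE _ hm i).
  - move=> j; rewrite /ex; case: insubP => [j' _ _|_]; first exact: hE.
    exact: leq_ltn_trans (hE _ hm i).
  - by under eq_bigr do rewrite exE; under [RHS]eq_bigr do rewrite exE.
pose Q : {poly F} := \sum_(m <- msupp Phi) mcoeff m Phi *: 'X^(wt m).
have Q0 : Q != 0.
  apply/eqP => Qz; have := congr1 (coefp (wt m0)) Qz; rewrite /coefp coef0 coef_sum.
  rewrite (bigD1_seq m0)//= ?msupp_uniq// coefZ coefXn eqxx mulr1 big_seq_cond big1.
    by rewrite addr0; apply/eqP; rewrite -mcoeff_msupp.
  move=> m /andP[hm mm0]; rewrite coefZ coefXn.
  have [e|_] := eqVneq (wt m0) (wt m); last by rewrite mulr0.
  by case/eqP: mm0; exact: wt_inj (esym e).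
have /existsNP[x Qx] : ~ forall x, Q.[x] = 0.
  by move=> /poly_fun0 e; rewrite e eqxx in Q0.
exists (fun i => x ^+ (E ^ i)); apply: contra_not_neq Qx => <-.
rewrite mevalE horner_sum; apply: eq_bigr => m _; rewrite !hornerE.
rewrite /wt expr_sum; congr (_ * _).
by apply: eq_bigr => i _; rewrite -exprM mulnC.
Qed.

Lemma meval_scale (N d : nat) (P : mpoly N F) (a : F) (v : 'I_N -> F) :
  P \is ishomog1 d (@mdeg N) ->
  meval (fun i => a * v i) P = a ^+ d * meval v P.
Proof.
move=> /dhomogP hP; rewrite !mevalE mulr_sumr.
rewrite big_seq_cond [RHS]big_seq_cond; apply: eq_bigr => m /andP[/hP <- _].
under eq_bigr do rewrite exprMn.
by rewrite big_split/= mulrCA -expr_sum mdegE.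
Qed.

(** For v in the cone, Phi(a v) is a polynomial in a that vanishes identically; its coefficients are
    the values at v of the homogeneous components of Phi, so any nonzero component serves. *)
Lemma thin_cone (N : nat) (B : ('I_N -> F) -> Prop) :
  thin B -> (forall v a, B v -> B (fun i => a * v i)) ->
  exists Phi : mpoly N F, [/\ Phi != 0,
    exists d, Phi \is ishomog1 d (@mdeg N) & forall v, B v -> meval v Phi = 0].
Proof.
move=> [Phi Phi0 hPhi] hB; pose k := mmeasure (@mdeg N) Phi.
have ePhi : Phi = \sum_(d < k) pihomog (@mdeg N) d Phi.
  exact: pihomog_partitionE.
have [d d0] : exists d : 'I_k, pihomog (@mdeg N) d Phi != 0.
  apply: contrapT => h; case/eqP: Phi0; rewrite ePhi big1// => d _.
  by apply/eqP/negPn/negP => h'; apply: h; exists d.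
exists (pihomog (@mdeg N) d Phi); split=> //.
  by exists d; exact: pihomogP.
move=> v Bv; pose Q := \poly_(i < k) meval v (pihomog (@mdeg N) i Phi).
have Q0 : Q = 0.
  apply: poly_fun0 => a; apply: etrans (hPhi _ (hB _ a Bv)).
  rewrite [in RHS]ePhi raddf_sum /= horner_poly; apply: eq_bigr => i _.
  by rewrite (@meval_scale _ i) ?pihomogP// mulrC.
have := congr1 (coefp d) Q0; rewrite /coefp coef0 coef_poly ltn_ord.
exact.
Qed.
End Cone.

(** * Coefficient vectors of nongeneric pairs *)

Section Bad.
Context {R : realType}.
Local Notation C := (Cplx R).
Implicit Types (p q f g : {poly C}).

Definition bad (n : nat) (B : {poly C} -> {poly C} -> Prop) : Prop :=
  exists Phi : mpoly (2 * n + 1).+1 C, [/\ Phi != 0,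
    exists d, Phi \is ishomog1 d (@mdeg (2 * n + 1).+1) &
    forall p q, (size p <= n.+1)%N -> (size q <= n.+1)%N -> B p q ->
      meval (fun i => coef_row n p q 0 i) Phi = 0].

Lemma bad_sub n (A B : {poly C} -> {poly C} -> Prop) :
  bad n B -> (forall p q, A p q -> B p q) -> bad n A.
Proof.
by move=> [P [P0 hd hP]] AB; exists P; split=> // p q hp hq /AB; exact: hP.
Qed.

Lemma badU n (A B : {poly C} -> {poly C} -> Prop) :
  bad n A -> bad n B -> bad n (fun p q => A p q \/ B p q).
Proof.
move=> [P [P0 [d hd] hP]] [Q [Q0 [e he] hQ]]; exists (P * Q); split.
- exact: mulf_neq0.
- by exists (d + e)%N; exact: dhomogM.
- move=> p q sp sq [/hP h|/hQ h].
    by rewrite mevalM h// mul0r.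
  by rewrite mevalM [X in _ * X]h// mulr0.
Qed.

Lemma bad_cone n (A : {poly C} -> {poly C} -> Prop)
    (B : ('I_(2 * n + 1).+1 -> C) -> Prop) :
  thin B -> (forall v a, B v -> B (fun i => a * v i)) ->
  (forall p q, (size p <= n.+1)%N -> (size q <= n.+1)%N -> A p q ->
    B (fun i => coef_row n p q 0 i)) -> bad n A.
Proof.
move=> tB cB AB; have [P [P0 hd hP]] := thin_cone tB cB.
by exists P; split=> // p q sp sq /(AB _ _ sp sq)/hP.
Qed.

(** Linear conditions on (p, q) are stored as coefficient rows as well, so that a matrix of
    conditions acts through this pairing. *)
Lemma coef_row_dot n (A B : {poly C}) p q :
  \sum_i coef_row n A B 0 i * coef_row n p q 0 i =
  \sum_(j < n.+1) A`_j * p`_j + \sum_(j < n.+1) B`_j * q`_j.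
Proof.
pose h i := if (i <= n)%N then A`_(n - i) * p`_(n - i)
            else B`_(2 * n + 1 - i) * q`_(2 * n + 1 - i).
transitivity (\sum_(i < (2 * n + 1).+1) h i).
  by apply: eq_bigr => i _; rewrite !mxE /h; case: ifP.
rewrite -(big_mkord xpredT h) (@big_cat_nat _ _ _ n.+1)//=; last by clear; lia.
congr (_ + _).
  rewrite big_mkord (reindex_inj rev_ord_inj) /=; apply: eq_bigr => i _.
  by rewrite /h subSS leq_subr subKn// -ltnS.
have -> : (2 * n + 1).+1 = (n.+1 + n.+1)%N by clear; lia.
rewrite -{1}[n.+1]add0n big_addn addnK big_mkord (reindex_inj rev_ord_inj) /=.
apply: eq_bigr => i _; rewrite /h.
have -> : (n.+1 - i.+1 + n.+1 <= n)%N = false by apply/negP; clear; lia.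
have -> // : (2 * n + 1 - (n.+1 - i.+1 + n.+1) = i)%N.
by have := ltn_ord i; clear; lia.
Qed.

(** Its coefficients are those of the linear functional p -> p^(r)(x). For j < r the falling
    factorial is 0, so the truncated subtraction [j - r] does no harm. *)
Definition eval_poly (n r : nat) (x : C) : {poly C} :=
  \poly_(j < n.+1) (x ^+ (j - r) *+ (j ^_ r)).

Lemma eval_polyP n r x p : (size p <= n.+1)%N ->
  p^`(r).[x] = \sum_(j < n.+1) (eval_poly n r x)`_j * p`_j.
Proof.
move=> sp; rewrite [in LHS](_ : p = \sum_(j < n.+1) p`_j *: 'X^j); last first.
  rewrite -poly_def; apply/polyP => i; rewrite coef_poly; case: ifP => // /negbT.
  by rewrite -leqNgt => h; rewrite nth_default// (leq_trans sp).
rewrite raddf_sum horner_sum; apply: eq_bigr => j _ /=.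
by rewrite derivnZ derivnXn coef_poly ltn_ord !hornerE hornerMn hornerXn mulrC.
Qed.

(* Dimension count: the linear conditions outnumber the parameters. The premise
   on [u] is their linear independence at the parameter [t]. *)
Lemma bad_eval (n m : nat) (I : finType) (al be x : I -> ('I_m -> C) -> C)
    (r : I -> nat) : (m < #|I|)%N -> (#|I| <= (2 * n + 1).+1)%N ->
  (forall i, [/\ polyfun (al i), polyfun (be i) & polyfun (x i)]) ->
  bad n (fun p q => exists t : 'I_m -> C,
    (forall u : I -> C, (forall f g, (size f <= n.+1)%N -> (size g <= n.+1)%N ->
        \sum_i u i * (al i t * f^`(r i).[x i t] + be i t * g^`(r i).[x i t]) = 0)
      -> forall i, u i = 0) /\
    forall i, al i t * p^`(r i).[x i t] + be i t * q^`(r i).[x i t] = 0).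
Proof.
move=> mI IN hpoly; pose E i t := eval_poly n (r i) (x i t).
pose M t : 'M[C]_(#|I|, (2 * n + 1).+1) := \matrix_(i, j)
  coef_row n (al (enum_val i) t *: E (enum_val i) t)
    (be (enum_val i) t *: E (enum_val i) t) 0 j.
have dotM i t p q : (size p <= n.+1)%N -> (size q <= n.+1)%N ->
    \sum_j M t i j * coef_row n p q 0 j =
    al (enum_val i) t * p^`(r (enum_val i)).[x (enum_val i) t] +
    be (enum_val i) t * q^`(r (enum_val i)).[x (enum_val i) t].
  move=> sp sq; rewrite !(@eval_polyP n)//.
  under eq_bigr do rewrite mxE.
  rewrite coef_row_dot; congr (_ + _); rewrite mulr_sumr; apply: eq_bigr => j _.
    by rewrite coefZ mulrA.
  by rewrite coefZ mulrA.
have pE i j : polyfun (fun t => (E i t)`_j).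
  have -> : (fun t => (E i t)`_j) =
      (fun t => (if (j < n.+1)%N then (j ^_ (r i))%:R else 0) * x i t ^+ (j - r i)).
    apply/funext => t; rewrite coef_poly; case: ifP => _; last by rewrite mul0r.
    by rewrite mulr_natl.
  apply: polyfunM; first exact: polyfun_cst.
  by apply: polyfunX; have [] := hpoly i.
have hM i j : polyfun (fun t => M t i j).
  have [h1 h2 _] := hpoly (enum_val i).
  have [jn|jn] := boolP (j <= n)%N.
    have -> : (fun t => M t i j) =
        (fun t => al (enum_val i) t * (E (enum_val i) t)`_(n - j)).
      by apply/funext => t; rewrite !mxE jn coefZ.
    exact: polyfunM.
  have -> : (fun t => M t i j) =
      (fun t => be (enum_val i) t * (E (enum_val i) t)`_(2 * n + 1 - j)).
    by apply/funext => t; rewrite !mxE (negbTE jn) coefZ.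
  exact: polyfunM.
have tB : thin (fun v => exists t, row_free (M t) /\ M t *m (\col_i v i) = 0).
  (* The number of columns is cast to the shape #|I| + k required by [thin_kernel]. *)
  clear -mI IN hM; move: (subnKC IN) M hM; move: (_ - _)%N => k.
  by case: _ / => M hM; exact: thin_kernel.
apply: (bad_cone tB).
  move=> v a [t [h1 h2]]; exists t; split=> //.
  have -> : \col_i (a * v i) = a *: \col_i v i by apply/colP => i; rewrite !mxE.
  by rewrite -scalemxAr h2 scaler0.
move=> p q sp sq [t [free zero]]; exists t; split.
  apply: row_free_ker => u uM; apply/rowP => i; rewrite [RHS]mxE -(enum_valK i).
  apply: (free (fun i => u 0 (enum_rank i))) => f g sf sg.
  transitivity ((u *m M t *m (\col_j coef_row n f g 0 j)) 0 0); last first.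
    by rewrite uM mul0mx mxE.
  rewrite -mulmxA mxE [LHS](reindex (enum_val : 'I_#|I| -> I)) /=; last first.
    exact: onW_bij (enum_val_bij _).
  apply: eq_bigr => j _; rewrite enum_valK -dotM// mxE; congr (_ * _).
  by apply: eq_bigr => l _; rewrite [X in _ = _ * X]mxE.
apply/colP => i; rewrite [RHS]mxE -(zero (enum_val i)) -dotM// mxE.
by apply: eq_bigr => l _; rewrite [X in _ * X = _]mxE.
Qed.
End Bad.

(** * Independence of double-zero conditions *)

Section Nodes.
Context {R : realType}.
Local Notation C := (Cplx R).
Implicit Types (p q f g : {poly C}) (x v a b : C).

(** A combination of the two conditions for f - v g to have a double zero at x. *)
Definition double_fun (f g : {poly C}) (x v a b : C) : C :=
  a * (f.[x] - v * g.[x]) + b * (f^`().[x] - v * g^`().[x]).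

(* Taking (f, g) = (v_j r, r) removes the j-th node; r then has double zeros
   at two of the other nodes. *)
Lemma four_nodes_free n (x0 x1 x2 x3 v0 v1 v2 v3 a0 a1 a2 a3 b0 b1 b2 b3 : C) :
  (4 <= n)%N -> x0 != x1 -> x0 != x2 -> x0 != x3 -> x1 != x2 ->
  v0 != v1 -> v0 != v2 ->
  (forall f g, (size f <= n.+1)%N -> (size g <= n.+1)%N ->
     double_fun f g x0 v0 a0 b0 + double_fun f g x1 v1 a1 b1 +
     double_fun f g x2 v2 a2 b2 + double_fun f g x3 v3 a3 b3 = 0) ->
  a0 = 0 /\ b0 = 0.
Proof.
move=> n4 x01 x02 x03 x12 v01 v02 h.
(* These test polynomials have degree 4 and fit because 4 <= n. *)
pose r (u w : C) : {poly C} := (('X - u%:P) * ('X - w%:P)) ^+ 2.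
have sr (u w c : C) : (size (c *: r u w) <= n.+1)%N.
  apply: leq_trans (size_scale_leq _ _) _.
  rewrite /r exprMn.
  apply: leq_trans (size_polyMleq _ _) _.
  by rewrite !size_exp_XsubC; clear -n4; lia.
have E (u w z : C) : (r u w).[z] = ((z - u) * (z - w)) ^+ 2.
  by rewrite /r !hornerE.
have E' (u w z : C) : (r u w)^`().[z] = 2 * ((z - u) * (z - w)) * ((z - u) + (z - w)).
  rewrite /r expr2 !derivM !derivXsubC !hornerE /=; ring.
have h1 : a0 * ((x0 - x2) * (x0 - x3)) + 2 * b0 * ((x0 - x2) + (x0 - x3)) = 0.
  have := h (v1 *: r x2 x3) (1 *: r x2 x3) (sr _ _ _) (sr _ _ _).
  rewrite /double_fun !derivZ !hornerZ !E !E' => e.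
  have k : (v1 - v0) * ((x0 - x2) * (x0 - x3)) != 0.
    by rewrite !mulf_neq0// subr_eq0// eq_sym.
  by apply: (mulfI k); rewrite mulr0 -[RHS]e; ring.
have h2 : a0 * ((x0 - x1) * (x0 - x3)) + 2 * b0 * ((x0 - x1) + (x0 - x3)) = 0.
  have := h (v2 *: r x1 x3) (1 *: r x1 x3) (sr _ _ _) (sr _ _ _).
  rewrite /double_fun !derivZ !hornerZ !E !E' => e.
  have k : (v2 - v0) * ((x0 - x1) * (x0 - x3)) != 0.
    by rewrite !mulf_neq0// subr_eq0// eq_sym.
  by apply: (mulfI k); rewrite mulr0 -[RHS]e; ring.
(* Eliminating a0 between [h1] and [h2] leaves 2 (x0 - x3) (x2 - x1) b0 = 0. *)
have b00 : b0 = 0.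
  have k : 2 * (x0 - x3) * (x2 - x1) != 0.
    by rewrite !mulf_neq0 ?pnatr_eq0// subr_eq0// eq_sym.
  apply: (mulfI k); rewrite mulr0.
  transitivity ((x0 - x1) * (a0 * ((x0 - x2) * (x0 - x3)) + 2 * b0 * ((x0 - x2) + (x0 - x3)))
    - (x0 - x2) * (a0 * ((x0 - x1) * (x0 - x3)) + 2 * b0 * ((x0 - x1) + (x0 - x3)))).
    ring.
  by rewrite h1 h2 !mulr0 subr0.
split=> //; have k : (x0 - x2) * (x0 - x3) != 0.
  by rewrite mulf_neq0// subr_eq0.
by apply: (mulIf k); rewrite mul0r -h1 b00; ring.
Qed.

Lemma fresh_shift (s : seq C) : exists y : C, forall i j, (i < size s)%N -> (j < 4)%N ->
  nth 0 s i != y + j%:R.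
Proof.
pose P : {poly C} := \prod_(z <- s) \prod_(j < 4) ('X + (j%:R - z)%:P).
have P0 : P != 0.
  rewrite /P prodf_seq_neq0; apply/allP => z _ /=; apply/prodf_neq0 => j _.
  by rewrite -size_poly_eq0 size_XaddC.
have /existsNP[y Py] : ~ forall y, P.[y] = 0.
  by move=> /poly_fun0 e; rewrite e eqxx in P0.
exists y => i j si j4; apply/eqP => e; apply: Py.
rewrite horner_prod (big_nth 0) big_mkord (bigD1 (Ordinal si))//= horner_prod.
rewrite (bigD1 (Ordinal j4))//= hornerD hornerX hornerC e.
by rewrite opprD addrCA addNKr subrr !mul0r.
Qed.

Lemma inj_extend (s : nat) (x : nat -> C) : (s <= 4)%N ->
  (forall i j, (i < s)%N -> (j < s)%N -> x i = x j -> i = j) ->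
  exists x' : nat -> C, (forall i, (i < s)%N -> x' i = x i) /\
    forall i j, (i < 4)%N -> (j < 4)%N -> i != j -> x' i != x' j.
Proof.
move=> s4 xI; have [y hy] := fresh_shift (mkseq x s).
have {}hy i j : (i < s)%N -> (j < 4)%N -> x i != y + j%:R.
  by move=> si j4; have := hy i j; rewrite size_mkseq nth_mkseq//; exact.
exists (fun i => if (i < s)%N then x i else y + i%:R); split; first by move=> i ->.
move=> i j i4 j4 ij; case: ifP => si; case: ifP => sj.
- by apply: contra_neq ij; exact: xI.
- exact: hy.
- by rewrite eq_sym; exact: hy.
- by rewrite (inj_eq (addrI _)) eqr_nat.
Qed.

(** Missing nodes are replaced by fresh distinct nodes and values with zero coefficients, so only
    the case of four nodes has to be computed. *)
Lemma nodes_free n s (x v a b : nat -> C) : (4 <= n)%N -> (s <= 4)%N ->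
  (forall i j, (i < s)%N -> (j < s)%N -> x i = x j -> i = j) ->
  (forall i j, (i < s)%N -> (j < s)%N -> v i = v j -> i = j) ->
  (forall f g, (size f <= n.+1)%N -> (size g <= n.+1)%N ->
     \sum_(i < s) double_fun f g (x i) (v i) (a i) (b i) = 0) ->
  forall i, (i < s)%N -> a i = 0 /\ b i = 0.
Proof.
move=> n4 s4 /(inj_extend s4)[X [eX IX]] /(inj_extend s4)[V [eV IV]] h.
pose A i := if (i < s)%N then a i else 0; pose B i := if (i < s)%N then b i else 0.
have H f g : (size f <= n.+1)%N -> (size g <= n.+1)%N ->
    \sum_(i < 4) double_fun f g (X i) (V i) (A i) (B i) = 0.
  move=> sf sg; apply: etrans (h _ _ sf sg).
  rewrite -(big_mkord xpredT (fun i => double_fun f g (X i) (V i) (A i) (B i))).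
  rewrite (@big_cat_nat _ _ _ s)//= [X in _ + X]big_nat [X in _ + X]big1.
    rewrite addr0 big_mkord; apply: eq_bigr => i _.
    by rewrite /A /B ltn_ord eX// eV.
  by move=> i /andP[si _]; rewrite /A /B ltnNge si /double_fun !mul0r addr0.
have {}H f g sf sg := H f g sf sg.
rewrite /= in H.
have D i : (i < 4)%N -> A i = 0 /\ B i = 0.
  have ne k l : (k < 4)%N -> (l < 4)%N -> k != l -> X k != X l /\ V k != V l.
    by move=> k4 l4 kl; split; [exact: IX|exact: IV].
  have K f g : (size f <= n.+1)%N -> (size g <= n.+1)%N ->
      double_fun f g (X 0) (V 0) (A 0) (B 0) + double_fun f g (X 1) (V 1) (A 1) (B 1) +
      double_fun f g (X 2) (V 2) (A 2) (B 2) + double_fun f g (X 3) (V 3) (A 3) (B 3) = 0.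
    by move=> sf sg; have := H f g sf sg; rewrite !big_ord_recr big_ord0 /= add0r.
  case: i => [|[|[|[|//]]]] _.
  - apply: (four_nodes_free n4 (ne 0 1 isT isT isT).1 (ne 0 2 isT isT isT).1 (ne 0 3 isT isT isT).1
      (ne 1 2 isT isT isT).1 (ne 0 1 isT isT isT).2 (ne 0 2 isT isT isT).2) => f g sf sg.
    by rewrite -[RHS](K f g sf sg); ring.
  - apply: (four_nodes_free n4 (ne 1 0 isT isT isT).1 (ne 1 2 isT isT isT).1 (ne 1 3 isT isT isT).1
      (ne 0 2 isT isT isT).1 (ne 1 0 isT isT isT).2 (ne 1 2 isT isT isT).2) => f g sf sg.
    by rewrite -[RHS](K f g sf sg); ring.
  - apply: (four_nodes_free n4 (ne 2 0 isT isT isT).1 (ne 2 1 isT isT isT).1 (ne 2 3 isT isT isT).1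
      (ne 0 1 isT isT isT).1 (ne 2 0 isT isT isT).2 (ne 2 1 isT isT isT).2) => f g sf sg.
    by rewrite -[RHS](K f g sf sg); ring.
  - apply: (four_nodes_free n4 (ne 3 0 isT isT isT).1 (ne 3 1 isT isT isT).1 (ne 3 2 isT isT isT).1
      (ne 0 1 isT isT isT).1 (ne 3 0 isT isT isT).2 (ne 3 1 isT isT isT).2) => f g sf sg.
    by rewrite -[RHS](K f g sf sg); ring.
by move=> i si; have := D i (leq_trans si s4); rewrite /A /B si.
Qed.
End Nodes.

(** * Counting conditions and parameters *)

Section Conditions.
Context {R : realType}.
Local Notation C := (Cplx R).
Implicit Types (p q f g : {poly C}) (x v c w : C).

Definition par (m : nat) (t : 'I_m -> C) (k : nat) : C :=
  if insub k is Some i then t i else 0.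

Lemma polyfun_par (m k : nat) : polyfun (fun t : 'I_m -> C => par t k).
Proof.
rewrite /par; case: insub => [i|]; first exact: polyfun_var.
exact: polyfun_cst.
Qed.

Lemma par_nth (m : nat) (s : seq C) (k : nat) : (size s <= m)%N ->
  par (fun i : 'I_m => nth 0 s i) k = nth 0 s k.
Proof.
move=> sm; rewrite /par; case: insubP => [i _ <-//|]; rewrite -leqNgt => mk.
by rewrite nth_default// (leq_trans sm).
Qed.

Lemma size_le_small n (k : nat) f : (4 <= n)%N -> (size f <= k)%N ->
  (k <= 4)%N -> (size f <= n.+1)%N.
Proof.
by move=> n4 fk k4; apply: leq_trans fk _; clear -n4 k4; lia.
Qed.

Lemma sum_pair_bool (I : finType) (G : I * bool -> C) :
  \sum_i G i = \sum_i (G (i, false) + G (i, true)).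
Proof.
rewrite (eq_bigr (fun k => G (k.1, k.2))) => [|[]//].
rewrite -(pair_bigA _ (fun i b => G (i, b))); apply: eq_bigr => i _.
by rewrite big_bool addrC.
Qed.

Lemma bad_common_root n : (4 <= n)%N ->
  bad n (fun p q => exists x, p.[x] = 0 /\ q.[x] = 0).
Proof.
move=> n4.
pose al (i : bool) (_ : 'I_1 -> C) : C := (~~ i)%:R.
pose be (i : bool) (_ : 'I_1 -> C) : C := i%:R.
pose x (i : bool) (t : 'I_1 -> C) : C := par t 0.
have h := @bad_eval R n 1 bool al be x (fun=> 0%N).
apply: (bad_sub (h _ _ _)).
- by rewrite card_bool.
- by rewrite card_bool; clear; lia.
- by move=> i; split; [exact: polyfun_cst|exact: polyfun_cst|exact: polyfun_par].
move=> p q [z [pz qz]]; exists (fun i => nth 0 [:: z] i); split=> [u hu|i].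
  have s1 : (size (1%:P%R : {poly C}) <= n.+1)%N by rewrite size_polyC oner_eq0.
  have s0 : (size (0%R : {poly C}) <= n.+1)%N by rewrite size_poly0.
  case; [have := hu _ _ s0 s1|have := hu _ _ s1 s0];
    by rewrite big_bool /al /be /= ?derivn0 hornerC horner0 !(mul0r, mulr0, mulr1, mul1r, addr0, add0r).
by rewrite /x par_nth// ?derivn0 /= pz qz !mulr0 addr0.
Qed.

Lemma bad_double_root n (b : bool) : (4 <= n)%N ->
  bad n (fun p q => let f := if b then p else q in
    exists x, f.[x] = 0 /\ f^`().[x] = 0).
Proof.
move=> n4.
pose al (i : bool) (_ : 'I_1 -> C) : C := b%:R.
pose be (i : bool) (_ : 'I_1 -> C) : C := (~~ b)%:R.
pose x (i : bool) (t : 'I_1 -> C) : C := par t 0.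
have h := @bad_eval R n 1 bool al be x nat_of_bool.
apply: (bad_sub (h _ _ _)).
- by rewrite card_bool.
- by rewrite card_bool; clear; lia.
- by move=> i; split; [exact: polyfun_cst|exact: polyfun_cst|exact: polyfun_par].
move=> p q [z [pz qz]]; exists (fun i => nth 0 [:: z] i); split=> [u hu|i].
  have s1 : (size (1%:P%R : {poly C}) <= n.+1)%N by rewrite size_polyC oner_eq0.
  have sX : (size (('X - z%:P)%R : {poly C}) <= n.+1)%N by rewrite size_XsubC; clear -n4; lia.
  have := hu _ _ sX sX; have := hu _ _ s1 s1.
  rewrite !big_bool /al /be /x par_nth//= ?derivn0 ?derivn1 !derivXsubC derivC.
  rewrite !hornerXsubC !hornerC ?horner0 subrr !(mul0r, mulr0, mulr1, mul1r, addr0, add0r) => e1 e2.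
  have k : b%:R + (~~ b)%:R = 1 :> C by case: (b); rewrite ?addr0 ?add0r.
  rewrite k !mulr1 in e1 e2.
  by case.
rewrite /x par_nth// /al /be; case: (b) i pz qz => [] [] /=;
  by rewrite ?derivn0 ?derivn1 => h0 h1; rewrite ?h0 ?h1 ?mul0r ?mulr0 ?add0r ?addr0.
Qed.

(** A multiple root of W leads to such a triple zero of p - v q. Three conditions face the two
    parameters v and x. *)
Lemma bad_triple n : (4 <= n)%N ->
  bad n (fun p q => exists v x, forall r, (r < 3)%N -> p^`(r).[x] = v * q^`(r).[x]).
Proof.
move=> n4.
pose al (i : 'I_3) (_ : 'I_2 -> C) : C := 1.
pose be (i : 'I_3) (t : 'I_2 -> C) : C := - par t 0.
pose x (i : 'I_3) (t : 'I_2 -> C) : C := par t 1.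
have h := @bad_eval R n 2 _ al be x (fun i => i : nat).
apply: (bad_sub (h _ _ _)).
- by rewrite card_ord.
- by rewrite card_ord; clear -n4; lia.
- by move=> i; split; [exact: polyfun_cst|apply: polyfunN; exact: polyfun_par|exact: polyfun_par].
move=> p q [v [z pq]]; exists (fun i => nth 0 [:: v; z] i); split=> [u hu|i]; last first.
  by rewrite /al /be /x !par_nth//= pq// mul1r mulNr subrr.
have s0 : (size (0%R : {poly C}) <= n.+1)%N by rewrite size_poly0.
pose U k := u (inord k).
have E f : (size f <= n.+1)%N ->
    U 0 * f.[z] + (U 1 * f^`().[z] + U 2 * f^`()^`().[z]) = 0.
  move=> sf; apply: etrans (hu f 0 sf s0).
  rewrite 3!big_ord_recl big_ord0 addr0 /al /be /x !par_nth//.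
  rewrite !linear0 !horner0 !mulr0 !addr0 !mul1r /U.
  by congr (u _ * _ + (u _ * _ + u _ * _)); apply/val_inj; rewrite /= inordK.
have u0 : U 0 = 0.
  have s1 : (size (1%:P%R : {poly C}) <= n.+1)%N by rewrite size_polyC oner_eq0.
  have := E _ s1; rewrite derivC deriv0 hornerC horner0 !mulr0 !addr0 mulr1.
  exact.
have u1 : U 1 = 0.
  have sX : (size ('X - z%:P)%R <= n.+1)%N by rewrite size_XsubC; clear -n4; lia.
  have := E _ sX; rewrite derivXsubC derivC hornerC horner0 u0 mul0r mulr0 mulr1.
  by rewrite add0r addr0.
have u2 : U 2 = 0.
  have sX : (size (('X - z%:P) * ('X - z%:P))%R <= n.+1)%N.
    by rewrite -expr2 size_exp_XsubC; clear -n4; lia.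
  have := E _ sX; rewrite derivM derivXsubC mul1r mulr1 derivD derivXsubC u0 u1.
  rewrite !mul0r !add0r hornerD hornerC => e.
  have k : (1 + 1 : C) != 0 by rewrite -[1 + 1]/(2%:R) pnatr_eq0.
  by apply: (mulIf k); rewrite mul0r.
move=> i; rewrite -(inord_val i); case: i => -[|[|[|//]]] hi.
- exact: u0.
- exact: u1.
- exact: u2.
Qed.

(** p - v q has a double zero at x: x is a critical point of p / q with value v, expressed without
    division. *)
Definition contact p q (x v : C) : Prop :=
  p.[x] = v * q.[x] /\ p^`().[x] = v * q^`().[x].

Lemma contactP p q x v (b : bool) : contact p q x v ->
  1 * p^`(b).[x] + - v * q^`(b).[x] = 0.
Proof.
by move=> [h0 h1]; case: b; rewrite ?derivn0 ?derivn1 ?h0 ?h1 mul1r mulNr subrr.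
Qed.

(** [nodes_free] relies on distinct values and does not apply. Testing with g = 0 and f of degree at
    most 3 suffices: four conditions, three parameters. *)
Lemma bad_same_value n : (4 <= n)%N ->
  bad n (fun p q => exists v x y, [/\ x != y, contact p q x v & contact p q y v]).
Proof.
move=> n4.
pose al (i : 'I_2 * bool) (_ : 'I_3 -> C) : C := 1.
pose be (i : 'I_2 * bool) (t : 'I_3 -> C) : C := - par t 2.
pose x (i : 'I_2 * bool) (t : 'I_3 -> C) : C := par t i.1.
have h := @bad_eval R n 3 _ al be x (fun i => i.2 : nat).
apply: (bad_sub (h _ _ _)).
- by rewrite card_prod card_ord card_bool.
- by rewrite card_prod card_ord card_bool; clear -n4; lia.
- by move=> i; split; [exact: polyfun_cst|apply: polyfunN; exact: polyfun_par|exact: polyfun_par].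
move=> p q [v [a [b [ab ha hb]]]]; exists (fun i => nth 0 [:: a; b; v] i).
have ex (i : 'I_2 * bool) : x i (fun i => nth 0 [:: a; b; v] i) = nth 0 [:: a; b] i.1.
  by rewrite /x par_nth//; case: i => -[[|[|//]] ?] ?.
split=> [u hu|i]; last first.
  rewrite ex /al /be par_nth//=; apply: contactP.
  by case: i => -[[|[|//]] ?] ?.
have s0 : (size (0%R : {poly C}) <= n.+1)%N by rewrite size_poly0.
pose U i b : C := u (inord i, b).
have E f : (size f <= n.+1)%N -> U 0 false * f.[a] + U 0 true * f^`().[a] +
    (U 1 false * f.[b] + U 1 true * f^`().[b]) = 0.
  move=> sf; apply: etrans (hu f 0 sf s0).
  rewrite sum_pair_bool 2!big_ord_recl big_ord0 addr0 !ex /al /be.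
  rewrite !linear0 !horner0 !mulr0 !addr0 !mul1r /U.
  have -> : inord 0 = ord0 :> 'I_2 by apply/val_inj; rewrite /= inordK.
  have -> : inord 1 = lift ord0 ord0 :> 'I_2 by apply/val_inj; rewrite /= inordK.
  by [].
have key (c d : C) (A A' B B' : C) : c != d ->
    (forall f, (size f <= n.+1)%N -> A * f.[c] + A' * f^`().[c] +
      (B * f.[d] + B' * f^`().[d]) = 0) -> A = 0 /\ A' = 0.
  move=> cd H; pose g : {poly C} := ('X - d%:P) * ('X - d%:P).
  have cd0 : c - d != 0 by rewrite subr_eq0.
  have sg : (size g <= 4)%N by rewrite /g -expr2 size_exp_XsubC.
  have sgX : (size (g * ('X - c%:P))%R <= 4)%N.
    by apply: leq_trans (size_polyMleq _ _) _; rewrite size_XsubC /g -expr2 size_exp_XsubC.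
  have := H _ (size_le_small n4 sg isT); have := H _ (size_le_small n4 sgX isT).
  have gE (z : C) : g.[z] = (z - d) * (z - d) by rewrite hornerM hornerXsubC.
  have g'E (z : C) : g^`().[z] = (z - d) + (z - d).
    by rewrite derivM derivXsubC mul1r mulr1 hornerD hornerXsubC.
  clearbody g; rewrite derivM derivXsubC mulr1 !hornerD !hornerM !hornerXsubC !gE !g'E !subrr => e1 e2.
  have A'0 : A' = 0.
    by apply: (mulIf (mulf_neq0 cd0 cd0)); rewrite mul0r -[RHS]e1; ring.
  split=> //; apply: (mulIf (mulf_neq0 cd0 cd0)); rewrite mul0r -[RHS]e2 A'0; ring.
have [a0 a1] := key _ _ _ _ _ _ ab E.
have [b0 b1] : U 1 false = 0 /\ U 1 true = 0.
  apply: (key b a _ _ (U 0 false) (U 0 true)); first by rewrite eq_sym.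
  by move=> f /E e; rewrite addrC.
move=> [i c]; have : U i c = 0.
  by case: i => -[|[|//]] ? /=; case: c.
by rewrite /U inord_val.
Qed.

(** The list [t] starts with the s nodes and continues with the parameters from which [vals]
    computes the s values: 2 s conditions against m parameters. *)
Lemma bad_nodes n s m (vals : seq C -> seq C) : (4 <= n)%N -> (s <= 4)%N ->
  (m < s * 2)%N -> (s <= m)%N ->
  (forall i, (i < s)%N -> polyfun (fun t : 'I_m -> C => nth 0 (vals (mkseq (par t) m)) i)) ->
  bad n (fun p q => exists t, [/\ size t = m, uniq (take s t),
    uniq (vals t) /\ size (vals t) = s &
    forall i, (i < s)%N -> contact p q (nth 0 t i) (nth 0 (vals t) i)]).
Proof.
move=> n4 s4 ms sm pv.
pose al (i : 'I_s * bool) (_ : 'I_m -> C) : C := 1.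
pose be (i : 'I_s * bool) (t : 'I_m -> C) : C := - nth 0 (vals (mkseq (par t) m)) i.1.
pose x (i : 'I_s * bool) (t : 'I_m -> C) : C := par t i.1.
have h := @bad_eval R n m _ al be x (fun i => i.2 : nat).
apply: (bad_sub (h _ _ _)).
- by rewrite card_prod card_ord card_bool.
- by rewrite card_prod card_ord card_bool; clear -n4 s4; lia.
- move=> i; split; [exact: polyfun_cst|apply: polyfunN; exact: pv|exact: polyfun_par].
move=> p q [t [st ut [uv sv] ht]]; exists (fun i => nth 0 t i).
have tE : mkseq (par (fun i : 'I_m => nth 0 t i)) m = t.
  apply: (@eq_from_nth _ 0); rewrite size_mkseq// => i im.
  by rewrite nth_mkseq// par_nth// st.
have ex i : x i (fun i => nth 0 t i) = nth 0 t i.1 by rewrite /x par_nth// st.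
have ev i : be i (fun i => nth 0 t i) = - nth 0 (vals t) i.1 by rewrite /be tE.
split=> [u hu|i]; last by rewrite ex ev; apply: contactP; exact: ht.
pose a b k : C := if insub k is Some j then u (j, b) else 0.
have aE b (j : 'I_s) : a b j = u (j, b) by rewrite /a valK.
have sm' : s = size (take s t) by rewrite size_takel// st.
have xinj i j : (i < s)%N -> (j < s)%N -> nth 0 t i = nth 0 t j -> i = j.
  move=> si sj; rewrite -(nth_take 0 si) -(nth_take 0 sj) => /eqP.
  by rewrite nth_uniq// -?sm'// => /eqP.
have vinj i j : (i < s)%N -> (j < s)%N -> nth 0 (vals t) i = nth 0 (vals t) j -> i = j.
  by move=> si sj /eqP; rewrite nth_uniq// ?sv// => /eqP.
have H f g : (size f <= n.+1)%N -> (size g <= n.+1)%N -> \sum_(i < s)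
    double_fun f g (nth 0 t i) (nth 0 (vals t) i) (a false i) (a true i) = 0.
  move=> sf sg; apply: etrans (hu f g sf sg).
  rewrite sum_pair_bool; apply: eq_bigr => i _; rewrite !ex !ev !aE /al /double_fun.
  by rewrite !mul1r !mulNr.
move=> [i b]; have [h0 h1] := nodes_free n4 s4 xinj vinj H (ltn_ord i).
by case: b; rewrite -aE.
Qed.

(** The case c = -1, with singular points (x, y) and (y, x): four conditions, three parameters. *)
Lemma bad_two_nodes n : (4 <= n)%N -> bad n (fun p q => exists w x y,
  [/\ uniq [:: x; y], uniq [:: w; - w], contact p q x w & contact p q y (- w)]).
Proof.
move=> n4; apply: (bad_sub (@bad_nodes n 2 3 (fun t => [:: nth 0 t 2; - nth 0 t 2]) n4 isT isT isT _)).
  move=> [|[|//]] _ /=; first exact: polyfun_par.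
  by apply: polyfunN; exact: polyfun_par.
move=> p q [w [x [y [uxy uw hx hy]]]]; exists [:: x; y; w]; split=> //.
by case=> [|[|//]].
Qed.

(** Two singular points (y, x) and (z, y) of one curve with a common critical point: six conditions,
    five parameters. *)
Lemma bad_three_nodes n : (4 <= n)%N -> bad n (fun p q => exists c w x y z,
  [/\ uniq [:: x; y; z], uniq [:: w; c * w; c * (c * w)] &
    [/\ contact p q x w, contact p q y (c * w) & contact p q z (c * (c * w))]]).
Proof.
move=> n4; apply: (bad_sub (@bad_nodes n 3 5 (fun t => let w := nth 0 t 3 in
    let c := nth 0 t 4 in [:: w; c * w; c * (c * w)]) n4 isT isT isT _)).
  by move=> [|[|[|//]]] _ /=; rewrite ?[nth _ _ _]/=;
    do ?apply: polyfunM; exact: polyfun_par.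
move=> p q [c [w [x [y [z [uxy uw [hx hy hz]]]]]]]; exists [:: x; y; z; w; c]; split=> //.
by case=> [|[|[|//]]].
Qed.

(** Two singular points (x, y) and (x', y') of one curve without common critical point. Sharing c
    leaves seven parameters for eight conditions. *)
Lemma bad_four_nodes n : (4 <= n)%N -> bad n (fun p q => exists c w w' x y x' y',
  [/\ uniq [:: x; y; x'; y'], uniq [:: c * w; w; c * w'; w'],
    contact p q x (c * w) /\ contact p q y w &
    contact p q x' (c * w') /\ contact p q y' w']).
Proof.
move=> n4; apply: (bad_sub (@bad_nodes n 4 7 (fun t => let w := nth 0 t 4 in
    let w' := nth 0 t 5 in let c := nth 0 t 6 in [:: c * w; w; c * w'; w']) n4 isT isT isT _)).
  by move=> [|[|[|[|//]]]] _ /=; do ?apply: polyfunM; exact: polyfun_par.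
move=> p q [c [w [w' [x [y [x' [y' [uxy uw [hx hy] [hx' hy']]]]]]]]].
exists [:: x; y; x'; y'; w; w'; c]; split=> //.
by case=> [|[|[|[|//]]]].
Qed.

End Conditions.

(** * Conditions on leading coefficients; degree of the Wronskian *)

Section Generic.
Context {R : realType}.
Local Notation C := (Cplx R).
Implicit Types (p q f g : {poly C}) (x c w : C).

Lemma thin_zeros (N : nat) (G : ('I_N -> C) -> C) (v0 : 'I_N -> C) :
  polyfun G -> G v0 != 0 -> thin (fun v => G v = 0).
Proof.
move=> [P hP] G0; exists P; last by move=> v; rewrite hP.
by apply: contra_neq G0 => P0; rewrite hP P0 meval0.
Qed.

Lemma coef_row_l n p q (i : nat) : (i <= n)%N ->
  coef_row n p q 0 (inord i) = p`_(n - i).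
Proof. by move=> ni; rewrite mxE inordK ?ni//; clear -ni; lia. Qed.

Lemma coef_row_r n p q (i : nat) : (i <= n)%N ->
  coef_row n p q 0 (inord (n + i).+1) = q`_(n - i).
Proof.
move=> ni; rewrite mxE inordK; last by clear -ni; lia.
rewrite [(_ <= n)%N](_ : _ = false); last by apply/negP; clear; lia.
by congr nth; clear -ni; lia.
Qed.

Lemma bad_coord n (i : 'I_(2 * n + 1).+1) (A : {poly C} -> {poly C} -> Prop) :
  (forall p q, A p q -> coef_row n p q 0 i = 0) -> bad n A.
Proof.
move=> h; apply: (@bad_cone _ n _ (fun v => v i = 0)).
- apply: (@thin_zeros _ (fun v => v i) (fun=> 1)); first exact: polyfun_var.
  by rewrite oner_eq0.
- by move=> v a ->; rewrite mulr0.
- by move=> p q _ _ /h.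
Qed.

Lemma bad_lead n : bad n (fun p q => p`_n = 0 \/ q`_n = 0).
Proof.
apply: (@badU _ n (fun p q => p`_n = 0) (fun p q => q`_n = 0)).
  by apply: (bad_coord (i := inord 0)) => p q; rewrite coef_row_l// subn0.
by apply: (bad_coord (i := inord (n + 0).+1)) => p q; rewrite coef_row_r// subn0.
Qed.

(** The difference of the two sides is the coefficient of W in degree 2 n - 2; where it is nonzero,
    infinity is not a critical point of p / q. *)
Lemma bad_sublead n : (4 <= n)%N ->
  bad n (fun p q => p`_n * q`_(n - 1) = p`_(n - 1) * q`_n).
Proof.
move=> n4.
pose G (v : 'I_(2 * n + 1).+1 -> C) := v (inord 0) * v (inord (n + 1).+1) +
  - (v (inord 1) * v (inord (n + 0).+1)).
apply: (@bad_cone _ n _ (fun v => G v = 0)).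
- apply: (@thin_zeros _ G (fun i => ((i == 0%N :> nat) || (i == (n + 1).+1 :> nat))%:R)).
    by apply: polyfunD; [|apply: polyfunN]; apply: polyfunM; exact: polyfun_var.
  rewrite /G !inordK; try by clear -n4; lia.
  rewrite !eqxx orbT !mul1r [(1 == 0)%N || _](_ : _ = false); last by apply/negP; clear -n4; lia.
  by rewrite mul0r subr0 oner_eq0.
- move=> v a h; rewrite /G; transitivity (a ^+ 2 * G v); last by rewrite h mulr0.
  by rewrite /G; ring.
- move=> p q _ _ h; have n1 : (1 <= n)%N by clear -n4; lia.
  rewrite /G (coef_row_l _ _ (leq0n n)) (coef_row_l _ _ n1) (coef_row_r _ _ n1).
  by rewrite (coef_row_r _ _ (leq0n n)) !subn0 h subrr.
Qed.

Lemma coprimep_noroot p q : p != 0 ->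
  (forall x, p.[x] = 0 -> q.[x] = 0 -> False) -> coprimep p q.
Proof.
move=> p0 h; apply/negPn/negP => /closed_rootP[x].
by rewrite root_gcd => /andP[/eqP px /eqP qx]; exact: h px qx.
Qed.

Lemma coefM_top p q (i j : nat) : (size p <= i.+1)%N -> (size q <= j.+1)%N ->
  (p * q)`_(i + j) = p`_i * q`_j.
Proof.
move=> sp sq; have ij : (i < (i + j).+1)%N by clear; lia.
rewrite coefM (bigD1 (Ordinal ij))//= addKn big1 ?addr0// => k /negbTE ki.
have [ik|ik] := ltnP i k.
  by rewrite [X in X * _]nth_default ?mul0r// (leq_trans sp).
rewrite [X in _ * X]nth_default ?mulr0// (leq_trans sq)//.
have : (k : nat) != i by apply/eqP => e; move/eqP: ki; apply; apply/val_inj.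
by move=> /eqP; clear -ik; lia.
Qed.

Lemma size_deriv_le p (k : nat) : (size p <= k.+1)%N -> (size p^`() <= k)%N.
Proof.
by move=> /leq_sizeP h; apply/leq_sizeP => j kj; rewrite coef_deriv h// mul0rn.
Qed.

Lemma size_wronsk n p q : (4 <= n)%N -> (size p <= n.+1)%N -> (size q <= n.+1)%N ->
  p`_n != 0 -> p`_n * q`_(n - 1) != p`_(n - 1) * q`_n ->
  size (wronsk p q) = (2 * n - 2).+1.
Proof.
(* W is alternating, so q may be replaced by q - k p, of degree below n; the cancellation in degree
   2 n - 1 is thereby built in. *)
move=> n4 sp sq pn pq; pose k := q`_n / p`_n; pose s := q - k *: p.
have -> : wronsk p q = wronsk p s.
  rewrite /wronsk /s derivB derivZ -!mul_polyC.
  ring.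
have ss : (size s <= n)%N.
  apply/leq_sizeP => j; rewrite leq_eqVlt => /orP[/eqP <-|nj].
    by rewrite coefB coefZ /k divfK// subrr.
  by rewrite coefB coefZ !nth_default ?mulr0 ?subr0// (leq_trans _ nj).
have sn : p`_n * s`_(n - 1) != 0.
  rewrite coefB coefZ /k; apply: contra_neq pq => e.
  apply/eqP; rewrite -subr_eq0 -[X in _ == X]e; apply/eqP; field.
  exact: pn.
have sp' : (size p^`() <= n)%N by exact: size_deriv_le.
have ss' : (size s^`() <= n - 1)%N.
  by apply: size_deriv_le; apply: leq_trans ss _; clear -n4; lia.
have e1 : (p^`() * s)`_(2 * n - 2) = p^`()`_(n - 1) * s`_(n - 1).
  have -> : (2 * n - 2 = (n - 1) + (n - 1))%N by clear -n4; lia.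
  apply: coefM_top; first by apply: leq_trans sp' _; clear -n4; lia.
  by apply: leq_trans ss _; clear -n4; lia.
have e2 : (p * s^`())`_(2 * n - 2) = p`_n * s^`()`_(n - 2).
  have -> : (2 * n - 2 = n + (n - 2))%N by clear -n4; lia.
  apply: coefM_top; first by [].
  by apply: leq_trans ss' _; clear -n4; lia.
have W0 : (wronsk p s)`_(2 * n - 2) != 0.
  rewrite coefB e1 e2 !coef_deriv.
  have -> : (n - 1).+1 = n by clear -n4; lia.
  have -> : (n - 2).+1 = (n - 1)%N by clear -n4; lia.
  have en : n = (n - 1).+1 by clear -n4; lia.
  rewrite [X in _ *+ X * _ - _]en.
  have top (a b : C) m : a *+ m.+1 * b - a * (b *+ m) = a * b.
    by rewrite mulrSr mulrDl mulrnAl mulrnAr addrAC subrr add0r.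
  by rewrite top.
apply/eqP; rewrite eqn_leq; apply/andP; split; last first.
  by rewrite ltnNge; apply: contra W0 => h; rewrite nth_default.
apply: leq_trans (size_polyD _ _) _; rewrite size_polyN geq_max; apply/andP; split.
  apply: leq_trans (size_polyMleq _ _) _.
  by move: (size _) (size _) sp' ss => x y; clear -n4; lia.
apply: leq_trans (size_polyMleq _ _) _.
by move: (size _) (size _) sp ss' => x y; clear -n4; lia.
Qed.
End Generic.

(** * From nondegenerate to generic pairs, and the theorem *)

Section Final.
Context {R : realType}.
Local Notation C := (Cplx R).
Implicit Types (p q f g : {poly C}) (x v c w : C).

Definition degenerate (n : nat) (p q : {poly C}) : Prop :=
  (p`_n = 0 \/ q`_n = 0) \/ p`_n * q`_(n - 1) = p`_(n - 1) * q`_n \/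
  (exists x, p.[x] = 0 /\ q.[x] = 0) \/
  (exists x, p.[x] = 0 /\ p^`().[x] = 0) \/
  (exists x, q.[x] = 0 /\ q^`().[x] = 0) \/
  (exists v x, forall r, (r < 3)%N -> p^`(r).[x] = v * q^`(r).[x]) \/
  (exists v x y, [/\ x != y, contact p q x v & contact p q y v]) \/
  (exists w x y,
    [/\ uniq [:: x; y], uniq [:: w; - w], contact p q x w & contact p q y (- w)]) \/
  (exists c w x y z,
    [/\ uniq [:: x; y; z], uniq [:: w; c * w; c * (c * w)] &
    [/\ contact p q x w, contact p q y (c * w) & contact p q z (c * (c * w))]]) \/
  (exists c w w' x y x' y',
    [/\ uniq [:: x; y; x'; y'], uniq [:: c * w; w; c * w'; w'],
      contact p q x (c * w) /\ contact p q y w &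
      contact p q x' (c * w') /\ contact p q y' w']).

Lemma bad_degenerate n : (4 <= n)%N -> bad n (degenerate n).
Proof.
move=> n4; apply: badU; first exact: bad_lead.
apply: badU; first exact: bad_sublead.
apply: badU; first exact: bad_common_root.
apply: badU; first exact: (bad_double_root true n4).
apply: badU; first exact: (bad_double_root false n4).
apply: badU; first exact: bad_triple.
apply: badU; first exact: bad_same_value.
apply: badU; first exact: bad_two_nodes.
apply: badU; first exact: bad_three_nodes.
exact: bad_four_nodes.
Qed.

(** Roots of W are critical points with finite nonzero value V, and V is injective on them. Two
    singular points (a, b) and (a', b') satisfy V a = c V b and V a' = c V b'; according to whether
    a = b' and a' = b, they form one of the excluded configurations of two, three or four nodes. *)
Lemma nondegenerate_generic n p q : (4 <= n)%N ->
  (size p <= n.+1)%N -> (size q <= n.+1)%N -> ~ degenerate n p q ->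
  generic_pair n p q.
Proof.
rewrite /degenerate => n4 sp sq.
move=> /not_orP[h0 /not_orP[h1 /not_orP[hc /not_orP[hp /not_orP[hq]]]]].
move=> /not_orP[h3 /not_orP[hs /not_orP[k2 /not_orP[k3 k4]]]].
have /not_orP[/eqP pn /eqP qn] := h0.
have p0 : p != 0 by apply: contra_neq pn => ->; rewrite coef0.
have size_top (f : {poly C}) : (size f <= n.+1)%N -> f`_n != 0 -> size f = n.+1.
  move=> sf fn; apply/eqP; rewrite eqn_leq sf ltnNge; apply: contra fn => h.
  by rewrite nth_default.
have cpq : coprimep p q.
  by apply: coprimep_noroot => // x px qx; apply: hc; exists x.
have WE x : (wronsk p q).[x] = p^`().[x] * q.[x] - p.[x] * q^`().[x].
  by rewrite hornerD hornerN !hornerM.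
have q_neq0 x : root (wronsk p q) x -> q.[x] != 0.
  move=> /eqP; rewrite WE => W0; apply/eqP => qx; rewrite qx mulr0 sub0r in W0.
  have /eqP := W0; rewrite oppr_eq0 mulf_eq0 => /orP[/eqP px|/eqP qx'].
    by apply: hc; exists x.
  by apply: hq; exists x.
have p_neq0 x : root (wronsk p q) x -> p.[x] != 0.
  move=> /eqP; rewrite WE => W0; apply/eqP => px; rewrite px mul0r subr0 in W0.
  have /eqP := W0; rewrite mulf_eq0 => /orP[/eqP px'|/eqP qx].
    by apply: hp; exists x.
  by apply: hc; exists x.
pose V x := p.[x] / q.[x].
have V0 x : root (wronsk p q) x -> V x != 0.
  by move=> rx; rewrite mulf_neq0 ?invr_neq0 ?p_neq0 ?q_neq0.
have cV x : root (wronsk p q) x -> contact p q x (V x).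
  move=> rx; have qx := q_neq0 _ rx; split; first by rewrite /V divfK.
  move/eqP: rx; rewrite WE => /eqP; rewrite subr_eq0 => /eqP e.
  by apply: (mulIf qx); rewrite e /V mulrAC divfK.
have Vinj x y : root (wronsk p q) x -> root (wronsk p q) y -> V x = V y -> x = y.
  move=> rx ry exy; apply/eqP/negPn/negP => nxy; apply: hs.
  by exists (V x), x, y; split=> //; [exact: cV|rewrite exy; exact: cV].
have VE c x y : root (wronsk p q) x -> root (wronsk p q) y ->
    p.[x] * q.[y] = c * p.[y] * q.[x] -> V x = c * V y.
  move=> rx ry e; have qx := q_neq0 _ rx; have qy := q_neq0 _ ry.
  apply: (mulIf qx); apply: (mulIf qy).
  rewrite /V divfK// e; field; exact: qy.
have Vuniq (s : seq C) : (forall x, x \in s -> root (wronsk p q) x) ->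
    uniq (map V s) = uniq s.
  by move=> hs'; apply: map_inj_in_uniq => x y /hs' rx /hs' ry; exact: Vinj.
split.
- by split; apply: size_top.
- exact: cpq.
- split; first by apply: size_wronsk => //; apply/eqP.
  have W0 : wronsk p q != 0.
    by rewrite -size_poly_eq0 (size_wronsk n4 sp sq pn)//; apply/eqP.
  rewrite unlock; apply: (coprimep_noroot W0) => x Wx W'x.
  have rx : root (wronsk p q) x by apply/eqP.
  apply: h3; exists (V x), x; have [c0 c1] := cV _ rx; have qx := q_neq0 _ rx.
  case=> [_|[_|[_|//]]]; [exact: c0|exact: c1|].
  (* The terms p' q' cancel, so a multiple root of W gives p'' q = p q'' at x, the third condition
     of a triple zero. *)
  have W'E : (wronsk p q)^`().[x] =
      p^`()^`().[x] * q.[x] - p.[x] * q^`()^`().[x].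
    by rewrite /wronsk derivB !derivM hornerD hornerN !hornerD !hornerM; ring.
  rewrite -[p^`(2)]/(p^`()^`()) -[q^`(2)]/(q^`()^`()).
  move/eqP: W'x; rewrite W'E subr_eq0 => /eqP e.
  by apply: (mulIf qx); rewrite e /V mulrAC divfK.
- move=> a b ra rb e; apply: (Vinj a b ra rb); rewrite -[RHS]mul1r.
  by apply: VE => //; rewrite mul1r.
- move=> c c0 c1 a b a' b' ra rb ra' rb' e e'.
  have {}e := VE _ _ _ ra rb e; have {}e' := VE _ _ _ ra' rb' e'.
  have ab x y : root (wronsk p q) y -> V x = c * V y -> x != y.
    move=> ry exy; apply: contra_neq c1 => xy; rewrite xy in exy.
    by apply: (mulIf (V0 _ ry)); rewrite mul1r -exy.
  have nab := ab _ _ rb e; have nab' := ab _ _ rb' e'.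
  have aa_bb : (a == a') = (b == b').
    apply/eqP/eqP => [h|h].
      by apply: Vinj => //; apply: (mulfI c0); rewrite -e -e' h.
    by apply: Vinj => //; rewrite e e' h.
  have [eaa|naa] := eqVneq a a'.
    by split=> //; apply/eqP; rewrite -aa_bb eaa eqxx.
  have nbb : b != b' by rewrite -aa_bb naa.
  exfalso; have [eab|nab2] := eqVneq a b'; have [eba|nba2] := eqVneq a' b.
  + subst a' b'; apply: k2; exists (V b), b, a.
    (* Here V b = c V a and V a = c V b, so c^2 = 1. *)
    have cc : c = -1.
      have : (c - 1) * (c + 1) = 0.
        apply: (mulIf (V0 _ ra)); rewrite mul0r.
        transitivity (c * (c * V a) - V a); first by ring.
        by rewrite -e' -e subrr.
      by move/eqP; rewrite mulf_eq0 subr_eq0 (negbTE c1) /= addr_eq0 => /eqP.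
    have eV : V a = - V b by rewrite e cc mulN1r.
    rewrite -eV; split; [by rewrite /= inE eq_sym nab| |exact: cV|exact: cV].
    by rewrite (Vuniq [:: b; a]) /= ?inE ?[b == a]eq_sym ?nab// => x; rewrite !inE => /orP[] /eqP ->.
  + subst b'; apply: k3; exists c, (V b), b, a, a'.
    rewrite -e -e'; split; last by split; exact: cV.
      by rewrite /= !inE negb_or eq_sym nab [b == _]eq_sym nba2 naa.
    rewrite (Vuniq [:: b; a; a']).
      by rewrite /= !inE negb_or eq_sym nab [b == _]eq_sym nba2 naa.
    by move=> x; rewrite !inE => /or3P[] /eqP ->.
  + subst a'; apply: k3; exists c, (V b'), b', b, a.
    rewrite -e' -e; split; last by split; exact: cV.
      by rewrite /= !inE negb_or [b' == _]eq_sym nab' [b' == _]eq_sym nab2 eq_sym nab.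
    rewrite (Vuniq [:: b'; b; a]).
      by rewrite /= !inE negb_or [b' == _]eq_sym nab' [b' == _]eq_sym nab2 eq_sym nab.
    by move=> x; rewrite !inE => /or3P[] /eqP ->.
  + apply: k4; exists c, (V b), (V b'), a, b, a', b'.
    rewrite -e -e'; split; [| |by split; exact: cV|by split; exact: cV].
      by rewrite /= !inE !negb_or nab naa nab2 [b == _]eq_sym nba2 nbb nab'.
    rewrite (Vuniq [:: a; b; a'; b']).
      by rewrite /= !inE !negb_or nab naa nab2 [b == _]eq_sym nba2 nbb nab'.
    by move=> x; rewrite !inE => /or4P[] /eqP ->.
Qed.
End Final.

Lemma coef_row_neq0 (R : realType) (n : nat) (p q : {poly Cplx R}) :
  (size q <= n.+1)%N -> q != 0 -> coef_row n p q != 0.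
Proof.
move=> sq; apply: contra_neq => e; apply/polyP => i; rewrite coef0.
have [ni|ni] := ltnP n i; first by rewrite nth_default// (leq_trans sq).
have := congr1 (fun A : 'rV_(2 * n + 1).+1 => A 0 (inord (n + (n - i)).+1)) e.
by rewrite coef_row_r ?leq_subr// subKn// mxE.
Qed.

Theorem theorem1p4 (R : realType) (n : nat) (hn : (4 <= n)%N) :
  exists Sigma : set (CP R (2 * n + 1)),
    proper_algebraic_subset Sigma /\
    forall p q : {poly Cplx R},
      (size p <= n.+1)%N -> (size q <= n.+1)%N -> q != 0 ->
      (forall x : CP R (2 * n + 1),
         has_hcoords x (coef_row n p q) -> ~ Sigma x) ->
      forall (c : Cplx R) (f g : Cplx R -> option (Cplx R)),
        meromorphic f -> meromorphic g -> nonconstant f -> nonconstant g ->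
        mero_eq (rat_comp p q f) (scale_fun c (rat_comp p q g)) ->
        c = 1 /\ (forall z : Cplx R, f z = g z).
Proof.
have [Phi [Phi0 [d hd] hPhi]] := @bad_degenerate R n hn.
have line (v : 'rV[Cplx R]_(2 * n + 1).+1) : v != 0 ->
    exists x : CP R (2 * n + 1), has_hcoords x v.
  move=> v0; have dv : \dim <[v]>%VS == 1%N by rewrite dim_vline v0.
  by exists (exist (fun L : {vspace 'rV[Cplx R]_(2 * n + 1).+1} => \dim L == 1%N) _ dv).
exists (proj_zeros [set Phi]); split.
  split; first by exists [set Phi]; split=> // P ->; exists d.
  move=> eS; have [v Phiv] := mpoly_nonroot Phi0.
  (* The zero pair is degenerate, so [Phi] vanishes at 0 whatever its degree; a nonroot of [Phi] is
     thus nonzero and spans a point outside the zero locus. *)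
  have Phi00 : meval (fun=> 0) Phi = 0.
    have e : (fun i => coef_row n (0 : {poly Cplx R}) 0 0 i) = (fun=> 0).
      by apply/funext => i; rewrite mxE; case: ifP; rewrite coef0.
    rewrite -e; apply: hPhi; rewrite ?size_poly0//.
    by left; left; rewrite coef0.
  pose w : 'rV[Cplx R]_(2 * n + 1).+1 := \row_i v i.
  have wv : (fun i => w 0 i) = v by apply/funext => i; rewrite mxE.
  have w0 : w != 0.
    apply: contra_neq Phiv => w0; rewrite -wv w0 -[RHS]Phi00.
    by apply: meval_eq => i; rewrite mxE.
  have [x xw] := line w w0.
  have : proj_zeros [set Phi] x by rewrite eS.
  by move=> /(_ Phi erefl w xw); rewrite wv; apply/eqP.
move=> p q sp sq q0 hS c f g mf mg nf ng fg.
have [x hx] := line _ (coef_row_neq0 p sq q0).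
have nd : ~ degenerate n p q.
  (* [proj_zeros] quantifies over all generators of the line, and homogeneity carries the vanishing
     from [coef_row n p q] to each of them. *)
  move=> /(hPhi p q sp sq) z; apply: (hS x hx) => P -> v xv.
  have /vlineP[k ->] : v \in <[coef_row n p q]>%VS.
    have <- : <[v]>%VS = <[coef_row n p q]>%VS by rewrite -hx -xv.
    exact: memv_line.
  transitivity (meval (fun i => k * coef_row n p q 0 i) Phi).
    by apply: meval_eq => i; rewrite mxE.
  by rewrite (meval_scale _ _ hd) z mulr0.
exact: (generic_unique hn (nondegenerate_generic hn sp sq nd) mf mg nf ng fg).
Qed.
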